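(* Let $n,N\ge2$, let $F\colon\mathbb{R}^{N\times n}\to\mathbb{R}$ be continuous and of linear growth (that is, there is $L>0$ with $|F(z)|\le L(|z|+1)$ for all $z$), let $\Omega\subset\mathbb{R}^n$ be a bounded Lipschitz domain and let $g\in W^{1,1}(\Omega,\mathbb{R}^N)$. Then all minimizing sequences for the variational problem $$\inf_{u\in W^{1,1}_g(\Omega,\mathbb{R}^N)}\int_\Omega F(\nabla u)\,dx$$ are bounded in $W^{1,1}$ if and only if there exist $\ell>0$ and $z_0\in\mathbb{R}^{N\times n}$ such that $F-\ell E$ is quasiconvex at $z_0$.
   Context: $W^{1,1}_g(\Omega,\mathbb{R}^N)=g+W^{1,1}_0(\Omega,\mathbb{R}^N)$ is the Dirichlet class determined by $g$. $E(z)=\sqrt{1+|z|^2}-1$ for $z\in\mathbb{R}^{N\times n}$, with $|\cdot|$ the Euclidean norm. A continuous $G\colon\mathbb{R}^{N\times n}\to\mathbb{R}$ is quasiconvex at $z_0$ if $G(z_0)\le\int_{(0,1)^n}G(z_0+\nabla\varphi(x))\,dx$ for all compactly supported Lipschitz maps $\varphi\colon(0,1)^n\to\mathbb{R}^N$. *)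

(* Defs.v *)
From HB Require Import structures.
From mathcomp Require Import all_boot all_order all_algebra.
From mathcomp Require Import all_classical all_reals all_analysis.

Set Implicit Arguments.
Unset Strict Implicit.
Unset Printing Implicit Defensive.

Import Order.TTheory GRing.Theory Num.Theory.
Import numFieldNormedType.Exports.

Local Open Scope classical_set_scope.
Local Open Scope ring_scope.

(* Points of R^n are row vectors 'rV[R]_n, with the topology and the
   (sup-norm) normed structure of the library.  Their Borel sigma-algebra is
   the one generated by the n coordinate functions, as the library does for
   n.-tuple. *)
Section rV_measurable.
Context {R : realType} (n : nat).

Let coors : 'I_n -> 'rV[R]_n -> R := fun i x => x ord0 i.

Let rV_set0 : g_sigma_preimage coors set0.
Proof. exact: sigma_algebra0. Qed.

Let rV_setC A : g_sigma_preimage coors A -> g_sigma_preimage coors (~` A).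
Proof. exact: sigma_algebraC. Qed.

Let rV_bigcup (F : (set 'rV[R]_n)^nat) :
  (forall i, g_sigma_preimage coors (F i)) ->
  g_sigma_preimage coors (\bigcup_i (F i)).
Proof. exact: sigma_algebra_bigcup. Qed.

HB.instance Definition _ := @isMeasurable.Build
  (measure_tuple_display default_measure_display) 'rV[R]_n
  (g_sigma_preimage coors) rV_set0 rV_setC rV_bigcup.

Lemma measurable_coord (i : 'I_n) :
  measurable_fun [set: 'rV[R]_n] (fun x : 'rV[R]_n => x ord0 i).
Proof.
move=> _ Y mY; rewrite setTI; apply: sub_sigma_algebra => /=.
rewrite -bigcup_seq/=; exists i => /=; first by rewrite mem_index_enum.
by exists Y => //; rewrite setTI.
Qed.

Lemma measurable_fun_rVP d (T : measurableType d) (f : T -> 'rV[R]_n) :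
  (forall i, measurable_fun [set: T] (fun t => f t ord0 i)) ->
  measurable_fun [set: T] f.
Proof.
move=> mf _ A mA; rewrite setTI.
suff : measurable `<=` [set B : set 'rV[R]_n | measurable (f @^-1` B)] by apply.
apply: smallest_sub => [|B].
  split => [|B mB|F mF] /=.
  - by rewrite preimage_set0.
  - by rewrite setTD -preimage_setC; exact: measurableC.
  - by rewrite preimage_bigcup; exact: bigcupT_measurable.
rewrite -bigcup_seq/= => -[i _ [Y mY <-]] /=.
rewrite setTI -comp_preimage -[X in measurable X]setTI.
exact: mf.
Qed.

End rV_measurable.

(* Lebesgue measure on R^n, by induction on n: unit mass on R^0, and on
   R^(1+n) the image of the product of the one-dimensional Lebesgue measure
   with the n-dimensional one under (t, x) |-> (t, x_1, ..., x_n). *)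
Section lebesgue_rV.
Context {R : realType}.

Definition rV_cons n (p : measurableTypeR R * 'rV[R]_n) : 'rV[R]_n.+1 :=
  \row_(i < n.+1) oapp (fun j : 'I_n => p.2 ord0 j) p.1 (unlift ord0 i).

Definition rV_uncons n (x : 'rV[R]_n.+1) : measurableTypeR R * 'rV[R]_n :=
  (x ord0 ord0, \row_(j < n) x ord0 (lift ord0 j)).

Lemma rV_consK n : cancel (@rV_cons n) (@rV_uncons n).
Proof.
move=> [t x]; rewrite /rV_uncons /rV_cons mxE unlift_none/=; congr (_, _).
by apply/rowP => j; rewrite !mxE liftK.
Qed.

Lemma measurable_rV_cons n : measurable_fun [set: _] (@rV_cons n).
Proof.
apply: measurable_fun_rVP => i; rewrite /rV_cons.
case: (unliftP ord0 i) => [j|] ->.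
  apply: (eq_measurable_fun
    ((fun x : 'rV[R]_n => x ord0 j) \o
      (snd : measurableTypeR R * 'rV[R]_n -> 'rV[R]_n))).
    by move=> p _; rewrite mxE liftK.
  by apply: measurableT_comp => //; exact: measurable_coord.
apply: (eq_measurable_fun (fst : measurableTypeR R * 'rV[R]_n -> R)).
  by move=> p _; rewrite mxE unlift_none.
exact: measurable_fst.
Qed.

Lemma measurable_rV_uncons n : measurable_fun [set: _] (@rV_uncons n).
Proof.
apply/measurable_fun_pairP; split => /=.
  exact: measurable_coord.
apply: measurable_fun_rVP => j /=.
apply: (eq_measurable_fun (fun x : 'rV[R]_n.+1 => x ord0 (lift ord0 j))).
  by move=> x _; rewrite /= mxE.
exact: measurable_coord.
Qed.

Lemma sigma_finite_product d1 d2 (T1 : measurableType d1)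
    (T2 : measurableType d2) (m1 : {sigma_finite_measure set T1 -> \bar R})
    (m2 : {sigma_finite_measure set T2 -> \bar R}) :
  sigma_finite setT (m1 \x m2)%E.
Proof.
have /sigma_finiteP[F [TF ndF Foo]] := sigma_finiteT m1.
have /sigma_finiteP[G [TG ndG Goo]] := sigma_finiteT m2.
exists (fun n => F n `*` G n).
  rewrite -setXTT TF TG predeqE => -[x y]; split.
    move=> [/= [n _ Fnx] [k _ Gky]]; exists (maxn n k) => //; split.
    - by move: x Fnx; exact/subsetPset/ndF/leq_maxl.
    - by move: y Gky; exact/subsetPset/ndG/leq_maxr.
  by move=> [n _ []/= ? ?]; split; exists n.
move=> k; have [? ?] := Foo k; have [? ?] := Goo k.
split; first exact: measurableX.
by rewrite product_measure1E// lte_mul_pinfty// ge0_fin_numE.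
Qed.

Section step.
Context (n : nat) (mu : {sigma_finite_measure set 'rV[R]_n -> \bar R}).

Definition lebesgue_rV_step : set 'rV[R]_n.+1 -> \bar R :=
  pushforward (lebesgue_measure \x mu)%E (@rV_cons n).

Let mT (A : set 'rV[R]_n.+1) : measurable A -> measurable (@rV_cons n @^-1` A).
Proof.
by move=> mA; rewrite -[X in measurable X]setTI; exact: measurable_rV_cons.
Qed.

Let step0 : lebesgue_rV_step set0 = 0%E.
Proof. by rewrite /lebesgue_rV_step /pushforward preimage_set0 measure0. Qed.

Let step_ge0 A : (0 <= lebesgue_rV_step A)%E.
Proof. exact: (measure_ge0 (product_measure1 lebesgue_measure mu)). Qed.

Let step_sigma_additive : semi_sigma_additive lebesgue_rV_step.
Proof.
move=> F mF tF mUF; rewrite /lebesgue_rV_step /pushforward preimage_bigcup.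
apply: measure_semi_sigma_additive.
- by move=> k; exact: mT.
- apply/trivIsetP => /= i j _ _ ij; rewrite -preimage_setI.
  by move/trivIsetP : tF => /(_ _ _ _ _ ij) ->//; rewrite preimage_set0.
- by rewrite -preimage_bigcup; exact: mT.
Qed.

HB.instance Definition _ := isMeasure.Build _ _ _ lebesgue_rV_step
  step0 step_ge0 step_sigma_additive.

Let step_sigma_finite : sigma_finite setT lebesgue_rV_step.
Proof.
have [F FT Foo] := sigma_finite_product lebesgue_measure mu.
exists (fun k => @rV_uncons n @^-1` F k).
  by rewrite -preimage_bigcup -FT preimage_setT.
move=> k; have [mFk Fkoo] := Foo k; split.
  by rewrite -[X in measurable X]setTI; exact: measurable_rV_uncons.
rewrite /lebesgue_rV_step /pushforward -comp_preimage.
rewrite (_ : _ \o _ = id)// ?preimage_id//.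
by apply/funext => p; exact: rV_consK.
Qed.

HB.instance Definition _ := @Measure_isSigmaFinite.Build _ _ _
  lebesgue_rV_step step_sigma_finite.

End step.

Fixpoint lebesgue_rV (n : nat) :
    {sigma_finite_measure set 'rV[R]_n -> \bar R} :=
  if n is m.+1
  then [the {sigma_finite_measure set 'rV[R]_m.+1 -> \bar R} of
         lebesgue_rV_step (lebesgue_rV m)]
  else [the {sigma_finite_measure set 'rV[R]_0 -> \bar R} of
         dirac (0 : 'rV[R]_0)].

End lebesgue_rV.

Lemma lebesgue_rV_box {R : realType} (n : nat) (A : 'I_n -> set R) :
  (forall i, measurable (A i)) ->
  lebesgue_rV n [set x : 'rV[R]_n | forall i, A i (x ord0 i)] =
  (\prod_(i < n) lebesgue_measure (A i))%E.
Proof.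
elim: n A => [|n IHn] A mA.
  rewrite big_ord0 /= diracE mem_set//; by case.
rewrite big_ord_recl /=.
rewrite /lebesgue_rV_step /pushforward.
rewrite [X in product_measure1 _ _ X](_ : _ =
    A ord0 `*` [set x : 'rV[R]_n | forall i, A (lift ord0 i) (x ord0 i)]).
  rewrite product_measure1E//; last first.
    rewrite [X in measurable X](_ : _ =
        \big[setI/setT]_(i < n) ((fun x : 'rV[R]_n => x ord0 i) @^-1`
          A (lift ord0 i))); last first.
      rewrite -bigcap_seq; apply/seteqP; split => [x + i _|x + i]; first exact.
      by apply; rewrite /= mem_index_enum.
    elim/big_ind : _ => //; first by move=> *; exact: measurableI.
    move=> i _; rewrite -[X in measurable X]setTI.
    exact: measurable_coord.
  - exact: mA.
  - by congr (_ * _)%E; exact: (IHn (fun i => A (lift ord0 i)) (fun i => mA _)).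
apply/seteqP; split => [[t x] h|[t x] [/= h1 h2] i].
  split => [|i] /=.
    by have := h ord0; rewrite mxE unlift_none.
  by have := h (lift ord0 i); rewrite mxE liftK.
by rewrite mxE; case: unliftP => [j|] ->.
Qed.

Section norms.
Context {R : realType}.

(* Euclidean (Frobenius) norm; the norm `|z| of the library is the sup norm *)
Definition enorm m n (z : 'M[R]_(m, n)) : R :=
  Num.sqrt (\sum_i \sum_j z i j ^+ 2).

Definition Eint m n (z : 'M[R]_(m, n)) : R := Num.sqrt (1 + enorm z ^+ 2) - 1.

End norms.

Section sobolev.
Context {R : realType} (n N : nat).
Implicit Types (Omega : set 'rV[R]_n) (u v g phi : 'rV[R]_n -> 'rV[R]_N)
  (G : 'rV[R]_n -> 'M[R]_(N, n)).

Definition partial (V : normedModType R) (j : 'I_n) (f : 'rV[R]_n -> V) :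
  'rV[R]_n -> V := fun x => 'D_(delta_mx ord0 j) f x.

(* C^oo: all iterated partial derivatives are differentiable everywhere *)
Definition smooth (V : normedModType R) (f : 'rV[R]_n -> V) :=
  forall (s : seq 'I_n) (x : 'rV[R]_n),
    differentiable (foldr (@partial V) f s) x.

Definition compactly_supported (V : normedModType R) Omega
    (f : 'rV[R]_n -> V) :=
  exists K : set 'rV[R]_n,
    [/\ compact K, K `<=` Omega & forall x, ~ K x -> f x = 0].

Definition test_function (V : normedModType R) Omega (f : 'rV[R]_n -> V) :=
  smooth f /\ compactly_supported Omega f.

Definition mx_integrable p q Omega (f : 'rV[R]_n -> 'M[R]_(p, q)) :=
  forall i j, (lebesgue_rV n).-integrable Omega (fun x => (f x i j)%:E).

(* Functions on Omega are represented by functions on R^n; their values outside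
   Omega play no role.  Row i, column j of the gradient is d_j u_i. *)
Definition weak_gradient Omega u G :=
  [/\ mx_integrable Omega u, mx_integrable Omega G &
    forall (i : 'I_N) (j : 'I_n) (psi : 'rV[R]_n -> R),
      test_function Omega psi ->
      \int[lebesgue_rV n]_(x in Omega) (u x ord0 i * partial j psi x) =
      - \int[lebesgue_rV n]_(x in Omega) (G x i j * psi x)].

(* A representative of the weak gradient, which is unique up to null sets; the
   zero function if there is no integrable weak gradient. *)
Definition wgrad Omega u : 'rV[R]_n -> 'M[R]_(N, n) :=
  xget (fun=> 0) [set G | weak_gradient Omega u G].

Definition W11 Omega : set ('rV[R]_n -> 'rV[R]_N) :=
  [set u | exists G, weak_gradient Omega u G].

Definition W11norm Omega u : \bar R :=
  (\int[lebesgue_rV n]_(x in Omega) (enorm (u x))%:E +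
   \int[lebesgue_rV n]_(x in Omega) (enorm (wgrad Omega u x))%:E)%E.

(* closure of C_c^oo(Omega, R^N) in W^{1,1} *)
Definition W11_0 Omega : set ('rV[R]_n -> 'rV[R]_N) :=
  [set v | W11 Omega v /\
    forall e : R, 0 < e -> exists2 phi, test_function Omega phi &
      (W11norm Omega (v \- phi)%R < e%:E)%E].

Definition dirichlet_class Omega g : set ('rV[R]_n -> 'rV[R]_N) :=
  [set g \+ v | v in W11_0 Omega].

Definition energy (F : 'M[R]_(N, n) -> R) Omega u : \bar R :=
  (\int[lebesgue_rV n]_(x in Omega) (F (wgrad Omega u x))%:E)%E.

(* The infimum may be -oo; then the energies of a minimizing sequence tend
   to -oo. *)
Definition minimizing_sequence F Omega g (u : nat -> 'rV[R]_n -> 'rV[R]_N) :=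
  (forall k, dirichlet_class Omega g (u k)) /\
  energy F Omega (u k) @[k --> \oo] -->
    ereal_inf (energy F Omega @` dirichlet_class Omega g).

Definition W11_bounded Omega (u : nat -> 'rV[R]_n -> 'rV[R]_N) :=
  exists M : R, forall k, (W11norm Omega (u k) <= M%:E)%E.

Definition unit_cube : set 'rV[R]_n := [set x | forall j, 0 < x ord0 j < 1].

(* A Lipschitz map is differentiable almost everywhere (Rademacher) and its
   classical gradient is its weak gradient. *)
Definition quasiconvex_at (G : 'M[R]_(N, n) -> R) (z0 : 'M[R]_(N, n)) :=
  forall phi, compactly_supported unit_cube phi ->
    [lipschitz phi x | x in unit_cube] ->
    ((G z0)%:E <=
     \int[lebesgue_rV n]_(x in unit_cube) (G (z0 + wgrad unit_cube phi x)%R)%:E)%E.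

(* Near each boundary point, after an orthogonal change of coordinates
   y = x *m A, Omega is the epigraph in direction y_j of a Lipschitz function
   of the n.-1 other coordinates. *)
Definition lipschitz_boundary Omega :=
  forall x0, (closure Omega `\` interior Omega) x0 ->
    exists (A : 'M[R]_n) (j : 'I_n) (gamma : 'rV[R]_n.-1 -> R),
      [/\ A *m A^T = 1%:M, lipschitz gamma &
        \forall x \near x0,
          Omega x <-> gamma (col' j (x *m A)) < (x *m A) ord0 j].

Definition bounded_lipschitz_domain Omega :=
  [/\ open Omega, connected Omega, Omega !=set0, bounded_set Omega &
    lipschitz_boundary Omega].

End sobolev.

(* Main.v *)
Require Import Defs.
From HB Require Import structures.
From mathcomp Require Import all_boot all_order all_algebra.
From mathcomp Require Import all_classical all_reals all_analysis.
From mathcomp Require Import measurable_realfun ring lra.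
Set Implicit Arguments.
Unset Strict Implicit.
Unset Printing Implicit Defensive.
Import Order.TTheory GRing.Theory Num.Theory.
Import numFieldNormedType.Exports.
Local Open Scope classical_set_scope.
Local Open Scope ring_scope.

(** Write H for the integrand F - l E.  Both implications compare matrix fields
    that need not be gradients with the gradients of smooth compactly supported
    maps, by means of two facts.

    Gradients are flexible: on a bounded open set every integrable field z agrees,
    up to an error tau and off a set of measure tau, with the gradient of a test
    function, the L^1 norm of which is at most a dimensional constant times that
    of z, plus tau ([lusin_gradient], built from the cut-off linear maps of
    [cell_potential]).  And an integrand of linear growth depends continuously in
    measure on the field, the exceptional set costing at most a constant times the
    L^1 distance there ([superposition_close]).

    Suppose that H is quasiconvex at z0.  By scaling, the integral of H(z0 + grad phi)
    over the domain is at least its measure times H(z0), for every test function phi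
    ([quasiconvex_domain]).  The gradient of a map u = g + v of the Dirichlet class
    differs from z0 + grad phi, with phi a test function near v, by a field whose L^1
    norm is bounded independently of u.  Replacing that field by a gradient bounds
    the H-energy from below on the whole class ([energy_lower_bound]).  Hence l times
    the integral of E(grad u) is at most the F-energy plus a constant, and
    Poincare's inequality bounds u itself ([norm_bound]).

    Conversely, suppose that F - l E is nowhere quasiconvex, for every l > 0.  Then
    its energy on the test functions of the cube is unbounded below, for every l
    ([quasiconvex_of_bounded_below]).  Indeed, if the energies of F - l E were
    bounded below, a near-minimiser for F - (l/2) E would have a bounded gradient on
    half of the cube; there the failure of quasiconvexity yields, by compactness, a
    uniform gain ([uniform_gain]), and inserting these gains in the cells of a fine
    grid would go below the infimum ([grid_gain]).  So there are test functions
    with a large E-energy and a comparatively small F-energy; shrinking them gives,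
    in an arbitrarily small box, an E-energy of at least T for an F-energy of little
    more than l T ([concentrate]).  In a small box the gradient of any given map can
    be nearly cancelled, at little cost, by that of a test function, and the
    concentrated map put on top: the F-energy rises by at most eta, and the E-energy
    is at least T ([perturb]).  With eta = 1/k and T = k along a minimizing sequence
    this produces an unbounded minimizing sequence.

    Quasiconvexity is tested with Lipschitz maps, everything else is done with smooth
    ones; mollification leads from the former to the latter
    ([compactly_supported_approx], [not_quasiconvex]). *)

(** * Measurability on matrix spaces *)

Lemma mx_ballE (R : realType) m n (x y : 'M[R]_(m, n)) (e : R) : 0 < e ->
  ball x e y <-> forall i j, `|x i j - y i j| < e.
Proof.
move=> e0; split; first by move=> [_ h] i j; exact: h.
by move=> h; split=> // i j; exact: h.
Qed.

Lemma mx_norm_ge (R : realType) m n (x : 'M[R]_(m, n)) i j : `|x i j| <= `|x|.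
Proof.
rewrite [leRHS]/Num.Def.normr/= mx_normrE.
exact: (@le_bigmax _ _ _ 0 (fun p : 'I_m * 'I_n => `|x p.1 p.2|) (i, j)).
Qed.

Lemma mx_norm_le (R : realType) m n (x : 'M[R]_(m, n)) c : 0 <= c ->
  (forall i j, `|x i j| <= c) -> `|x| <= c.
Proof.
move=> c0 h; rewrite [leLHS]/Num.Def.normr/= mx_normrE.
by apply: bigmax_le => // -[i j] _; exact: h.
Qed.

Lemma mx_norm_lt (R : realType) m n (x : 'M[R]_(m, n)) c : 0 < c ->
  (forall i j, `|x i j| < c) -> `|x| < c.
Proof.
move=> c0 h; rewrite [ltLHS]/Num.Def.normr/= mx_normrE.
by apply: bigmax_lt => // -[i j] _; exact: h.
Qed.

Section measurability.
Context {R : realType} d (T : measurableType d).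

Lemma measurable_mx_box m n (D : set T) (G : T -> 'M[R]_(m, n))
    (c : 'M[R]_(m, n)) (e : R) : measurable D ->
  (forall i j, measurable_fun D (fun x => G x i j)) ->
  measurable (D `&` [set x | forall i j, `|c i j - G x i j| < e]).
Proof.
move=> mD mG.
rewrite (_ : _ `&` _ =
   \bigcap_(ij in [set: option ('I_m * 'I_n)])
     (if ij is Some p then D `&` (fun x => G x p.1 p.2) @^-1`
        `](c p.1 p.2 - e), (c p.1 p.2 + e)[ else D)).
  apply: fin_bigcap_measurable => [|[[i j]|] _]; first exact: finite_finset.
    by apply: mG => //=.
  by [].
apply/seteqP; split => [x [Dx h] [[i j]|] _|x h] //=.
  split=> //; rewrite in_itv/=; have := h i j.
  by rewrite ltr_norml => /andP[]; lra.
split; first exact: (h None).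
move=> i j; have [_] := h (Some (i, j)) Logic.I.
by rewrite /= in_itv/= => /andP[]; rewrite ltr_norml; lra.
Qed.

(** A countable family of boxes with rational centres is a base of the topology,
    so that entrywise measurability suffices for the preimage of an open set. *)
Lemma measurable_mx_open m n (D : set T) (G : T -> 'M[R]_(m, n))
    (U : set 'M[R]_(m, n)) : measurable D ->
  (forall i j, measurable_fun D (fun x => G x i j)) ->
  open U -> measurable (D `&` G @^-1` U).
Proof.
move=> mD mG oU.
pose box (p : 'M[rat]_(m, n) * nat) :=
  [set z : 'M[R]_(m, n) | forall i j, `|ratr (p.1 i j) - z i j| < p.2.+1%:R^-1].
pose B p := if pselect (box p `<=` U) then D `&` G @^-1` (box p) else set0.
rewrite (_ : D `&` _ = \bigcup_p (B p)).
  apply: countable_bigcupT_measurable => [|p]; first exact: countableP.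
  rewrite /B; case: pselect => bU /=; last exact: measurable0.
  have := measurable_mx_box (map_mx ratr p.1) p.2.+1%:R^-1 mD mG.
  by under eq_set do under eq_forall do under eq_forall do rewrite mxE.
apply/seteqP; split => [x [Dx Ux]|x [p _]]; last first.
  by rewrite /B; case: pselect => //= bU [Dx bx]; split=> //; exact: bU.
have /nbhs_ballP[e /= e0 eU] : nbhs (G x) U by exact: open_nbhs_nbhs.
have e20 : 0 < e / 2 by lra.
pose k := Num.truncn (e / 2)^-1.
have k1 : (k.+1%:R : R)^-1 < e / 2.
  rewrite invf_plt ?posrE//.
  exact: truncnS_gt.
have k0 : 0 < (k.+1%:R : R)^-1 by rewrite invr_gt0.
have /choice[q hq] : forall p : 'I_m * 'I_n, exists q : rat,
    ratr q \in `](G x p.1 p.2 - k.+1%:R^-1), (G x p.1 p.2 + k.+1%:R^-1)[.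
  move=> p; apply: rat_in_itvoo.
  by rewrite ltrBlDr -addrA ltrDl addr_gt0.
have bx : box (\matrix_(i, j) q (i, j), k) (G x).
  move=> i j /=; have := hq (i, j); rewrite in_itv/= mxE ltr_norml => /andP[].
  by move: (ratr _) (_^-1) (G x i j) => a b c; lra.
exists (\matrix_(i, j) q (i, j), k) => //; rewrite /B.
case: pselect => //= -[] z bz; apply: eU; apply/mx_ballE => // i j.
have := bx i j; have := bz i j; rewrite /= => h1 h2.
have := ler_distD (ratr ((\matrix_(i, j) q (i, j)) i j)) (G x i j) (z i j).
rewrite distrC in h2 => /le_lt_trans; apply; apply: (lt_trans (ltrD h2 h1)).
move: k1; move: (k.+1%:R^-1) => r; lra.
Qed.

Lemma measurable_comp_mx m n (D : set T) (G : T -> 'M[R]_(m, n))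
    (F : 'M[R]_(m, n) -> R) : measurable D -> continuous F ->
  (forall i j, measurable_fun D (fun x => G x i j)) ->
  measurable_fun D (F \o G).
Proof.
move=> mD cF mG.
apply: (measurability (@RGenOInfty.G R)).
  exact: RGenOInfty.measurableE.
move=> _ [_ [a ->] <-]; rewrite comp_preimage.
apply: measurable_mx_open => //; move/continuousP : cF; apply.
by have := @open_gt R a; rewrite set_itvoy.
Qed.

End measurability.

Lemma measurable_rV_open (R : realType) n (U : set 'rV[R]_n) :
  open U -> measurable U.
Proof.
move=> oU; rewrite -[U]setTI; apply: (measurable_mx_open (G := id)) => //.
by move=> i j; rewrite (ord1 i); exact: measurable_coord.
Qed.

Lemma measurable_rV_continuous (R : realType) n (D : set 'rV[R]_n)
    (f : 'rV[R]_n -> R) : measurable D -> continuous f -> measurable_fun D f.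
Proof.
move=> mD cf; apply: (measurable_comp_mx (G := id)) => // i j.
by rewrite (ord1 i); apply: measurable_funTS; exact: measurable_coord.
Qed.

(** * Affine changes of variables *)

Section affine_change.
Context {R : realType}.

Definition aff (V : lmodType R) (c : V) (r : R) (x : V) : V := c + r *: x.

(** By uniqueness of Lebesgue measure: r times its image under the affine map
    gives each interval its length. *)
Lemma aff1_lebesgue (c r : R) (A : set (measurableTypeR R)) : 0 < r ->
  measurable A ->
  lebesgue_measure ((fun t : R => c + r * t) @^-1` A) =
    ((r^-1)%:E * lebesgue_measure A)%E.
Proof.
move=> r0 mA.
pose f : measurableTypeR R -> measurableTypeR R := fun t => c + r * t.
have mf : measurable_fun setT f.
  by apply: measurable_funD => //; exact: measurable_funM.
pose r' : {nonneg R} := NngNum (ltW r0).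
have := @lebesgue_measure_unique R (mscale r' (pushforward lebesgue_measure f)).
move=> /(_ mf) E; rewrite [in RHS]E//; last first.
  move=> _ [[a b] _ <-] /=; rewrite /mscale/= /pushforward.
  rewrite (_ : _ @^-1` _ = `](a - c) / r, (b - c) / r]%classic); last first.
    apply/seteqP; split => t /=; rewrite !in_itv/= /f => /andP[h1 h2].
      by rewrite ltr_pdivrMr// ler_pdivlMr//; apply/andP; split; lra.
    move: h1 h2; rewrite ltr_pdivrMr// ler_pdivlMr// => h1 h2.
    by apply/andP; split; lra.
  rewrite !lebesgue_measure_itv/= !lte_fin ltr_pM2r ?invr_gt0// ltrD2r.
  case: ifPn => ab; last by rewrite mule0.
  by rewrite -!EFinB -EFinM; congr EFin; field; rewrite gt_eqF.
by rewrite /mscale/= /pushforward muleA -EFinM mulVf ?gt_eqF// mul1e.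
Qed.

Definition rect n : set (set 'rV[R]_n) :=
  [set B | exists2 A : 'I_n -> set R, (forall i, measurable (A i)) &
    B = [set x : 'rV[R]_n | forall i, A i (x ord0 i)]].

Lemma measurable_rect n (A : 'I_n -> set R) : (forall i, measurable (A i)) ->
  measurable [set x : 'rV[R]_n | forall i, A i (x ord0 i)].
Proof.
move=> mA.
rewrite (_ : [set x | _] =
  \bigcap_(i in [set: 'I_n]) ((fun x : 'rV[R]_n => x ord0 i) @^-1` A i)).
  apply: fin_bigcap_measurable => [|i _]; first exact: finite_finset.
  by rewrite -[X in measurable X]setTI; exact: measurable_coord.
by apply/seteqP; split => x h // i; [move=> _; exact: h|exact: h].
Qed.

(** The Borel structure comes from the coordinate functions, whereas the
    uniqueness of measures needs generators that are stable under
    intersection. *)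
Lemma measurable_rectE n :
  @measurable _ 'rV[R]_n = <<s @rect n >>.
Proof.
apply/seteqP; split.
  apply: smallest_sub => [|B]; first exact: smallest_sigma_algebra.
  rewrite -bigcup_seq/= => -[i _ [Y mY <-]].
  apply: sub_sigma_algebra; exists (fun j => if j == i then Y else setT).
    by move=> j; case: ifP.
  rewrite setTI; apply/seteqP; split => x /= h.
    by move=> j; case: eqP => // ->.
  by have := h i; rewrite eqxx.
apply: smallest_sub; first exact: sigma_algebra_measurable.
by move=> _ [A mA ->]; exact: measurable_rect.
Qed.

Lemma measurable_aff n (c : 'rV[R]_n) r : measurable_fun setT (aff c r).
Proof.
apply: measurable_fun_rVP => i.
rewrite (_ : (fun _ => _) = fun x : 'rV[R]_n => c ord0 i + r * x ord0 i).
  apply: measurable_funD => //; apply: measurable_funM => //.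
  exact: measurable_coord.
by apply/funext => x; rewrite !mxE.
Qed.

(** By uniqueness of a measure given on rectangles, to the sides of which the
    one-dimensional case applies. *)
Lemma lebesgue_rV_aff n (c : 'rV[R]_n) r (A : set 'rV[R]_n) : 0 < r ->
  measurable A ->
  lebesgue_rV n (aff c r @^-1` A) = ((r^-1 ^+ n)%:E * lebesgue_rV n A)%E.
Proof.
move=> r0 mA.
pose f : 'rV[R]_n -> 'rV[R]_n := aff c r.
have rn0 : 0 <= r ^+ n by rewrite exprn_ge0// ltW.
pose r' : {nonneg R} := NngNum rn0.
pose g k := [set x : 'rV[R]_n | forall i, `](- k%:R), k%:R[%classic (x ord0 i)].
have mg k : forall i : 'I_n, measurable (`](- k%:R : R), k%:R[%classic) by [].
have E : lebesgue_rV n A = mscale r' (pushforward (lebesgue_rV n) f) A.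
  move=> mf; apply: (@measure_unique _ R 'rV[R]_n (@rect n) g (@measurable_rectE n)) => //.
  - move=> _ _ [B mB ->] [C mC ->]; exists (fun i => B i `&` C i).
      by move=> i; exact: measurableI.
    apply/seteqP; split => [x [h1 h2] i|x h]; first by split.
    by split=> i; have [] := h i.
  - by move=> k; exists (fun=> `](- k%:R : R), k%:R[%classic).
  - apply/seteqP; split => // x _.
    pose k := (Num.truncn `|x|).+1; exists k => // i /=.
    rewrite in_itv/= -ltr_norml; apply: (le_lt_trans _ (truncnS_gt _)).
    by rewrite [leRHS]mx_normrE (le_trans _ (le_bigmax _ _ (ord0, i))).
  - move=> _ [B mB ->]; rewrite /= /mscale/= /pushforward.
    rewrite (_ : _ @^-1` _ = [set x : 'rV[R]_n |
       forall i, ((fun t => c ord0 i + r * t) @^-1` B i) (x ord0 i)]); last first.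
      by apply/seteqP; split => x h i; have := h i; rewrite /aff/= !mxE.
    have mB' i : measurable ((fun t => c ord0 i + r * t) @^-1` B i).
      rewrite -[X in measurable X]setTI.
      have mf1 : measurable_fun setT (fun t : measurableTypeR R => c ord0 i + r * t).
        by apply: measurable_funD => //; exact: measurable_funM.
      exact: mf1.
    rewrite (lebesgue_rV_box mB) (lebesgue_rV_box mB').
    rewrite [in RHS](eq_bigr (fun i => (r^-1)%:E * lebesgue_measure (B i)))%E; last first.
      by move=> i _; exact: (aff1_lebesgue _ r0 (mB i)).
    rewrite -[n in r ^+ n]card_ord -prodr_const -prodEFin -big_split/=.
    apply: eq_bigr => i _.
    by rewrite muleA -EFinM mulfV ?gt_eqF// mul1e.
  - move=> k; apply: (eq_ind_r (fun z => z < +oo)%E _ (lebesgue_rV_box (mg k))).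
    suff : ((\prod_(i < n) lebesgue_measure (`](- (k%:R : R))%R, (k%:R : R)%R[%classic : set R))%E
      \is a fin_num)%E by rewrite fin_numE => /andP[_ ]; rewrite -ltey.
    apply: prode_fin_num => i _.
    by rewrite lebesgue_measure_itv/=; case: ifPn.
rewrite (E (measurable_aff c r)) /mscale/= /pushforward muleA -EFinM -exprMn mulVf ?gt_eqF//.
by rewrite expr1n mul1e.
Qed.

Lemma ge0_integral_aff n (c : 'rV[R]_n) r (D : set 'rV[R]_n)
    (f : 'rV[R]_n -> \bar R) : 0 < r -> measurable D -> measurable_fun D f ->
  (forall x, D x -> 0 <= f x)%E ->
  (\int[lebesgue_rV n]_(x in aff c r @^-1` D) f (aff c r x) =
   (r^-1 ^+ n)%:E * \int[lebesgue_rV n]_(x in D) f x)%E.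
Proof.
move=> r0 mD mf f0.
have := ge0_integral_pushforward (measurable_aff c r) (lebesgue_rV n) mD mf.
move=> /(_ _) <-; last by move=> x; rewrite inE; exact: f0.
have rn0 : 0 <= r^-1 ^+ n by rewrite exprn_ge0// invr_ge0 ltW.
have := ge0_integral_mscale (lebesgue_rV n) mD (NngNum rn0) mf f0.
move=> /= <-; apply: eq_measure_integral; first exact: measurable_aff.
by move=> mf' A mA _; rewrite /mscale/= /pushforward lebesgue_rV_aff.
Qed.

Lemma measurable_preimage_aff n (c : 'rV[R]_n) r (D : set 'rV[R]_n) :
  measurable D -> measurable (aff c r @^-1` D).
Proof.
by move=> mD; rewrite -[X in measurable X]setTI; exact: measurable_aff.
Qed.

Lemma measurable_fun_aff n (c : 'rV[R]_n) r (D : set 'rV[R]_n)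
    d (T : measurableType d) (f : 'rV[R]_n -> T) :
  measurable_fun D f -> measurable D ->
  measurable_fun (aff c r @^-1` D) (fun x => f (aff c r x)).
Proof.
move=> mf mD; apply: (measurable_comp (F := D)) => //.
  by move=> _ [x ? <-].
by apply: measurable_funTS; exact: measurable_aff.
Qed.

Lemma integrable_aff n (c : 'rV[R]_n) r (D : set 'rV[R]_n)
    (f : 'rV[R]_n -> \bar R) : 0 < r -> measurable D ->
  (lebesgue_rV n).-integrable D f ->
  (lebesgue_rV n).-integrable (aff c r @^-1` D) (fun x => f (aff c r x)).
Proof.
move=> r0 mD /integrableP[mf foo]; apply/integrableP; split.
  exact: measurable_fun_aff.
rewrite (ge0_integral_aff c (f := fun x => `|f x|%E))//.
  by rewrite lte_mul_pinfty// lee_fin exprn_ge0// invr_ge0 ltW.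
exact: measurableT_comp.
Qed.

Lemma integral_aff n (c : 'rV[R]_n) r (D : set 'rV[R]_n)
    (f : 'rV[R]_n -> \bar R) : 0 < r -> measurable D ->
  (lebesgue_rV n).-integrable D f ->
  (\int[lebesgue_rV n]_(x in aff c r @^-1` D) f (aff c r x) =
   (r^-1 ^+ n)%:E * \int[lebesgue_rV n]_(x in D) f x)%E.
Proof.
move=> r0 mD fi; have mf := measurable_int _ fi.
rewrite integralE [in RHS]integralE muleBr//.
  congr (_ - _)%E.
    rewrite -(ge0_integral_aff c)//; last exact: measurable_funepos.
    by apply: eq_integral => x _; rewrite !funeposE.
  rewrite -(ge0_integral_aff c)//; last exact: measurable_funeneg.
  by apply: eq_integral => x _; rewrite !funenegE.
apply: fin_num_adde_defl.
by rewrite fin_numN; exact: integrable_neg_fin_num.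
Qed.

Lemma Rintegral_aff n (c : 'rV[R]_n) r (D : set 'rV[R]_n)
    (f : 'rV[R]_n -> R) : 0 < r -> measurable D ->
  (lebesgue_rV n).-integrable D (EFin \o f) ->
  \int[lebesgue_rV n]_(x in aff c r @^-1` D) f (aff c r x) =
   (r^-1 ^+ n) * \int[lebesgue_rV n]_(x in D) f x.
Proof.
move=> r0 mD fi; rewrite /Rintegral.
have := integral_aff c r0 mD fi; rewrite /= => ->.
by rewrite fineM//; exact: integrable_fin_num.
Qed.

End affine_change.

(** * Smooth functions *)

Section smooth_algebra.
Context {R : realType} {n : nat}.

(** Iterated partial derivatives are seldom available in closed form; a class of
    differentiable functions that is stable under partial derivatives dispenses
    with computing them. *)
Lemma smooth_coind (V : normedModType R) (P : ('rV[R]_n -> V) -> Prop) :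
  (forall f, P f -> (forall x, differentiable f x) /\
     forall j, P (partial j f)) ->
  forall f, P f -> smooth f.
Proof.
move=> hP f Pf s x.
suff : P (foldr (@partial R n V) f s) by move=> /hP[+ _]; exact.
by elim: s => //= j s /hP[_]; exact.
Qed.

Lemma smooth_differentiable (V : normedModType R) (f : 'rV[R]_n -> V) x :
  smooth f -> differentiable f x.
Proof. by move=> /(_ [::]); exact. Qed.

Lemma smooth_partial (V : normedModType R) (f : 'rV[R]_n -> V) j :
  smooth f -> smooth (partial j f).
Proof.
move=> sf s x; have := sf (rcons s j) x.
by rewrite -cats1 foldr_cat.
Qed.

Lemma smooth_continuous (V : normedModType R) (f : 'rV[R]_n -> V) :
  smooth f -> continuous f.
Proof.
by move=> sf x; apply: differentiable_continuous; exact: smooth_differentiable.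
Qed.

Inductive generated (B : set ('rV[R]_n -> R)) : ('rV[R]_n -> R) -> Prop :=
| generated_base f : B f -> generated B f
| generated_add f g : generated B f -> generated B g -> generated B (f \+ g)
| generated_mul f g : generated B f -> generated B g -> generated B (f \* g).

Lemma partialD (V : normedModType R) (f g : 'rV[R]_n -> V) j :
  (forall x, differentiable f x) -> (forall x, differentiable g x) ->
  partial j (fun x => f x + g x) = fun x => partial j f x + partial j g x.
Proof.
move=> df dg; apply/funext => x; rewrite /partial.
by apply: (@deriveD _ _ _ f g); apply: diff_derivable.
Qed.

Lemma partialM (f g : 'rV[R]_n -> R) j :
  (forall x, differentiable f x) -> (forall x, differentiable g x) ->
  partial j (fun x => f x * g x) =
  fun x => f x * partial j g x + g x * partial j f x.
Proof.
move=> df dg; apply/funext => x; rewrite /partial.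
by apply: (@deriveM _ _ f g); apply: diff_derivable.
Qed.

(** By the sum and product rules an algebra whose generators have their partial
    derivatives in the algebra is stable under differentiation. *)
Lemma generated_smooth (B : set ('rV[R]_n -> R)) :
  (forall f, B f -> (forall x, differentiable f x) /\
     forall j, generated B (partial j f)) ->
  forall f, generated B f -> smooth f.
Proof.
move=> hB; apply: smooth_coind => f.
elim=> {f} [f /hB//|f g _ [df pf] _ [dg pg]|f g gf [df pf] gg [dg pg]].
- split=> [x|j]; first exact: differentiableD.
  by rewrite partialD//; exact: generated_add.
- split=> [x|j]; first exact: differentiableM.
  rewrite partialM//; apply: generated_add; exact: generated_mul.
Qed.

Lemma smoothD (f g : 'rV[R]_n -> R) :
  smooth f -> smooth g -> smooth (fun x => f x + g x).
Proof.
move=> sf sg; refine (@generated_smooth [set f | smooth f] _ _ _) => [h sh|].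
  split=> [x|j]; first exact: smooth_differentiable.
  by apply: generated_base; exact: smooth_partial.
by apply: generated_add; exact: generated_base.
Qed.

Lemma smoothM (f g : 'rV[R]_n -> R) :
  smooth f -> smooth g -> smooth (fun x => f x * g x).
Proof.
move=> sf sg; refine (@generated_smooth [set f | smooth f] _ _ _) => [h sh|].
  split=> [x|j]; first exact: smooth_differentiable.
  by apply: generated_base; exact: smooth_partial.
by apply: generated_mul; exact: generated_base.
Qed.

Lemma partial_cst (V : normedModType R) (c : V) j :
  partial j (fun _ : 'rV[R]_n => c) = fun=> 0.
Proof. by apply/funext => x; rewrite /partial derive_cst. Qed.

Lemma smooth_cst (V : normedModType R) (c : V) : smooth (fun _ : 'rV[R]_n => c).
Proof.
apply: (@smooth_coind _ [set f | exists c, f = fun=> c]); last by exists c.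
move=> _ [d ->]; split=> [x|j]; first exact: differentiable_cst.
by exists 0; rewrite partial_cst.
Qed.

Lemma smooth_sum (I : Type) (r : seq I) (P : pred I) (F : I -> 'rV[R]_n -> R) :
  (forall i, P i -> smooth (F i)) ->
  smooth (fun x => \sum_(i <- r | P i) F i x).
Proof.
move=> sF; elim: r => [|i r IH].
  by under eq_fun do rewrite big_nil; exact: smooth_cst.
under eq_fun do rewrite big_cons.
have [Pi|] := boolP (P i) => //.
by apply: smoothD => //; exact: sF.
Qed.

Lemma smooth_prod (I : Type) (r : seq I) (P : pred I) (F : I -> 'rV[R]_n -> R) :
  (forall i, P i -> smooth (F i)) ->
  smooth (fun x => \prod_(i <- r | P i) F i x).
Proof.
move=> sF; elim: r => [|i r IH].
  by under eq_fun do rewrite big_nil; exact: smooth_cst.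
under eq_fun do rewrite big_cons.
have [Pi|] := boolP (P i) => //.
by apply: smoothM => //; exact: sF.
Qed.

Lemma smoothN (f : 'rV[R]_n -> R) : smooth f -> smooth (fun x => - f x).
Proof.
move=> sf; rewrite (_ : (fun _ => _) = fun x => -1 * f x).
  by apply: smoothM => //; exact: smooth_cst.
by apply/funext => x; rewrite mulN1r.
Qed.

Lemma partialV (f : 'rV[R]_n -> R) j :
  (forall x, f x != 0) -> (forall x, differentiable f x) ->
  partial j (fun x => (f x)^-1) = fun x => - partial j f x * (f x)^-1 * (f x)^-1.
Proof.
move=> f0 df; apply/funext => x; rewrite /partial deriveV//; last first.
  exact: diff_derivable.
by rewrite scaleNr expr2 invfM [_ *: _]mulrC !mulNr mulrA.
Qed.

(** The derivatives of 1/f are polynomials in 1/f and in smooth functions. *)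
Lemma smoothV (f : 'rV[R]_n -> R) :
  (forall x, f x != 0) -> smooth f -> smooth (fun x => (f x)^-1).
Proof.
move=> f0 sf.
refine (@generated_smooth ([set f | smooth f] `|` [set fun x => (f x)^-1]) _ _ _); last first.
  by apply: generated_base; right.
move=> g [sg|->]; (split=> [x|j]).
- exact: smooth_differentiable.
- by apply: generated_base; left; exact: smooth_partial.
- by apply: differentiableV => //; exact: smooth_differentiable.
- rewrite partialV//; last by move=> x; exact: smooth_differentiable.
  apply: generated_mul; last by apply: generated_base; right.
  apply: generated_mul; last by apply: generated_base; right.
  by apply: generated_base; left; apply: smoothN; exact: smooth_partial.
Qed.

Lemma partial_coord (k j : 'I_n) :
  partial j (fun x : 'rV[R]_n => x ord0 k) = fun=> (j == k)%:R.
Proof.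
apply/funext => x; rewrite /partial.
have := @derive_mx R _ 1 n (id : 'rV[R]_n -> 'rV[R]_n) x (delta_mx ord0 j).
move=> /(_ (@derivable_id _ _ _ _)); rewrite derive_id => /matrixP/(_ ord0 k).
by rewrite !mxE /= eq_sym.
Qed.

Lemma smooth_coord (k : 'I_n) : smooth (fun x : 'rV[R]_n => x ord0 k).
Proof.
refine (@generated_smooth ([set f | smooth f] `|` [set fun x : 'rV[R]_n => x ord0 k]) _ _ _); last first.
  by apply: generated_base; right.
move=> g [sg|->]; (split=> [x|j]).
- exact: smooth_differentiable.
- by apply: generated_base; left; exact: smooth_partial.
- exact: differentiable_coord.
- by rewrite partial_coord; apply: generated_base; left; exact: smooth_cst.
Qed.

Lemma partial_comp1 (h : R -> R) (l : 'rV[R]_n -> R) (j : 'I_n) x :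
  derivable h (l x) 1 -> differentiable l x ->
  partial j (h \o l) x = h^`()%classic (l x) * partial j l x.
Proof.
move=> dh dl; have dh' := (derivable1_diffP _ _).1 dh.
rewrite /partial deriveE; last exact: differentiable_comp.
rewrite diff_comp//= deriv1E//= -deriveE//.
by rewrite mulrC.
Qed.

Lemma differentiable_aff (c : 'rV[R]_n) r x : differentiable (aff c r) x.
Proof.
apply: differentiableD; first exact: differentiable_cst.
exact: differentiableZ.
Qed.

Lemma partial_aff (V : normedModType R) (f : 'rV[R]_n -> V) (c : 'rV[R]_n) r j :
  (forall x, differentiable f x) ->
  partial j (fun x => f (aff c r x)) = fun x => r *: partial j f (aff c r x).
Proof.
move=> df; apply/funext => x; rewrite /partial.
have da := differentiable_aff c r x.
rewrite (deriveE (f := f \o aff c r)); last exact: differentiable_comp.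
rewrite diff_comp//= -(deriveE (f := aff c r))// [in RHS](deriveE (f := f))//.
rewrite -linearZ/=; congr ('d f _ _).
rewrite (_ : aff c r = cst c + (r *: id)%R)//.
have di : derivable (id : 'rV[R]_n -> 'rV[R]_n) x (delta_mx ord0 j).
  exact: derivable_id.
rewrite deriveD; [|exact: derivable_cst|exact: derivableZ].
by rewrite derive_cst add0r deriveZ// derive_id.
Qed.

(** Each derivative contributes a factor r, whence the constant k. *)
Lemma smooth_aff (V : normedModType R) (f : 'rV[R]_n -> V) (c : 'rV[R]_n) r k :
  smooth f -> smooth (fun x => k *: f (aff c r x)).
Proof.
move=> sf.
refine (@smooth_coind _ [set h | exists k g, smooth g /\
  h = fun x => k *: g (aff c r x)] _ _ _); last by exists k, f.
move=> _ [a [g [sg ->]]]; split=> [x|j].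
  apply: differentiableZ; apply: differentiable_comp.
    exact: differentiable_aff.
  exact: smooth_differentiable.
exists (a * r), (partial j g); split; first exact: smooth_partial.
apply/funext => x; rewrite /partial deriveZ; last first.
  apply: diff_derivable; apply: differentiable_comp.
    exact: differentiable_aff.
  exact: smooth_differentiable.
have := partial_aff c r j (fun y => smooth_differentiable y sg).
by move=> /(congr1 (@^~ x)); rewrite /partial => ->; rewrite scalerA.
Qed.

Lemma partial_row N (f : 'rV[R]_n -> 'rV[R]_N) j x i :
  differentiable f x ->
  partial j (fun y => f y ord0 i) x = partial j f x ord0 i.
Proof.
move=> df; rewrite /partial derive_mx ?mxE//.
exact: diff_derivable.
Qed.

Lemma differentiable_row N (f : 'rV[R]_n -> 'rV[R]_N) x :
  (forall i, differentiable (fun y => f y ord0 i) x) -> differentiable f x.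
Proof.
move=> df.
rewrite (_ : f = \sum_(i < N)
  (fun y => f y ord0 i *: (delta_mx ord0 i : 'rV[R]_N))).
  by apply: differentiable_sum => i; exact: differentiableZl.
apply/funext => y; rewrite fct_sumE; exact: row_sum_delta.
Qed.

Lemma smooth_row N (f : 'rV[R]_n -> 'rV[R]_N) :
  (forall i, smooth (fun y => f y ord0 i)) -> smooth f.
Proof.
move=> sf.
refine (@smooth_coind 'rV[R]_N [set f : 'rV[R]_n -> 'rV[R]_N | forall i, smooth (fun y => f y ord0 i)] _ _ _) => //.
move=> g sg; have dg x : differentiable g x.
  by apply: differentiable_row => i; exact: smooth_differentiable.
split=> // j i.
rewrite (_ : (fun y => _) = partial j (fun y => g y ord0 i)).
  exact: smooth_partial.
by apply/funext => y; rewrite partial_row.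
Qed.

Lemma smooth_rowP N (f : 'rV[R]_n -> 'rV[R]_N) i :
  smooth f -> smooth (fun y => f y ord0 i).
Proof.
move=> sf.
refine (@smooth_coind _ [set h | exists2 g : 'rV[R]_n -> 'rV[R]_N, smooth g &
  h = fun y => g y ord0 i] _ _ _); last by exists f.
move=> _ [g sg ->]; split=> [x|j].
  apply: (@differentiable_comp _ _ _ _ g (fun y => y ord0 i)).
    exact: smooth_differentiable.
  exact: differentiable_coord.
exists (partial j g); first exact: smooth_partial.
apply/funext => y; rewrite partial_row//; exact: smooth_differentiable.
Qed.

End smooth_algebra.

(** * Flat functions and a smooth step *)

Section bump.
Context {R : realType}.

(** These functions, all derived from exp(-1/t), span a space that is stable
    under differentiation. *)
Definition flat (k : nat) (t : R) : R :=
  if 0 < t then t^-1 ^+ k * expR (- t^-1) else 0.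

(** From the power series of the exponential; the square on the right makes the
    derivative at 0 vanish. *)
Lemma flat_le k (t : R) : 0 <= flat k t <= k.+2`!%:R * t ^+ 2.
Proof.
rewrite /flat; case: ifPn => t0; last first.
  by rewrite lexx/= mulr_ge0// sqr_ge0.
have u0 : 0 < t^-1 by rewrite invr_gt0.
rewrite mulr_ge0 ?expR_ge0//=; last by rewrite exprn_ge0// ltW.
rewrite expRN ler_pdivrMr ?expR_gt0//.
have := expR_ge1Dxn k.+1 (ltW u0).
set e := expR _ => h.
have {}h : t^-1 ^+ k.+2 <= e * k.+2`!%:R.
  rewrite -ler_pdivrMr ?ltr0n ?fact_gt0//; apply: le_trans h.
  by rewrite lerDr.
have -> : t^-1 ^+ k = t ^+ 2 * t^-1 ^+ k.+2.
  by rewrite -[k.+2]addn2 exprD mulrCA -exprMn mulfV ?gt_eqF// expr1n mulr1.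
rewrite [leRHS](_ : _ = t ^+ 2 * (e * k.+2`!%:R)) ?ler_wpM2l ?sqr_ge0//.
by rewrite mulrAC mulrC; congr (_ * _); rewrite mulrC.
Qed.

Lemma is_derive_flat k (t : R) :
  is_derive t 1 (flat k) (- k%:R * flat k.+1 t + flat k.+2 t).
Proof.
have [t0|t0|t0] := ltgtP t 0.
- have nE : \near t, cst 0 t = flat k t.
    near=> s; rewrite /flat/= ltNge ltW//=.
    by near: s; exact: lt_nbhsl.
  apply: (near_eq_is_derive nE).
  apply: (is_derive_eq (is_derive_cst _ _ _)).
  by rewrite /flat ltNge ltW//= mulr0 addr0.
- have nE : \near t, t^-1 ^+ k * expR (- t^-1) = flat k t.
    near=> s; rewrite /flat/=; case: ifPn => //; rewrite -leNgt => s0.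
    exfalso; move: s0; apply/negP; rewrite -ltNge.
    by near: s; exact: lt_nbhsr.
  apply: (near_eq_is_derive nE).
  have tn0 : t != 0 by rewrite gt_eqF.
  have dV : is_derive t 1 (fun s : R => s^-1) (- t ^- 2).
    apply: is_derive_eq; first exact: (is_deriveV (f := id)).
    by rewrite /= [_ *: _]mulr1.
  have := is_deriveX k dV; rewrite exprfctE => dX.
  have dE : is_derive t 1 (fun s : R => expR (- s^-1)) (expR (- t^-1) * (t ^- 2)).
    apply: (@is_derive1_comp _ expR (fun s : R => - s^-1)).
    by apply: (is_derive_eq (is_deriveN dV)); rewrite opprK.
  have := is_deriveM dX dE; rewrite /=.
  move=> h; apply: (is_derive_eq h).
  rewrite /flat t0 /GRing.scale/=.
  case: k {nE dX h} => [|k]; first by rewrite !expr0 !mulr0n; field.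
  rewrite !exprS /=; move: (expR _) (t^-1 ^+ k) (k.+1%:R : R) => u v c.
  by field.
- rewrite t0 {2 3}/flat ltxx mulr0 addr0.
  have flat0 : flat k 0 = 0 by rewrite /flat ltxx.
  suff : h^-1 *: (flat k (h *: 1 + 0) - flat k 0) @[h --> 0^'] --> (0 : R).
    by move=> h; apply: DeriveDef; [apply/cvg_ex; exists 0|exact: cvg_lim].
  apply/cvgr0Pnorm_lt => e e0.
  near=> h.
  rewrite flat0 subr0 addr0 [h *: 1]mulr1 normrM normrV ?unitfE; last first.
    by near: h; exact: nbhs_dnbhs_neq.
  have h0 : h != 0 by near: h; exact: nbhs_dnbhs_neq.
  have /andP[f0 fle] := flat_le k h.
  rewrite mulrC ltr_pdivrMr ?normr_gt0// (ger0_norm f0).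
  apply: (le_lt_trans fle).
  rewrite -real_normK ?num_real// expr2 mulrA ltr_pM2r ?normr_gt0//.
  rewrite -ltr_pdivlMl ?ltr0n ?fact_gt0//.
  near: h; apply: dnbhs0_lt.
  by rewrite mulr_gt0// invr_gt0 ltr0n fact_gt0.
Unshelve. all: by end_near. Qed.

Lemma flat_gt0 k (t : R) : 0 < t -> 0 < flat k t.
Proof. by move=> t0; rewrite /flat t0 mulr_gt0 ?expR_gt0 ?exprn_gt0 ?invr_gt0. Qed.

Lemma flat_ge0 k (t : R) : 0 <= flat k t.
Proof. by have /andP[] := flat_le k t. Qed.

Lemma flat_eq0 k (t : R) : t <= 0 -> flat k t = 0.
Proof. by rewrite /flat leNgt => /negbTE ->. Qed.

Lemma smooth_flat n k (a b : R) (i : 'I_n) :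
  smooth (fun x : 'rV[R]_n => flat k (a * x ord0 i + b)).
Proof.
pose lin x : R := a * (x : 'rV[R]_n) ord0 i + b.
have slin : smooth lin.
  apply: smoothD; last exact: smooth_cst.
  by apply: smoothM; [exact: smooth_cst|exact: smooth_coord].
pose B := [set f : 'rV[R]_n -> R | smooth f] `|`
  [set f | exists k, f = flat k \o lin].
suff : generated B (flat k \o lin).
  refine (@generated_smooth _ _ B _ _) => f [sf|[m ->]]; (split=> [x|j]).
  - exact: smooth_differentiable.
  - by apply: generated_base; left; exact: smooth_partial.
  - apply: differentiable_comp; first exact: smooth_differentiable.
    by apply/derivable1_diffP; have := is_derive_flat m (lin x); case.
  - rewrite (_ : partial j _ = fun x =>
      (- m%:R * flat m.+1 (lin x) + flat m.+2 (lin x)) * partial j lin x).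
      apply: generated_mul; last first.
        by apply: generated_base; left; exact: smooth_partial.
      apply: generated_add.
        apply: generated_mul; apply: generated_base.
          by left; exact: smooth_cst.
        by right; exists m.+1.
      by apply: generated_base; right; exists m.+2.
    apply/funext => x; have [dh hE] := is_derive_flat m (lin x).
    rewrite partial_comp1//; last exact: smooth_differentiable.
    by rewrite derive1E hE.
by apply: generated_base; right; exists k.
Qed.

Lemma flat_le1 k (t : R) : t <= 1 -> flat k t <= k.+2`!%:R.
Proof.
move=> t1; have [t0|t0] := ltP 0 t; last by rewrite flat_eq0.
have /andP[_ h] := flat_le k t; apply: (le_trans h).
by rewrite ler_piMr// expr_le1// ltW.
Qed.

Lemma flat0_homo (s t : R) : s <= t -> flat 0 s <= flat 0 t.
Proof.
move=> st; have [s0|s0] := ltP 0 s; last by rewrite (flat_eq0 _ s0) flat_ge0.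
have t0 := lt_le_trans s0 st.
by rewrite /flat s0 t0 !expr0 !mul1r ler_expR lerN2 lef_pV2.
Qed.

(** A smooth step from 0 to 1, all of whose variation takes place in [1, 2]. *)
Definition step (t : R) : R := flat 0 (t - 1) / (flat 0 (t - 1) + flat 0 (2 - t)).

Let step_denom (t : R) : R := flat 0 (t - 1) + flat 0 (2 - t).

Lemma step_denom_ge (t : R) : flat 0 (2^-1 : R) <= step_denom t.
Proof.
rewrite /step_denom; have [h|h] := leP (t - 1) 2^-1.
  rewrite -[leLHS]add0r lerD ?flat_ge0// flat0_homo//; lra.
rewrite -[leLHS]addr0 lerD ?flat_ge0// flat0_homo//; lra.
Qed.

Lemma step_denom_gt0 (t : R) : 0 < step_denom t.
Proof. by apply: lt_le_trans (step_denom_ge t); apply: flat_gt0; lra. Qed.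

Lemma step_ge0 t : 0 <= step t.
Proof. by rewrite divr_ge0 ?flat_ge0// ltW// step_denom_gt0. Qed.

Lemma step_le1 t : step t <= 1.
Proof.
by rewrite ler_pdivrMr ?step_denom_gt0// mul1r lerDl flat_ge0.
Qed.

Lemma step_eq0 t : t <= 1 -> step t = 0.
Proof. by move=> t1; rewrite /step flat_eq0 ?mul0r//; lra. Qed.

Lemma step_eq1 t : 2 <= t -> step t = 1.
Proof.
move=> t2; rewrite /step (@flat_eq0 0 (2 - t)); last lra.
by rewrite addr0 divff// gt_eqF// flat_gt0//; lra.
Qed.

Definition dstep (t : R) : R :=
  (flat 2 (t - 1) * flat 0 (2 - t) + flat 0 (t - 1) * flat 2 (2 - t)) /
  (flat 0 (t - 1) + flat 0 (2 - t)) ^+ 2.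

Lemma is_derive_step (t : R) : is_derive t 1 step (dstep t).
Proof.
have d1 : is_derive t 1 (fun s : R => flat 0 (s - 1)) (flat 2 (t - 1)).
  have h : is_derive t 1 (fun s : R => s - 1) 1.
    by apply: is_derive_eq; rewrite ?subr0.
  apply: (is_derive_eq (is_derive1_comp (is_derive_flat 0 _) h)).
  by rewrite mulr1 mulr0n oppr0 mul0r add0r.
have d2 : is_derive t 1 (fun s : R => flat 0 (2 - s)) (- flat 2 (2 - t)).
  have h : is_derive t 1 (fun s : R => 2 - s) (- 1).
    apply: (is_derive_eq (is_deriveB (is_derive_cst (2 : R) t 1) (is_derive_id t 1))).
    by rewrite sub0r.
  apply: (is_derive_eq (is_derive1_comp (is_derive_flat 0 _) h)).
  by rewrite mulrN1 mulr0n oppr0 mul0r add0r.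
have d3 := is_deriveD d1 d2.
have n0 : step_denom t != 0 by rewrite gt_eqF// step_denom_gt0.
have d4 := is_deriveV n0 d3.
apply: (is_derive_eq (is_deriveM d1 d4)).
rewrite /dstep /GRing.scale/= -/(step_denom t).
have -> : flat 0 (2 - t) = step_denom t - flat 0 (t - 1).
  by rewrite /step_denom; move: (flat _ _) (flat _ _) => u v; ring.
by field.
Qed.

(** The numerator of dstep is a sum of two products of a factor at most 4! and a
    factor at most 2!; its denominator is at least flat 0 (1/2) squared, since t
    - 1 or 2 - t is at least 1/2. *)
Definition step_bound : R := 96 / flat 0 (2^-1 : R) ^+ 2.

Lemma dstep_eq0 t : ~~ (1 < t < 2) -> dstep t = 0.
Proof.
rewrite negb_and -!leNgt => /orP[h|h]; rewrite /dstep.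
  by rewrite !(@flat_eq0 _ (t - 1)) ?mul0r ?addr0 ?mul0r//; lra.
by rewrite !(@flat_eq0 _ (2 - t)) ?mulr0 ?addr0 ?mul0r//; lra.
Qed.

Lemma dstep_le t : `|dstep t| <= step_bound.
Proof.
have b0 : 0 < flat 0 (2^-1 : R) by apply: flat_gt0; lra.
have [h|h] := boolP (1 < t < 2); last first.
  by rewrite dstep_eq0// normr0 divr_ge0// exprn_ge0// ltW.
have le1 k s : s <= 1 -> `|flat k s| <= k.+2`!%:R.
  by move=> s1; rewrite ger0_norm ?flat_ge0// flat_le1.
rewrite normrM normrV ?unitfE ?expf_neq0 ?gt_eqF ?step_denom_gt0//.
rewrite ler_pM ?invr_ge0//; last first.
  rewrite lef_pV2 ?posrE ?normr_gt0 ?exprn_gt0 ?expf_neq0 ?gt_eqF ?step_denom_gt0//.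
  rewrite ger0_norm; last by rewrite exprn_ge0// ltW// step_denom_gt0.
  apply: lerXn2r; rewrite ?nnegrE ?(ltW b0) ?(ltW (step_denom_gt0 t))//.
  exact: step_denom_ge.
apply: (le_trans (ler_normD _ _)); rewrite !normrM.
have h1 : t - 1 <= 1 by lra.
have h2 : 2 - t <= 1 by lra.
have := le1 2%N _ h1; have := le1 2%N _ h2.
have := le1 0%N _ h1; have := le1 0%N _ h2.
rewrite (_ : (2.+2)`!%:R = 24 :> R)// (_ : (0.+2)`!%:R = 2 :> R)//.
move=> a1 a2 a3 a4.
have := ler_pM (normr_ge0 _) (normr_ge0 _) a4 a1.
have := ler_pM (normr_ge0 _) (normr_ge0 _) a2 a3.
lra.
Qed.

End bump.

(** * Integrals of real-valued functions *)

Section Rintegral_tools.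
Context d (T : measurableType d) (R : realType) (mu : {measure set T -> \bar R}).
Implicit Types (D A : set T) (f g : T -> R).
Local Notation Li D f := (mu.-integrable D (EFin \o f)).

Lemma Li_measurable D f : Li D f -> measurable_fun D f.
Proof. by move=> /integrableP[mf _]; exact/measurable_EFinP. Qed.

Lemma Li_cst D c : measurable D -> (mu D < +oo)%E -> Li D (fun=> c).
Proof.
move=> mD fD; apply: measurable_bounded_integrable => //.
exact: bounded_cst.
Qed.

Lemma LiD D f g : measurable D -> Li D f -> Li D g -> Li D (fun x => f x + g x).
Proof. by move=> mD lf lg; by apply: (eq_integrable mD _ _ _ (integrableD mD lf lg)). Qed.

Lemma LiB D f g : measurable D -> Li D f -> Li D g -> Li D (fun x => f x - g x).
Proof. by move=> mD lf lg; by apply: (eq_integrable mD _ _ _ (integrableB mD lf lg)). Qed.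

Lemma LiZ D f c : measurable D -> Li D f -> Li D (fun x => c * f x).
Proof. by move=> mD lf; by apply: (eq_integrable mD _ _ _ (integrableZl mD c lf)). Qed.

Lemma LiN D f : measurable D -> Li D f -> Li D (fun x => - f x).
Proof. by move=> mD lf; by apply: (eq_integrable mD _ _ _ (integrableN lf)). Qed.

Lemma Li_norm D f : measurable D -> Li D f -> Li D (fun x => `|f x|).
Proof. by move=> mD lf; by apply: (eq_integrable mD _ _ _ (integrable_abse lf)). Qed.

Lemma Li_le D f g : measurable D -> measurable_fun D f ->
  (forall x, D x -> `|f x| <= g x) -> Li D g -> Li D f.
Proof.
move=> mD mf fg lg; apply: (le_integrable mD _ _ lg).
  exact/measurable_EFinP.
by move=> x Dx /=; rewrite lee_fin (le_trans (fg _ Dx))// ler_norm.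
Qed.

Lemma Li_sum D (I : Type) (r : seq I) (P : pred I) (F : I -> T -> R) :
  measurable D -> (forall i, P i -> Li D (F i)) ->
  Li D (fun x => \sum_(i <- r | P i) F i x).
Proof.
move=> mD lF; elim: r => [|i r IH].
  apply: (eq_integrable mD _ _ _ (integrable0 mu D)).
  by move=> x _; rewrite /= big_nil.
have [Pi|nPi] := boolP (P i); last first.
  apply: (eq_integrable mD _ _ _ IH).
  by move=> x _; rewrite /= big_cons (negbTE nPi).
apply: (eq_integrable mD _ _ _ (LiD mD (lF i Pi) IH)).
by move=> x _; rewrite /= big_cons Pi.
Qed.

Lemma Rintegral_sum D (I : Type) (r : seq I) (P : pred I) (F : I -> T -> R) :
  measurable D -> (forall i, P i -> Li D (F i)) ->
  \int[mu]_(x in D) (\sum_(i <- r | P i) F i x) =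
  \sum_(i <- r | P i) \int[mu]_(x in D) F i x.
Proof.
move=> mD lF; elim: r => [|i r IH].
  rewrite big_nil (@eq_Rintegral _ _ _ _ _ (fun=> 0)) ?Rintegral_cst ?mul0r//.
  by move=> x _; rewrite big_nil.
rewrite big_cons -IH; have [Pi|nPi] := boolP (P i); last first.
  by apply: eq_Rintegral => x _; rewrite big_cons (negbTE nPi).
rewrite -RintegralD//; last 2 first.
  exact: lF.
  exact: Li_sum.
by apply: eq_Rintegral => x _; rewrite big_cons Pi.
Qed.

Lemma LiS D A f : measurable D -> measurable A -> A `<=` D -> Li D f -> Li A f.
Proof. by move=> mD mA AD; exact: integrableS. Qed.

Lemma Rintegral_split D A f : measurable D -> measurable A -> A `<=` D ->
  Li D f ->
  \int[mu]_(x in D) f x = \int[mu]_(x in A) f x + \int[mu]_(x in D `\` A) f x.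
Proof.
move=> mD mA AD lf.
rewrite -Rintegral_setU//.
- by rewrite setDUK.
- exact: measurableD.
- by rewrite setDUK.
- by apply/disj_setPS => x [? []].
Qed.

Lemma Rintegral_le_norm D f : measurable D -> Li D f ->
  \int[mu]_(x in D) f x <= \int[mu]_(x in D) `|f x|.
Proof.
move=> mD lf; apply: le_Rintegral => //; first exact: Li_norm.
by move=> x _; exact: ler_norm.
Qed.

Lemma Rintegral_subset D A f : measurable D -> measurable A -> A `<=` D ->
  Li D f -> (forall x, D x -> 0 <= f x) ->
  \int[mu]_(x in A) f x <= \int[mu]_(x in D) f x.
Proof.
move=> mD mA AD lf f0; rewrite (Rintegral_split mD mA AD lf) lerDl.
by apply: Rintegral_ge0 => x [Dx _]; exact: f0.
Qed.

Lemma fin_measure_subset D A : measurable D -> measurable A -> A `<=` D ->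
  (mu D < +oo)%E -> (mu A < +oo)%E.
Proof.
by move=> mD mA AD; apply: le_lt_trans; apply: le_measure; rewrite ?inE.
Qed.

Lemma measurable_superlevel D f c : measurable D -> measurable_fun D f ->
  measurable (D `&` [set x | c < f x]).
Proof.
move=> mD mf; have := mf mD `]c, +oo[%classic.
rewrite (_ : _ @^-1` _ = [set x | c < f x]); first by apply.
by apply/seteqP; split=> x /=; rewrite in_itv/= andbT.
Qed.

Lemma markov_superlevel D f c : measurable D -> (mu D < +oo)%E -> 0 <= c ->
  Li D f -> (forall x, D x -> 0 <= f x) ->
  c * fine (mu (D `&` [set x | c < f x])) <= \int[mu]_(x in D) f x.
Proof.
move=> mD fD c0 lf f0.
have mf := Li_measurable lf.
have mB := measurable_superlevel c mD mf.
have sB : D `&` [set x | c < f x] `<=` D by move=> x [].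
rewrite -Rintegral_cst//.
apply: (@le_trans _ _ (\int[mu]_(x in D `&` [set x | c < f x]) f x)).
  apply: le_Rintegral => //.
  - exact: (Li_cst c mB (fin_measure_subset mD mB sB fD)).
  - exact: LiS lf.
  - by move=> x [_ /ltW].
exact: Rintegral_subset.
Qed.

Lemma Rintegral_le_cst D f c : measurable D -> (mu D < +oo)%E ->
  Li D f -> (forall x, D x -> f x <= c) ->
  \int[mu]_(x in D) f x <= c * fine (mu D).
Proof.
move=> mD fD lf fc; rewrite -Rintegral_cst//.
by apply: le_Rintegral => //; exact: Li_cst.
Qed.

Lemma Rdominated_convergence D (f_ : nat -> T -> R) f g e : measurable D ->
  (forall k, measurable_fun D (f_ k)) -> measurable_fun D f ->
  (forall x, D x -> f_ k x @[k --> \oo] --> f x) -> Li D g ->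
  (forall k x, D x -> `|f_ k x| <= g x) -> 0 < e ->
  \forall k \near \oo, \int[mu]_(x in D) `|f_ k x - f x| <= e.
Proof.
move=> mD mf_ mf f_f lg f_g e0.
have H1 : {ae mu, forall x, D x -> (EFin \o f_ k) x @[k --> \oo] --> (EFin \o f) x}.
  apply: aeW => x Dx; apply: cvg_EFin; last exact: f_f.
  by near=> k.
have H2 : {ae mu, forall x k, D x -> `|(EFin \o f_ k) x| <= (EFin \o g) x}%E.
  by apply: aeW => x k Dx; rewrite /= lee_fin; exact: f_g.
have [_ + _] := dominated_convergence mD
   (fun k => proj2 (measurable_EFinP _ _) (mf_ k))
   (proj2 (measurable_EFinP _ _) mf) H1 lg H2.
move=> /fine_cvgP[_ /cvgrPdist_le/(_ _ e0)]; apply: filterS => k.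
by rewrite sub0r normrN; apply: le_trans; exact: ler_norm.
Unshelve. all: by end_near. Qed.

(** The part of |f| above a high level k is small in L^1, and the rest is
    bounded by k. *)
Lemma Rintegral_abs_cont D f e : measurable D -> (mu D < +oo)%E ->
  Li D f -> 0 < e -> exists2 t : R, 0 < t &
  forall A, measurable A -> A `<=` D -> fine (mu A) <= t ->
    \int[mu]_(x in A) `|f x| <= e.
Proof.
move=> mD fD lf e0.
have lnf := Li_norm mD lf; have mnf := Li_measurable lnf.
pose g (k : nat) x : R := Num.min `|f x| k%:R.
have mg k : measurable_fun D (g k) by apply: measurable_minr.
have g0 k x : 0 <= g k x by rewrite le_min normr_ge0 ler0n.
have gle k x : `|g k x| <= `|f x|.
  by rewrite ger0_norm// ge_min lexx.
have lg k : Li D (g k) by apply: (Li_le mD (mg k) _ lnf) => x _; exact: gle.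
have gf x : D x -> g k x @[k --> \oo] --> `|f x|.
  move=> _; apply: cvg_near_cst; near=> k.
  rewrite /g; apply/min_idPl.
  by near: k; exact: nbhs_infty_ger.
have e20 : 0 < e / 2 by lra.
have [k _ /(_ k)/(_ (leqnn k)) /= hk] :=
  Rdominated_convergence mD mg mnf gf lnf (fun k x _ => gle k x) e20.
have k10 : 0 < k.+1%:R :> R by rewrite ltr0n.
exists (e / 2 / k.+1%:R); first by rewrite divr_gt0.
move=> A mA AD tA.
have fA := fin_measure_subset mD mA AD fD.
have lA h : Li D h -> Li A h by exact: LiS.
have ld : Li D (fun x => `|g k x - `|f x| |) by apply: Li_norm => //; exact: LiB.
apply: (@le_trans _ _ (\int[mu]_(x in A) (`|g k x - `|f x| | + k.+1%:R))).
  apply: le_Rintegral => //; first exact: lA.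
    by apply: LiD => //; [exact: lA|exact: Li_cst].
  move=> x Ax; rewrite -[leLHS](subrK (g k x)) lerD//.
    by rewrite distrC ler_norm.
  by rewrite /g ge_min ler_nat leqnSn orbT.
rewrite RintegralD//; [|exact: lA|exact: Li_cst].
rewrite Rintegral_cst// (splitr e) lerD//.
  by apply: le_trans hk; exact: Rintegral_subset.
by rewrite mulrC -ler_pdivlMr.
Unshelve. all: by end_near. Qed.

Lemma Li_indic D A : measurable D -> (mu D < +oo)%E -> measurable A ->
  Li D (\1_A : T -> R).
Proof.
move=> mD fD mA; apply: (Li_le mD _ _ (Li_cst 1 mD fD)).
  exact: measurable_indic.
by move=> x _; rewrite ger0_norm ?indicE ?ler0n//; case: (_ \in _).
Qed.

Lemma Rintegral_indic D A : measurable D -> measurable A ->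
  \int[mu]_(x in D) (\1_A x : R) = fine (mu (A `&` D)).
Proof. by move=> mD mA; rewrite /Rintegral integral_indic. Qed.

End Rintegral_tools.

(** * Uniform continuity and integration by parts *)

Section unif_cont.
Context {R : realType}.

(** Finitely many radii have a positive minimum. *)
Lemma uniform_radius (I : finType) (P : I -> R -> Prop) :
  (forall i, exists2 d, 0 < d & P i d) ->
  (forall i d d', d' <= d -> P i d -> P i d') ->
  exists2 d, 0 < d & forall i, P i d.
Proof.
move=> hP dP; have /choice[d hd] : forall i, exists d, 0 < d /\ P i d.
  by move=> i; have [d] := hP i; exists d.
exists (\big[Num.min/1]_i d i).
  by elim/big_ind : _ => // [a b a0 b0|i _]; [rewrite lt_min a0|case: (hd i)].
by move=> i; apply: dP (hd i).2; exact: bigmin_le_cond.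
Qed.

(** Only x is confined to the compact set, y being any point close to it: this
    serves to perturb a bounded field by an arbitrary one. *)
Lemma compact_unif_continuous (V W : normedModType R) (f : V -> W) (K : set V) e :
  compact K -> (forall x, K x -> {for x, continuous f}) -> 0 < e ->
  exists2 d, 0 < d & forall x y, K x -> `|x - y| < d -> `|f x - f y| <= e.
Proof.
move=> /compact_near_coveringP cK cf e0.
have e20 : 0 < e / 2 by lra.
have := cK _ (0^'+ : set_system R)
  (fun d x => forall y, `|x - y| < d -> `|f x - f y| <= e) _.
case.
  move=> x Kx; have := cf x Kx => /cvgrPdist_le/(_ _ e20).
  move=> /nbhs_ballP[r /= r0 hr].
  have r20 : 0 < r / 2 by lra.
  exists (ball x (r / 2), [set d | d < r / 2]); first split => /=.
  - exact: nbhsx_ballx.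
  - by exists (r / 2) => // d /= + d0; rewrite sub0r normrN gtr0_norm.
  move=> [z d] /= [xz dr] y zy.
  have h1 : `|f x - f z| <= e / 2.
    apply: hr; rewrite -ball_normE/=; rewrite -ball_normE/= in xz.
    by apply: lt_trans xz _; lra.
  have h2 : `|f x - f y| <= e / 2.
    apply: hr; rewrite -ball_normE/=; rewrite -ball_normE/= in xz.
    have := ler_distD z x y; lra.
  have := ler_distD (f x) (f z) (f y); rewrite (distrC (f z) (f x)); lra.
move=> r /= r0 hr; exists (r / 2); first lra.
move=> x y Kx xy; apply: (hr (r / 2)) => //=; last lra.
by rewrite sub0r normrN gtr0_norm; lra.
Qed.

Lemma compact_closed_ball n (M : R) : compact [set x : 'rV[R]_n | `|x| <= M].
Proof.
apply: bounded_closed_compact.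
  exists M; split; first exact: num_real.
  by move=> M' MM' x /= xM; exact: le_trans xM (ltW MM').
rewrite (_ : [set x | _] = Num.Def.normr @^-1` [set y : R | y <= M]) //.
by apply: closed_comp => [x _|]; [exact: norm_continuous|exact: closed_le].
Qed.

Lemma supp_unif_continuous n (W : normedModType R) (f : 'rV[R]_n -> W) (M : R) e :
  continuous f -> (forall x, M < `|x| -> f x = 0) -> 0 < e ->
  exists2 d, 0 < d & forall x y, `|x - y| < d -> `|f x - f y| <= e.
Proof.
move=> cf f0 e0.
have [d d0 hd] := compact_unif_continuous (@compact_closed_ball n (M + 1))
  (fun x _ => cf x) e0.
exists (Num.min d 1); first by rewrite lt_min d0/=.
move=> x y; rewrite lt_min => /andP[xyd xy1].
have [xM|xM] := leP `|x| (M + 1); first exact: hd.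
have yM : M < `|y|.
  have := ler_normD (x - y) y; rewrite subrK; lra.
by rewrite !f0 ?subrr ?normr0 ?ltW//; lra.
Qed.

End unif_cont.

Section lebesgue_bounded.
Context {R : realType} {n : nat}.
Notation mu := (@lebesgue_rV R n).

Lemma measurable_norm_le (M : R) : measurable [set x : 'rV[R]_n | `|x| <= M].
Proof.
have := measurable_rV_open (closed_openC (compact_closed
  (@norm_hausdorff _ _) (@compact_closed_ball R n M))).
by move=> /measurableC; rewrite setCK.
Qed.

Lemma lebesgue_bounded_lt_oo (D : set 'rV[R]_n) (M : R) : measurable D ->
  (forall x, D x -> `|x| <= M) -> (mu D < +oo)%E.
Proof.
move=> mD DM.
pose B := [set x : 'rV[R]_n | forall i, `[(- M), M]%classic (x ord0 i)].
have mB : measurable B by apply: (@measurable_rect _ _ (fun=> `[(- M), M]%classic)).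
have DB : D `<=` B.
  move=> x /DM xM i /=; rewrite in_itv/= -ler_norml.
  exact: le_trans (mx_norm_ge _ _ _) xM.
apply: (@le_lt_trans _ _ (mu B)); first by apply: le_measure; rewrite ?inE.
have mI : forall i : 'I_n, measurable (`[(- M), M]%classic : set R) by [].
have -> : mu B = _ := lebesgue_rV_box mI.
suff : ((\prod_(i < n) lebesgue_measure (`[(- M)%R, M%R]%classic : set R))%E
   \is a fin_num)%E by rewrite fin_numE => /andP[_]; rewrite -ltey.
apply: prode_fin_num => i _.
by rewrite lebesgue_measure_itv/=; case: ifPn.
Qed.

Lemma Li_supp (D : set 'rV[R]_n) (f : 'rV[R]_n -> R) (M : R) : measurable D ->
  continuous f -> (forall x, M < `|x| -> f x = 0) ->
  mu.-integrable D (EFin \o f).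
Proof.
move=> mD cf f0; apply: (@LiS _ _ _ mu setT) => //.
have mB := measurable_norm_le M.
have : mu.-integrable [set x : 'rV[R]_n | `|x| <= M] (EFin \o f).
  apply: measurable_bounded_integrable => //.
  - by apply: (lebesgue_bounded_lt_oo mB) => x; exact.
  - exact: measurable_rV_continuous.
  have : compact (f @` [set x : 'rV[R]_n | `|x| <= M]).
    apply: continuous_compact; last exact: compact_closed_ball.
    exact: continuous_subspaceT.
  move=> /compact_bounded[N [Nr hN]].
  exists N; split => // N' /hN h x /= xM; apply: h.
  by exists x.
move/(integrable_mkcond _ mB); apply: eq_integrable => // x _ /=.
rewrite /patch; case: ifPn => //; rewrite notin_setE /= => /negP.
by rewrite -ltNge => /f0 ->.
Qed.

Lemma Rintegral_supp (D : set 'rV[R]_n) (f : 'rV[R]_n -> R) :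
  (forall x, ~ D x -> f x = 0) ->
  \int[mu]_(x in D) f x = \int[mu]_x f x.
Proof.
move=> f0; rewrite Rintegral_mkcond; apply: eq_Rintegral => x _.
by rewrite /patch; case: ifPn => //; rewrite notin_setE => /f0.
Qed.

Lemma compactly_supportedW (V : normedModType R) Omega (f : 'rV[R]_n -> V) :
  compactly_supported Omega f ->
  exists2 M : R, 0 < M & forall x, M < `|x| -> f x = 0.
Proof.
move=> [K [/compact_bounded[M [Mr hM]] KO f0]].
exists (Num.max M 0 + 1); first by rewrite ltr_pwDr// le_max lexx orbT.
move=> x xM; apply: f0 => Kx.
have MM : M < Num.max M 0 + 1 by rewrite ltr_pwDr// le_max lexx.
by have /= := hM _ MM x Kx; rewrite leNgt xM.
Qed.

Lemma compactly_supported_notin (V : normedModType R) Omega (f : 'rV[R]_n -> V) x :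
  compactly_supported Omega f -> ~ Omega x -> f x = 0.
Proof. by move=> [K [_ KO f0]] nx; apply: f0 => /KO. Qed.

Lemma partial_eq0 (V : normedModType R) (f : 'rV[R]_n -> V) j x :
  (\forall y \near x, f y = 0) -> partial j f x = 0.
Proof.
move=> f0; rewrite /partial (@near_eq_derive _ _ _ f (cst 0)) ?derive_cst//.
Qed.

Lemma compactly_supported_near (V : normedModType R) (f : 'rV[R]_n -> V) K x :
  compact K -> (forall x, ~ K x -> f x = 0) -> ~ K x ->
  \forall y \near x, f y = 0.
Proof.
move=> cK f0 nKx.
have oK := closed_openC (compact_closed (@norm_hausdorff _ _) cK).
have : nbhs x (~` K) by exact: open_nbhs_nbhs.
by apply: filterS => y /f0.
Qed.

Lemma partial_supp (V : normedModType R) (f : 'rV[R]_n -> V) j (M : R) x :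
  (forall x, M < `|x| -> f x = 0) -> M < `|x| -> partial j f x = 0.
Proof.
move=> f0 xM; apply: partial_eq0.
apply: (@compactly_supported_near _ f [set x : 'rV[R]_n | `|x| <= M]).
- exact: compact_closed_ball.
- by move=> y /= /negP; rewrite -ltNge; exact: f0.
- by move=> /=; apply/negP; rewrite -ltNge.
Qed.

Lemma is_derive_line (V W : normedModType R) (f : V -> W) (x v : V) (s : R) :
  derivable f (s *: v + x) v ->
  is_derive s 1 (fun t : R => f (t *: v + x)) ('D_v f (s *: v + x)).
Proof.
move=> df.
have E : (fun h : R => h^-1 *: ((fun t : R => f (t *: v + x)) (h *: 1 + s) -
                         f (s *: v + x))) =
    (fun h : R => h^-1 *: (f (h *: v + (s *: v + x)) - f (s *: v + x))).
  apply/funext => h; congr (_ *: (f _ - _)).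
  by rewrite [h *: 1]mulr1 scalerDl addrA.
by apply: DeriveDef; [rewrite /derivable|rewrite /derive] => /=; rewrite E.
Qed.

Lemma MVT_line (V : normedModType R) (f : V -> R) (x v : V) (t : R) : 0 < t ->
  (forall y, derivable f y v) ->
  exists2 s, 0 < s < t & f (t *: v + x) - f x = t * 'D_v f (s *: v + x).
Proof.
move=> t0 df.
have [s st E] := @MVT R (fun t => f (t *: v + x)) (fun s => 'D_v f (s *: v + x)) 0 t t0
  (fun s _ => is_derive_line (df _))
  (derivable_within_continuous (fun s _ => ex_derive (is_derive := is_derive_line (df _)))).
exists s; first by rewrite in_itv in st.
by rewrite scale0r add0r subr0 mulrC in E.
Qed.

(** The integral of a difference quotient vanishes by translation invariance,
    and the quotients converge uniformly with supports in a fixed ball. *)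
Lemma Rintegral_partial_eq0 (f : 'rV[R]_n -> R) j (M : R) :
  (forall x, differentiable f x) -> continuous (partial j f) ->
  (forall x, M < `|x| -> f x = 0) ->
  \int[mu]_x partial j f x = 0.
Proof.
move=> df cg f0.
set g := partial j f.
have cf : continuous f by move=> x; exact: differentiable_continuous.
have g0 x : M < `|x| -> g x = 0 by move=> xM; exact: partial_supp f0 xM.
pose B := [set x : 'rV[R]_n | `|x| <= M + 1].
have mB : measurable B by exact: measurable_norm_le.
have fB : (mu B < +oo)%E by apply: (lebesgue_bounded_lt_oo mB) => x; exact.
pose v : 'rV[R]_n := delta_mx ord0 j.
have v1 : `|v| <= 1.
  by apply: mx_norm_le => // i k; rewrite mxE; case: (_ && _); rewrite ?normr1 ?normr0.
suff H e : 0 < e -> `|\int[mu]_x g x| <= e * fine (mu B).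
  have [m0|m0] := eqVneq (fine (mu B)) 0.
    by have := H 1 ltr01; rewrite m0 mulr0 normr_le0 => /eqP.
  have m1 : 0 < fine (mu B) by rewrite lt_neqAle eq_sym m0 fine_ge0.
  apply/eqP; rewrite -normr_le0; apply/ler_addgt0Pl => e e0; rewrite addr0.
  have := H (e / fine (mu B)); rewrite divfK//; apply.
  exact: divr_gt0.
move=> e0.
have [d d0 hd] := supp_unif_continuous cg g0 e0.
pose t := Num.min (d / 2) 1.
have t0 : 0 < t by rewrite lt_min ltr01 andbT; lra.
have t1 : t <= 1 by rewrite ge_min lexx orbT.
have td : t < d.
  by rewrite (@le_lt_trans _ _ (d / 2))// ?ge_min ?lexx//; lra.
have cs : continuous (fun x : 'rV[R]_n => f (t *: v + x)).
  move=> x; apply: continuous_comp; last exact: cf.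
  rewrite (_ : +%R (t *: v) = aff (t *: v) 1); last first.
    by apply/funext => y; rewrite /aff scale1r.
  apply: differentiable_continuous; exact: differentiable_aff.
have fs x : M + 1 < `|x| -> f (t *: v + x) = 0.
  move=> xM; apply: f0; have := ler_normD (t *: v + x) (- (t *: v)).
  rewrite addrAC subrr add0r normrN normrZ gtr0_norm// => h.
  have : t * `|v| <= 1 by rewrite mulr_ile1// ltW.
  lra.
have f0' x : M + 1 < `|x| -> f x = 0 by move=> h; apply: f0; lra.
have g0' x : M + 1 < `|x| -> g x = 0 by move=> h; apply: g0; lra.
pose q x := t^-1 * (f (t *: v + x) - f x).
have ls := Li_supp measurableT cs fs.
have lf := Li_supp measurableT cf f0'.
have lg := Li_supp measurableT cg g0'.
have lfs := LiB measurableT ls lf.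
have lq : mu.-integrable setT (EFin \o q) by exact: LiZ.
have q0 : \int[mu]_x q x = 0.
  rewrite RintegralZl// RintegralB//.
  have := Rintegral_aff (t *: v) ltr01 measurableT lf.
  rewrite preimage_setT invr1 expr1n mul1r => <-.
  rewrite [X in X - _](@eq_Rintegral _ _ _ _ _ (fun x => f (aff (t *: v) 1 x))).
    by rewrite subrr mulr0.
  by move=> x _; rewrite /aff scale1r.
rewrite -[X in `|X|]subr0 -q0 -RintegralB//.
apply: (le_trans (le_normr_Rintegral measurableT (LiB measurableT lg lq))).
rewrite -(@Rintegral_supp B); last first.
  move=> x /= /negP; rewrite -ltNge => xM.
  transitivity `|g x - q x| => //.
  have -> : q x = 0 by rewrite /q fs// f0'// subrr mulr0.
  by rewrite subr0 g0' ?normr0.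
apply: Rintegral_le_cst => //.
  apply: (@LiS _ _ _ mu setT) => //; apply: Li_norm => //; exact: LiB.
move=> x _.
have [s /andP[s0 st] E] := MVT_line x t0 (fun y => diff_derivable (df y) (v := v)).
rewrite /q E mulKf ?gt_eqF// distrC -/(partial j f _) -/g.
apply: hd; rewrite addrK normrZ gtr0_norm//.
rewrite (le_lt_trans _ td)// (le_trans _ (ltW st))//.
by rewrite ler_piMr// ltW.
Qed.

Lemma continuous_mulR (f g : 'rV[R]_n -> R) :
  continuous f -> continuous g -> continuous (fun x => f x * g x).
Proof. by move=> cf cg x; exact: (cvgM (cf x) (cg x)). Qed.

(** The product has compact support, so that its partial derivatives have
    integral zero. *)
Lemma Rintegral_by_parts (f g : 'rV[R]_n -> R) j (M : R) :
  (forall x, differentiable f x) -> continuous (partial j f) ->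
  (forall x, differentiable g x) -> continuous (partial j g) ->
  (forall x, M < `|x| -> g x = 0) ->
  \int[mu]_x (f x * partial j g x) = - \int[mu]_x (partial j f x * g x).
Proof.
move=> df cf dg cg g0.
have c f' : (forall x, differentiable f' x) -> continuous (f' : 'rV[R]_n -> R).
  by move=> d x; exact: differentiable_continuous.
have l1 : mu.-integrable setT (EFin \o (fun x => f x * partial j g x)).
  apply: (@Li_supp _ _ M) => //; first exact: continuous_mulR (c _ df) cg.
  by move=> x xM; rewrite (partial_supp j g0)// mulr0.
have l2 : mu.-integrable setT (EFin \o (fun x => partial j f x * g x)).
  apply: (@Li_supp _ _ M) => //; first exact: continuous_mulR cf (c _ dg).
  by move=> x xM; rewrite g0// mulr0.
apply/eqP; rewrite -addr_eq0 -RintegralD//; apply/eqP.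
have := @Rintegral_partial_eq0 (fun x => f x * g x) j M.
rewrite partialM// => <-.
- by apply: eq_Rintegral => x _; rewrite [g x * _]mulrC.
- by move=> x; exact: differentiableM.
- by move=> x; exact: (cvgD (continuous_mulR (c _ df) cg (x := x))
    (continuous_mulR (c _ dg) cf (x := x))).
- by move=> x xM; rewrite g0 ?mulr0.
Qed.

End lebesgue_bounded.

(** * Gradients of smooth maps and cutoff functions *)

Section jac.
Context {R : realType} {n N : nat}.
Implicit Types phi psi : 'rV[R]_n -> 'rV[R]_N.

Definition jac phi (x : 'rV[R]_n) : 'M[R]_(N, n) :=
  \matrix_(i, j) partial j (fun y => phi y ord0 i) x.

Lemma jac_continuous phi : smooth phi -> continuous (jac phi).
Proof.
move=> sp x; apply/(@cvgrPdist_lt _ _ _ _ (@nbhs_filter _ (x : 'rV[R]_n))) => e e0.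
have cij i j : \forall y \near x, `|jac phi x i j - jac phi y i j| < e.
  have sc : smooth (partial j (fun y => phi y ord0 i)).
    by apply: smooth_partial; exact: smooth_rowP.
  have := smooth_continuous sc (x := x) => /cvgrPdist_lt/(_ _ e0).
  by apply: filterS => y; rewrite !mxE.
near=> y; apply: mx_norm_lt => // i j; rewrite !mxE.
have : forall i j, `|jac phi x i j - jac phi y i j| < e.
  near: y; apply: filter_forall => i'; apply: filter_forall => j'; exact: cij.
by move=> /(_ i j); rewrite !mxE.
Unshelve. all: by end_near. Qed.

Lemma jac_comp_continuous phi i j : smooth phi ->
  continuous (fun x => jac phi x i j).
Proof.
move=> sp; rewrite (_ : (fun x => _) = partial j (fun y => phi y ord0 i)).
  by apply: smooth_continuous; apply: smooth_partial; exact: smooth_rowP.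
by apply/funext => x; rewrite mxE.
Qed.

Lemma jac_eq0 phi K x : compact K -> (forall x, ~ K x -> phi x = 0) -> ~ K x ->
  jac phi x = 0.
Proof.
move=> cK p0 nK; apply/matrixP => i j; rewrite !mxE.
apply: partial_eq0; have := compactly_supported_near cK p0 nK.
by apply: filterS => y ->; rewrite mxE.
Qed.

Lemma jac0 x : jac (fun=> 0) x = 0.
Proof. by apply/matrixP => i j; rewrite !mxE partial_cst. Qed.

Lemma jacD phi psi : smooth phi -> smooth psi ->
  jac (fun x => phi x + psi x) = fun x => jac phi x + jac psi x.
Proof.
move=> sp sq; apply/funext => x; apply/matrixP => i j; rewrite !mxE.
have dc (f : 'rV[R]_n -> 'rV[R]_N) : smooth f -> forall y, differentiable (fun y : 'rV[R]_n => f y ord0 i : R) y.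
  by move=> sf y; apply: smooth_differentiable; exact: (@smooth_rowP _ _ N).
have := partialD j (dc _ sp) (dc _ sq) => /(congr1 (@^~ x)) /= <-.
by congr (partial j _ x); apply/funext => y; rewrite mxE.
Qed.

Lemma smooth_mapD phi psi : smooth phi -> smooth psi ->
  smooth (fun x => phi x + psi x).
Proof.
move=> sp sq; apply: smooth_row => i.
rewrite (_ : (fun y => _) = fun y => phi y ord0 i + psi y ord0 i).
  by apply: smoothD; exact: smooth_rowP.
by apply/funext => y; rewrite mxE.
Qed.

Lemma compactly_supportedD (V : normedModType R) (Omega : set 'rV[R]_n)
    (f g : 'rV[R]_n -> V) :
  compactly_supported Omega f -> compactly_supported Omega g ->
  compactly_supported Omega (fun x => f x + g x).
Proof.
move=> [K [cK KO f0]] [L [cL LO g0]]; exists (K `|` L); split.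
- exact: compactU.
- by move=> x [/KO|/LO].
- by move=> x /not_orP[nK nL]; rewrite f0// g0// addr0.
Qed.

Lemma test_functionD (Omega : set 'rV[R]_n) phi psi :
  test_function Omega phi -> test_function Omega psi ->
  test_function Omega (fun x => phi x + psi x).
Proof.
move=> [sp cp] [sq cq]; split; first exact: smooth_mapD.
exact: compactly_supportedD.
Qed.

Lemma test_function0 (Omega : set 'rV[R]_n) :
  test_function Omega (fun _ : 'rV[R]_n => 0 : 'rV[R]_N).
Proof.
split; first exact: smooth_cst.
by exists set0; split => //; exact: compact0.
Qed.

Lemma test_function_sub (A B : set 'rV[R]_n) (V : normedModType R)
    (phi : 'rV[R]_n -> V) : A `<=` B ->
  test_function A phi -> test_function B phi.
Proof.
move=> AB [sp [K [cK KA p0]]]; split => //; exists K; split => //.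
exact: subset_trans AB.
Qed.

(** The copy of a map on the image of the affine change of variables, scaled so
    as to preserve the gradient. *)
Definition rescale phi (c : 'rV[R]_n) (r : R) : 'rV[R]_n -> 'rV[R]_N :=
  fun x => r *: phi (aff (- (r^-1 *: c)) r^-1 x).

Lemma aff_invK (c : 'rV[R]_n) (r : R) : r != 0 ->
  cancel (aff (- (r^-1 *: c)) r^-1) (aff c r).
Proof.
move=> r0 x; rewrite /aff scalerDr scalerN !scalerA divff// !scale1r.
by rewrite addrA subrr add0r.
Qed.

Lemma affK (c : 'rV[R]_n) (r : R) : r != 0 ->
  cancel (aff c r) (aff (- (r^-1 *: c)) r^-1).
Proof.
move=> r0 x; rewrite /aff scalerDr scalerA mulVf// scale1r.
by rewrite addrA addNr add0r.
Qed.

Lemma smooth_rescale phi c r : smooth phi -> smooth (rescale phi c r).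
Proof. by move=> sp; exact: smooth_aff. Qed.

Lemma jac_rescale phi c r x : r != 0 -> smooth phi ->
  jac (rescale phi c r) x = jac phi (aff (- (r^-1 *: c)) r^-1 x).
Proof.
move=> r0 sp; apply/matrixP => i j; rewrite !mxE.
have sc := smooth_rowP i sp.
have dc y : differentiable (fun y : 'rV[R]_n => phi y ord0 i) y.
  exact: smooth_differentiable.
rewrite (_ : (fun y => _) = fun y => r *: (phi (aff (- (r^-1 *: c)) r^-1 y)) ord0 i); last first.
  by apply/funext => y; rewrite mxE.
rewrite /partial deriveZ.
  have := partial_aff (- (r^-1 *: c)) r^-1 j dc => /(congr1 (@^~ x)).
  by rewrite /partial => ->; rewrite scalerA divff// scale1r.
apply: diff_derivable.
apply: (@differentiable_comp _ _ _ _ _ (fun y : 'rV[R]_n => phi y ord0 i)).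
  exact: differentiable_aff.
exact: dc.
Qed.

Lemma compactly_supported_rescale phi c r (Omega : set 'rV[R]_n) : r != 0 ->
  compactly_supported Omega phi ->
  compactly_supported (aff c r @` Omega) (rescale phi c r).
Proof.
move=> r0 [K [cK KO p0]]; exists (aff c r @` K); split.
- apply: continuous_compact => //.
  apply: continuous_subspaceT => x.
  by apply: differentiable_continuous; exact: differentiable_aff.
- by move=> _ [x Kx <-]; exists x => //; exact: KO.
- move=> x nK; rewrite /rescale p0 ?scaler0// => Kx; apply: nK.
  by exists (aff (- (r^-1 *: c)) r^-1 x) => //; exact: aff_invK.
Qed.

Lemma test_function_rescale phi c r (Omega : set 'rV[R]_n) : r != 0 ->
  test_function Omega phi ->
  test_function (aff c r @` Omega) (rescale phi c r).
Proof.
move=> r0 [sp cp]; split; first exact: smooth_rescale.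
exact: compactly_supported_rescale.
Qed.

End jac.

Section cutoff.
Context {R : realType} {n : nat}.
Implicit Types (x : 'rV[R]_n).

Lemma partial_invariant (f : 'rV[R]_n -> R) j x :
  (forall h : R, f (h *: delta_mx ord0 j + x) = f x) -> partial j f x = 0.
Proof.
move=> fE; rewrite /partial /derive.
rewrite (_ : (fun h => _) = cst 0); first exact: lim_cst.
by apply/funext => h /=; rewrite fE subrr scaler0.
Qed.

Variables (d : R) (d0 : 0 < d).

(** A plateau equal to 1 on [2 d, 1 - 2 d] and to 0 off [d, 1 - d]. *)
Definition edge (t : R) : R := step (d^-1 * t) * step (- d^-1 * t + d^-1).

Definition cutoff x : R := \prod_(k < n) edge (x ord0 k).

Lemma edge_ge0 t : 0 <= edge t.
Proof. by rewrite mulr_ge0// step_ge0. Qed.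

Lemma edge_le1 t : edge t <= 1.
Proof. by rewrite mulr_ile1// ?step_ge0// step_le1. Qed.

Lemma edge_eq0 t : ~~ (d < t < 1 - d) -> edge t = 0.
Proof.
rewrite negb_and -!leNgt => /orP[h|h]; rewrite /edge.
  by rewrite step_eq0 ?mul0r// mulrC ler_pdivrMr// mul1r.
rewrite (@step_eq0 _ (- d^-1 * t + d^-1)) ?mulr0//.
rewrite mulNr addrC -[X in X - _](mulr1) -mulrBr mulrC ler_pdivrMr// mul1r; lra.
Qed.

Lemma edge_eq1 t : 2 * d <= t <= 1 - 2 * d -> edge t = 1.
Proof.
move=> /andP[h1 h2]; rewrite /edge !step_eq1 ?mulr1//.
  rewrite mulNr addrC -[X in X - _](mulr1) -mulrBr mulrC ler_pdivlMr//; lra.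
by rewrite mulrC ler_pdivlMr.
Qed.

Definition dedge (t : R) : R :=
  d^-1 * (dstep (d^-1 * t) * step (- d^-1 * t + d^-1)
          - step (d^-1 * t) * dstep (- d^-1 * t + d^-1)).

Lemma is_derive_edge (t : R) : is_derive t 1 edge (dedge t).
Proof.
have l1 : is_derive t 1 (fun s : R => d^-1 * s) d^-1.
  by apply: (is_derive_eq (is_deriveZ d^-1 (is_derive_id t 1))); rewrite [_ *: _]mulr1.
have l2 : is_derive t 1 (fun s : R => - d^-1 * s + d^-1) (- d^-1).
  apply: (is_derive_eq (is_deriveD (is_deriveZ (- d^-1) (is_derive_id t 1)) (is_derive_cst d^-1 t 1))).
  by rewrite [_ *: _]mulr1 addr0.
have s1 := is_derive1_comp (is_derive_step _) l1.
have s2 := is_derive1_comp (is_derive_step _) l2.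
apply: (is_derive_eq (is_deriveM s1 s2)).
by rewrite /dedge /GRing.scale/=; ring.
Qed.

Lemma dedge_le t : `|dedge t| <= 2 * step_bound / d.
Proof.
have sb t' : `|step t'| <= 1 :> R by rewrite ger0_norm ?step_ge0 ?step_le1.
have b0 : 0 <= step_bound :> R by apply: le_trans (dstep_le 0); rewrite normr_ge0.
rewrite /dedge normrM ger0_norm ?invr_ge0 ?(ltW d0)// mulrC.
rewrite ler_wpM2r ?invr_ge0 ?(ltW d0)//.
apply: (le_trans (ler_normB _ _)); rewrite !(normrM (dstep _)) !(normrM (step _)).
rewrite mulr_natl mulr2n lerD//.
  by rewrite -[leRHS]mulr1 ler_pM// dstep_le.
by rewrite -[leRHS]mul1r ler_pM// dstep_le.
Qed.

Lemma dedge_eq0 t : 2 * d <= t <= 1 - 2 * d -> dedge t = 0.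
Proof.
move=> /andP[h1 h2]; rewrite /dedge !dstep_eq0 ?mul0r ?mulr0 ?subr0 ?mulr0//.
  rewrite negb_and -!leNgt; apply/orP; right.
  rewrite mulNr addrC -[X in X - _](mulr1) -mulrBr mulrC ler_pdivlMr//; lra.
rewrite negb_and -!leNgt; apply/orP; right.
by rewrite mulrC ler_pdivlMr.
Qed.

Lemma smooth_edge (k : 'I_n) : smooth (fun x : 'rV[R]_n => edge (x ord0 k)).
Proof.
have ss a b : smooth (fun x : 'rV[R]_n => step (a * x ord0 k + b)).
  have e1 : (fun x : 'rV[R]_n => flat 0 (a * x ord0 k + b - 1)) =
    (fun x => flat 0 (a * x ord0 k + (b - 1))).
    by apply/funext => x; rewrite addrA.
  have e2 : (fun x : 'rV[R]_n => flat 0 (2 - (a * x ord0 k + b))) =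
    (fun x => flat 0 (- a * x ord0 k + (2 - b))).
    by apply/funext => x; congr flat; ring.
  apply: smoothM; first by rewrite e1; exact: smooth_flat.
  apply: smoothV => [x|]; first by rewrite gt_eqF// step_denom_gt0.
  by apply: smoothD; rewrite ?e1 ?e2; exact: smooth_flat.
apply: smoothM; last exact: ss.
have := ss d^-1 0; congr smooth; apply/funext => x; by rewrite addr0.
Qed.

Lemma smooth_cutoff : smooth cutoff.
Proof. by apply: smooth_prod => k _; exact: smooth_edge. Qed.

Lemma cutoff_ge0 x : 0 <= cutoff x.
Proof. by apply: prodr_ge0 => k _; exact: edge_ge0. Qed.

Lemma prod_edge_le1 (P : pred 'I_n) x : \prod_(k < n | P k) edge (x ord0 k) <= 1.
Proof. by apply: prodr_ile1 => k _; rewrite edge_ge0 edge_le1. Qed.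

Lemma cutoff_le1 x : cutoff x <= 1.
Proof. exact: prod_edge_le1. Qed.

Lemma cutoff_eq0 x : ~ (forall k, d <= x ord0 k <= 1 - d) -> cutoff x = 0.
Proof.
move=> /existsNP[k /negP hk]; rewrite /cutoff (bigD1 k)//= edge_eq0 ?mul0r//.
by apply: contraNN hk => /andP[/ltW -> /ltW ->].
Qed.

Lemma cutoff_eq1 x : (forall k, 2 * d <= x ord0 k <= 1 - 2 * d) -> cutoff x = 1.
Proof. by move=> h; rewrite /cutoff big1// => k _; exact: edge_eq1. Qed.

Lemma partial_cutoff j x :
  partial j cutoff x = dedge (x ord0 j) * \prod_(k < n | k != j) edge (x ord0 k).
Proof.
rewrite (_ : cutoff = fun x => edge (x ord0 j) *
  \prod_(k < n | k != j) edge (x ord0 k)); last first.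
  by apply/funext => y; rewrite /cutoff (bigD1 j).
rewrite partialM; last 2 first.
- by move=> y; apply: smooth_differentiable; exact: smooth_edge.
- move=> y; apply: smooth_differentiable; apply: smooth_prod => k _.
  exact: smooth_edge.
have -> : partial j (fun x : 'rV[R]_n => \prod_(k < n | k != j) edge (x ord0 k)) x = 0.
  apply: partial_invariant => h; apply: eq_bigr => k kj.
  by rewrite !mxE eqxx (negbTE kj) mulr0 add0r.
rewrite mulr0 add0r mulrC; congr (_ * _).
have [de dE] := is_derive_edge (x ord0 j).
rewrite (partial_comp1 j (h := edge) (l := fun x : 'rV[R]_n => x ord0 j))//.
  by rewrite derive1E dE partial_coord eqxx mulr1.
exact: differentiable_coord.
Qed.

Lemma partial_cutoff_le j x : `|partial j cutoff x| <= 2 * step_bound / d.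
Proof.
rewrite partial_cutoff normrM -[leRHS]mulr1 ler_pM// ?dedge_le//.
rewrite ger0_norm ?prod_edge_le1//; apply: prodr_ge0 => k _; exact: edge_ge0.
Qed.

Lemma partial_cutoff_eq0 j x :
  2 * d <= x ord0 j <= 1 - 2 * d -> partial j cutoff x = 0.
Proof. by move=> h; rewrite partial_cutoff dedge_eq0 ?mul0r. Qed.

End cutoff.

(** * Cut-off linear maps on the unit cube *)

Section cell.
Context {R : realType} {n N : nat}.
Notation mu := (@lebesgue_rV R n).
Notation cube := (@unit_cube R n).

Lemma measurable_cube : measurable cube.
Proof.
have := @measurable_rect R n (fun=> `]0, 1[%classic) (fun=> _).
rewrite (_ : [set x | _] = cube); first by apply.
by apply/seteqP; split => x h i; have := h i; rewrite /= in_itv.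
Qed.

Lemma open_cube : open cube.
Proof.
rewrite (_ : cube = \big[setI/setT]_(j < n)
   ((fun x : 'rV[R]_n => x ord0 j) @^-1` `]0, 1[%classic)); last first.
  rewrite -bigcap_seq; apply/seteqP; split => [x + j _|x + j].
    by move=> /(_ j); rewrite /= in_itv.
  by move=> /(_ j); rewrite /= in_itv/= mem_index_enum; exact.
elim/big_ind : _ => [|A B oA oB|j _]; first exact: openT.
  exact: openI.
apply: open_comp; last exact: interval_open.
by move=> x _; exact: coord_continuous.
Qed.

Lemma cube_norm x : cube x -> `|x| <= 1.
Proof.
move=> h; apply: mx_norm_le => // i j; rewrite (ord1 i).
by have /andP[/ltW h0 /ltW h1] := h j; rewrite ger0_norm.
Qed.

Lemma lebesgue_cube : mu cube = 1%E.
Proof.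
have := @lebesgue_rV_box R n (fun=> `]0, 1[%classic) (fun=> _).
rewrite (_ : [set x | _] = cube) => [->//|]; last first.
  by apply/seteqP; split => x h i; have := h i; rewrite /= in_itv.
rewrite big1// => i _.
by rewrite lebesgue_measure_itv/= lte_fin ltr01 oppr0 adde0.
Qed.

Lemma lebesgue_cube_fin : (mu cube < +oo)%E.
Proof. by rewrite [mu _]lebesgue_cube ltry. Qed.

Lemma Rintegral_cube_cst (a : R) : \int[mu]_(x in cube) a = a.
Proof.
transitivity (a * fine (mu cube)); first by apply: Rintegral_cst; exact: measurable_cube.
by rewrite [mu _]lebesgue_cube mulr1.
Qed.

(** The part of the cube near its two faces orthogonal to the direction k, where
    alone the partial derivative of the cutoff in that direction is nonzero. *)
Definition layer (d : R) (k : 'I_n) : set 'rV[R]_n :=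
  [set x | cube x /\ ~~ (2 * d <= x ord0 k <= 1 - 2 * d)].

Definition slab (I : set R) (k : 'I_n) : set 'rV[R]_n :=
  [set x | forall i, (if i == k then I else `]0, 1[%classic) (x ord0 i)].

Let slab_side (I : set R) (k i : 'I_n) : measurable I ->
  measurable ((fun i => if i == k then I else `]0, 1[%classic) i).
Proof. by move=> mI /=; case: ifP. Qed.

Lemma lebesgue_slab (I : set R) (k : 'I_n) : measurable I ->
  mu (slab I k) = lebesgue_measure I.
Proof.
move=> mI; have -> : mu (slab I k) = _ := lebesgue_rV_box (fun i => slab_side k i mI).
rewrite (bigD1 k)//= eqxx big1 ?mule1// => i /negbTE ->.
by rewrite lebesgue_measure_itv/= lte_fin ltr01 oppr0 adde0.
Qed.

Lemma measurable_slab (I : set R) (k : 'I_n) : measurable I ->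
  measurable (slab I k).
Proof. by move=> mI; exact: (measurable_rect (fun i => slab_side k i mI)). Qed.

Lemma layerE d k : 0 < d -> 2 * d <= 1 -> layer d k =
  slab `]0, (2 * d)[%classic k `|` slab `](1 - 2 * d), 1[%classic k.
Proof.
move=> d0 d1; apply/seteqP; split => x.
  move=> [cx]; rewrite negb_and -!ltNge => /orP[h|h]; [left|right] => i;
    have := cx i; case: eqP => [->|_] /andP[h1 h2]; rewrite /= in_itv/= ?h1 ?h2//=.
  by rewrite h.
move=> [h|h].
  split.
    move=> i; have := h i; case: eqP => [->|_] /=; rewrite in_itv/= => /andP[-> /= h1] //.
    by lra.
  have := h k; rewrite eqxx/= in_itv/= => /andP[_ h1].
  by rewrite negb_and -ltNge h1.
split.
  move=> i; have := h i; case: eqP => [->|_] /=; rewrite in_itv/= => /andP[h1 ->] //.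
    by rewrite andbT; lra.
  by rewrite h1.
have := h k; rewrite eqxx/= in_itv/= => /andP[h1 _].
by rewrite negb_and orbC -ltNge h1.
Qed.

Lemma measurable_layer d k : 0 < d -> 2 * d <= 1 -> measurable (layer d k).
Proof.
by move=> d0 d1; rewrite layerE//; apply: measurableU; exact: measurable_slab.
Qed.

Lemma lebesgue_layer d k : 0 < d -> 2 * d <= 1 -> fine (mu (layer d k)) <= 4 * d.
Proof.
move=> d0 d1.
have E1 : lebesgue_measure (`]0, (2 * d)[%classic : set R) = (2 * d)%:E.
  rewrite lebesgue_measure_itv/= lte_fin ifT; last lra.
  by rewrite oppr0 adde0.
have E2 : lebesgue_measure (`](1 - 2 * d), 1[%classic : set R) = (2 * d)%:E.
  rewrite lebesgue_measure_itv/= lte_fin ifT; last lra.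
  by rewrite -EFinB; congr EFin; lra.
have : (mu (layer d k) <= (4 * d)%:E)%E.
  have mI (a b : R) : measurable (`]a, b[%classic : set R) by [].
  pose S1 := slab `]0, (2 * d)[%classic k.
  pose S2 := slab `](1 - 2 * d), 1[%classic k.
  have h : (mu (layer d k) <= mu S1 + mu S2)%E.
    rewrite layerE//; exact: (measureU2 mu (measurable_slab k (mI _ _))
      (measurable_slab k (mI _ _))).
  rewrite /S1 /S2 !lebesgue_slab// E1 E2 -EFinD in h; apply: (le_trans h).
  by rewrite lee_fin; lra.
move=> h; rewrite -lee_fin fineK// ge0_fin_numE//.
exact: le_lt_trans h (ltry _).
Qed.

(** There are n layers, each of measure at most 4 d; in each of them a linear
    map of size at most n |z| is multiplied by a partial derivative of the
    cutoff of size at most 2 step_bound / d. *)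
Definition cell_const : R := 1 + 8 * n%:R ^+ 2 * step_bound.

Lemma cell_const_gt0 : 0 < cell_const.
Proof. by rewrite ltr_pwDl// mulr_ge0// (le_trans _ (dstep_le 0)). Qed.

(** A linear map cut off near the boundary of the unit cube: the layer where the
    cutoff varies has thickness d while its gradient is of order 1/d, so that
    the mass of the gradient is bounded independently of d. *)
Lemma cell_potential (z : 'M[R]_(N, n)) (k : R) : 0 < k ->
  exists psi : 'rV[R]_n -> 'rV[R]_N, [/\ test_function cube psi,
    (exists A, [/\ measurable A, A `<=` cube, fine (mu A) <= k &
       forall y, cube y -> ~ A y -> jac psi y = z]) &
    \int[mu]_(y in cube) `|jac psi y| <= cell_const * `|z| ].
Proof.
move=> k0.
pose d : R := Num.min 4^-1 (k / (4 * n.+1%:R)).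
have n0 : 0 < n.+1%:R :> R by rewrite ltr0n.
have d0 : 0 < d by rewrite lt_min invr_gt0 ltr0n/= divr_gt0// mulr_gt0.
have d4 : d <= 4^-1 by rewrite ge_min lexx.
have d1 : 2 * d <= 1 by lra.
have dk : n%:R * (4 * d) <= k.
  have h : d <= k / (4 * n.+1%:R) by rewrite ge_min lexx orbT.
  rewrite ler_pdivlMr ?mulr_gt0// in h; apply: le_trans h.
  by move: d0; rewrite -(natr1 n); move: (n%:R : R) (d) => m e e0; nra.
pose eta : 'rV[R]_n -> R := cutoff d.
pose psi (y : 'rV[R]_n) : 'rV[R]_N := \row_i \sum_j (z i j * (y ord0 j * eta y)).
have seta : smooth eta by exact: smooth_cutoff.
have syj j : smooth (fun y : 'rV[R]_n => y ord0 j * eta y).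
  by apply: smoothM => //; exact: smooth_coord.
have szj i j : smooth (fun y : 'rV[R]_n => z i j * (y ord0 j * eta y)).
  by apply: smoothM => //; exact: smooth_cst.
have spsi : smooth psi.
  apply: smooth_row => i.
  rewrite (_ : (fun y => _) = fun y : 'rV[R]_n => \sum_j (z i j * (y ord0 j * eta y))).
    by apply: smooth_sum.
  by apply/funext => y; rewrite mxE.
have dsm (f : 'rV[R]_n -> R) : smooth f -> forall y, differentiable f y.
  by move=> sf y; exact: smooth_differentiable.
have jacE y i l : jac psi y i l =
    z i l * eta y + (\sum_j z i j * y ord0 j) * partial l eta y.
  rewrite mxE (_ : (fun y0 => _) = fun y : 'rV[R]_n => \sum_j (z i j * (y ord0 j * eta y))); last first.
    by apply/funext => u; rewrite mxE.
  have -> : partial l (fun y : 'rV[R]_n => \sum_j (z i j * (y ord0 j * eta y))) y =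
      \sum_j partial l (fun y : 'rV[R]_n => z i j * (y ord0 j * eta y)) y.
    rewrite /partial -derive_sum; last by move=> j; apply: diff_derivable; exact: dsm.
    by congr derive; apply/funext => u; rewrite fct_sumE.
  rewrite (eq_bigr (fun j => z i j * (y ord0 j * partial l eta y) +
      (if j == l then z i l * eta y else 0))); last first.
    move=> j _; rewrite partialM; [|exact: (dsm _ (smooth_cst _))|exact: dsm].
    rewrite partial_cst mulr0 addr0 partialM; [|exact: (dsm _ (smooth_coord _))|exact: dsm].
    rewrite partial_coord mulrDr eq_sym; congr (_ + _).
    by case: eqP => [->|_]; rewrite ?mulr1 ?mulr0// mulr0.
  rewrite big_split/= -big_mkcond/= big_pred1_eq addrC; congr (_ + _).
  by rewrite mulr_suml; apply: eq_bigr => j _; rewrite mulrA.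
pose A := \bigcup_(l in [set: 'I_n]) layer d l.
have mL l : measurable (layer d l) by exact: measurable_layer.
have mcube := measurable_cube.
have fcube := lebesgue_cube_fin.
have Lcube l : layer d l `<=` cube by move=> x [].
exists psi; split.
- split => //; exists [set x | forall i, `[d, (1 - d)]%classic (x ord0 i)]; split.
  + exact: (rV_compact (fun i => @segment_compact _ d (1 - d))).
  + move=> x h j; have := h j; rewrite /= in_itv/= => /andP[h1 h2]; apply/andP; split; lra.
  + move=> x h; apply/rowP => i; rewrite !mxE big1// => j _.
    have nx : ~ (forall k, d <= x ord0 k <= 1 - d).
      by move=> h'; apply: h => l; rewrite /= in_itv; exact: h'.
    by rewrite /eta cutoff_eq0 ?mulr0.
- exists A; split.
  + apply: fin_bigcup_measurable => //; exact: finite_finset.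
  + by move=> x [l _ /Lcube].
  + apply: le_trans dk.
    have mA : measurable A by apply: fin_bigcup_measurable => //; exact: finite_finset.
    rewrite -[A](@setIidl _ _ cube); last by move=> x [l _ /Lcube].
    rewrite -Rintegral_indic//.
    apply: (@le_trans _ _ (\int[mu]_(y in cube) \sum_(l < n) \1_(layer d l) y)).
      apply: le_Rintegral => //; first exact: Li_indic.
        by apply: Li_sum => // l _; exact: Li_indic.
      move=> x cx; rewrite indicE; case: (boolP (x \in A)) => [|_]; last first.
        by apply: sumr_ge0 => l _; rewrite indicE ler0n.
      rewrite inE => -[l _ xl]; rewrite (bigD1 l)//= indicE mem_set// lerDl.
      by apply: sumr_ge0 => l' _; rewrite indicE ler0n.
    rewrite Rintegral_sum//; last by move=> l _; exact: Li_indic.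
    rewrite -[n in n%:R]card_ord mulr_natl -sumr_const; apply: ler_sum => l _.
    by rewrite Rintegral_indic// (setIidl (@Lcube l)); exact: lebesgue_layer.
  + move=> y cy nA; apply/matrixP => i l.
    have hl l' : 2 * d <= y ord0 l' <= 1 - 2 * d.
      by apply/negPn/negP => h; apply: nA; exists l'.
    rewrite jacE partial_cutoff_eq0// mulr0 addr0 /eta cutoff_eq1 ?mulr1//.
- have b0 : 0 <= step_bound :> R.
    by apply: le_trans (dstep_le 0); rewrite normr_ge0.
  pose c : R := n%:R * (2 * step_bound / d).
  have c0 : 0 <= c.
    apply: mulr_ge0; first exact: ler0n.
    by apply: divr_ge0; [exact: mulr_ge0|exact: ltW].
  pose B y : R := `|z| + \sum_(l < n) (`|z| * c) * \1_(layer d l) y.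
  have lB : mu.-integrable cube (EFin \o B).
    apply: LiD => //; first exact: Li_cst.
    apply: Li_sum => // l _; apply: LiZ => //; exact: Li_indic.
  have JB y : cube y -> `|jac psi y| <= B y.
    move=> cy; have s0 : 0 <= \sum_(l < n) (`|z| * c) * \1_(layer d l) y :> R.
      by apply: sumr_ge0 => l _; rewrite indicE mulr_ge0 ?ler0n// mulr_ge0.
    apply: mx_norm_le => [|i l]; first by rewrite addr_ge0.
    rewrite jacE (le_trans (ler_normD _ _))// lerD//.
      rewrite normrM -[leRHS]mulr1 ler_pM// ?mx_norm_ge//.
      by rewrite ger0_norm ?cutoff_ge0 ?cutoff_le1.
    have [hl|hl] := boolP (2 * d <= y ord0 l <= 1 - 2 * d).
      by rewrite partial_cutoff_eq0// mulr0 normr0.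
    rewrite [leRHS](bigD1 l)//= -[leLHS]addr0 lerD//; last first.
      by apply: sumr_ge0 => l' _; rewrite indicE mulr_ge0 ?ler0n// mulr_ge0.
    have yL : layer d l y by split.
    rewrite indicE (mem_set yL) mulr1 normrM /c.
    rewrite (_ : `|z| * _ = (`|z| * n%:R) * (2 * step_bound / d)); last by rewrite !mulrA.
    have hp : `|partial l eta y| <= 2 * step_bound / d by exact: partial_cutoff_le.
    apply: ler_pM => //.
    apply: (le_trans (ler_norm_sum _ _ _)).
    rewrite -[n in n%:R]card_ord mulrC mulr_natl -sumr_const.
    apply: ler_sum => j _; rewrite normrM -[leRHS]mulr1 ler_pM// ?mx_norm_ge//.
    by have /andP[h1 h2] := cy j; rewrite ger0_norm ltW.
  have cJ : continuous (fun y => `|jac psi y|).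
    by move=> y; apply: (@continuous_comp _ _ _ (jac psi)); [exact: jac_continuous|exact: norm_continuous].
  apply: (@le_trans _ _ (\int[mu]_(y in cube) B y)).
    apply: le_Rintegral => //; apply: (Li_le mcube _ _ lB).
      exact: measurable_rV_continuous.
    by move=> y cy; rewrite normr_id; exact: JB.
  rewrite RintegralD//; [|exact: Li_cst|by apply: Li_sum => // l _; apply: LiZ => //; exact: Li_indic].
  rewrite [\int[mu]_(y in cube) `|z|]Rintegral_cube_cst.
  rewrite Rintegral_sum//; last first.
    by move=> l _; apply: LiZ => //; exact: Li_indic.
  rewrite /cell_const mulrDl mul1r lerD2l.
  apply: (@le_trans _ _ (\sum_(l < n) (`|z| * c * (4 * d)))).
    apply: ler_sum => l _; rewrite RintegralZl//; last exact: Li_indic.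
    rewrite Rintegral_indic// ler_wpM2l ?(mulr_ge0 (normr_ge0 z) c0)//.
    by rewrite (setIidl (@Lcube l)); exact: lebesgue_layer.
  rewrite sumr_const card_ord -mulr_natl /c le_eqVlt; apply/orP; left; apply/eqP.
  by field; rewrite gt_eqF.
Qed.

End cell.

(** * Density of continuous functions with compact support *)

Section density.
Context {R : realType} {n : nat}.
Notation mu := (@lebesgue_rV R n).
Implicit Types (U D : set 'rV[R]_n).

(** Unlike the preimages of intervals under the coordinate functions, open sets
    are stable under intersection, as is needed for an induction on Borel
    sets. *)
Lemma measurable_openE :
  @measurable _ 'rV[R]_n = <<s [set U : set 'rV[R]_n | open U] >>.
Proof.
apply/seteqP; split; last first.
  apply: smallest_sub; first exact: sigma_algebra_measurable.
  by move=> U; exact: measurable_rV_open.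
apply: smallest_sub => [|B]; first exact: smallest_sigma_algebra.
rewrite -bigcup_seq/= => -[i _ [Y mY <-]]; rewrite setTI.
have [S0 SC SU] := @smallest_sigma_algebra _ setT [set U : set 'rV[R]_n | open U].
pose S := [set Y : set R | <<s [set U : set 'rV[R]_n | open U] >>
   ((fun x : 'rV[R]_n => x ord0 i) @^-1` Y)].
suff : (@RGenOInfty.G R).-sigma.-measurable `<=` S.
  by rewrite -RGenOInfty.measurableE; apply.
apply: smallest_sub.
  split => [|A SA|F SF]; rewrite /S/=.
  - by rewrite preimage_set0.
  - by rewrite setTD preimage_setC -setTD; exact: SC.
  - by rewrite preimage_bigcup; exact: SU.
move=> _ [a ->]; apply: sub_sigma_algebra => /=.
apply: open_comp; last by rewrite set_itvoy; exact: open_gt.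
by move=> x _; exact: coord_continuous.
Qed.

(** Distance to the complement of U, capped by 1 so as to be defined when that
    complement is empty. *)
Definition depth_set U (x : 'rV[R]_n) : set R :=
  [set 1] `|` [set `|x - y| | y in ~` U].

Definition depth U x : R := inf (depth_set U x).

Lemma depth_has_inf U x : has_inf (depth_set U x).
Proof.
split; first by exists 1; left.
by exists 0 => _ [->|[y _ <-]].
Qed.

Lemma depth_ge0 U x : 0 <= depth U x.
Proof.
apply: lb_le_inf; first by exists 1; left.
by move=> _ [->|[y _ <-]].
Qed.

Lemma depth_le U x y : ~ U y -> depth U x <= `|x - y|.
Proof.
move=> nU; apply: ge_inf; last by right; exists y.
by case: (depth_has_inf U x).
Qed.

Lemma depth_lip U x y : depth U x <= depth U y + `|x - y|.
Proof.
rewrite -lerBlDr; apply: lb_le_inf; first by exists 1; left.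
move=> _ [->|[z nUz <-]].
  rewrite lerBlDr (@le_trans _ _ 1)// ?lerDl//.
  by apply: ge_inf; [case: (depth_has_inf U x)|left].
rewrite lerBlDr (le_trans (depth_le x nUz))// [leRHS]addrC.
exact: ler_distD.
Qed.

Lemma depth_continuous U : continuous (depth U).
Proof.
move=> x; apply/(@cvgrPdist_le _ _ _ _ (@nbhs_filter _ (x : 'rV[R]_n))) => e e0.
apply/nbhs_ballP; exists e => //= y; rewrite -ball_normE/= => xy.
rewrite ler_norml; have := depth_lip U x y; have := depth_lip U y x.
rewrite (distrC y); lra.
Qed.

Lemma depth_gt0 U x : open U -> U x -> 0 < depth U x.
Proof.
move=> oU Ux; have /nbhs_ballP[e /= e0 eU] : nbhs x U by exact: open_nbhs_nbhs.
apply: (@lt_le_trans _ _ (Num.min e 1)); first by rewrite lt_min e0 ltr01.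
apply: lb_le_inf; first by exists 1; left.
move=> _ [->|[y nUy <-]]; first by rewrite ge_min lexx orbT.
rewrite ge_min; apply/orP; left; rewrite leNgt; apply/negP => xy.
by apply: nUy; apply: eU; rewrite -ball_normE.
Qed.

(** Membership in the L^1 closure of C_c(D). *)
Definition cc_approx D (f : 'rV[R]_n -> R) := mu.-integrable D (EFin \o f) /\
  forall e : R, 0 < e -> exists2 a : 'rV[R]_n -> R,
    continuous a /\ compactly_supported D a &
    \int[mu]_(x in D) `|f x - a x| <= e.

Lemma Li_cc D a : measurable D -> continuous a -> compactly_supported D a ->
  mu.-integrable D (EFin \o a).
Proof.
by move=> mD ca /compactly_supportedW[M _ aM]; exact: Li_supp ca aM.
Qed.

Lemma cc_approx_lim D f : measurable D -> mu.-integrable D (EFin \o f) ->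
  (forall e, 0 < e -> exists2 g, cc_approx D g &
     \int[mu]_(x in D) `|f x - g x| <= e) -> cc_approx D f.
Proof.
move=> mD lf H; split => // e e0; have e20 : 0 < e / 2 by lra.
have [g [lg /(_ _ e20)[a [ca sa] ga]] fg] := H _ e20.
exists a => //; have la := Li_cc mD ca sa.
have l1 := Li_norm mD (LiB mD lf lg); have l2 := Li_norm mD (LiB mD lg la).
apply: (@le_trans _ _ (\int[mu]_(x in D) (`|f x - g x| + `|g x - a x|))).
  apply: le_Rintegral => //.
  - exact: (Li_norm mD (LiB mD lf la)).
  - exact: LiD.
  - by move=> x _; exact: ler_distD.
by rewrite RintegralD//; lra.
Qed.

Lemma compactly_supported_comb D (f g : 'rV[R]_n -> R) c :
  compactly_supported D f -> compactly_supported D g ->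
  compactly_supported D (fun x => f x + c * g x).
Proof.
move=> sf [K [cK KD g0]]; apply: compactly_supportedD => //.
by exists K; split => // x /g0 ->; rewrite mulr0.
Qed.

Lemma cc_approx_comb D f g c : measurable D -> cc_approx D f -> cc_approx D g ->
  cc_approx D (fun x => f x + c * g x).
Proof.
move=> mD [lf hf] [lg hg]; have lcg := LiZ c mD lg; split; first exact: LiD.
move=> e e0; have e20 : 0 < e / 2 by lra.
have c1 : 0 < `|c| + 1 by rewrite ltr_pwDr.
have [a [ca sa] fa] := hf _ e20.
have [b [cb sb] gb] := hg (e / 2 / (`|c| + 1)) (divr_gt0 e20 c1).
have la := Li_cc mD ca sa; have lb := Li_cc mD cb sb.
exists (fun x => a x + c * b x).
  split; last exact: compactly_supported_comb.
  move=> x; apply: (cvgD (ca x)).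
  exact: (cvgM (cvg_cst c) (cb x)).
have l1 := Li_norm mD (LiB mD lf la); have l2 := Li_norm mD (LiB mD lg lb).
apply: (@le_trans _ _ (\int[mu]_(x in D) (`|f x - a x| + `|c| * `|g x - b x|))).
  apply: le_Rintegral => //.
  - apply: Li_norm => //; apply: LiB => //; first exact: LiD.
    by apply: LiD => //; exact: LiZ.
  - by apply: LiD => //; exact: LiZ.
  - move=> x _; rewrite -normrM (le_trans _ (ler_normD _ _))// le_eqVlt.
    by apply/orP; left; apply/eqP; congr `|_|; ring.
rewrite RintegralD//; last exact: LiZ.
rewrite RintegralZl//.
have : `|c| * \int[mu]_(x in D) `|g x - b x| <= e / 2.
  apply: (@le_trans _ _ (`|c| * (e / 2 / (`|c| + 1)))); first by rewrite ler_wpM2l.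
  rewrite mulrA ler_pdivrMr//; nra.
lra.
Qed.

Lemma cc_approx0 D : measurable D -> cc_approx D (fun=> 0).
Proof.
move=> mD; split; first exact: integrable0.
move=> e e0; exists (fun=> 0).
  split; first exact: cst_continuous.
  by exists set0; split => //; exact: compact0.
rewrite (@eq_Rintegral _ _ _ _ _ (fun=> 0)).
  by rewrite Rintegral_cst// mul0r ltW.
by move=> x _; rewrite subrr normr0.
Qed.

Lemma cc_approx_eq D f g : measurable D -> {in D, f =1 g} ->
  cc_approx D f -> cc_approx D g.
Proof.
move=> mD fg [lf hf]; split.
  by apply: (eq_integrable mD _ _ _ lf) => x xD; rewrite /= fg.
move=> e /hf[a ca fa]; exists a => //.
by rewrite (eq_Rintegral _ (g := fun x => `|f x - a x|))// => x xD; rewrite fg.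
Qed.

(** Depth is continuous and vanishes outside D. *)
Lemma compact_depth D (M t : R) : (forall x, D x -> `|x| <= M) -> 0 < t ->
  compact [set x | t <= depth D x] /\ [set x | t <= depth D x] `<=` D.
Proof.
move=> DM t0.
have KV : [set x | t <= depth D x] `<=` D.
  move=> x /= h; apply: contrapT => nV.
  have := @depth_le D x x nV; rewrite subrr normr0 => h'.
  by have := le_trans h h'; rewrite leNgt t0.
split => //; apply: bounded_closed_compact.
  exists M; split; first exact: num_real.
  by move=> M' MM' x /KV/DM /le_trans; apply; exact: ltW.
have -> : [set x | t <= depth D x] = depth D @^-1` [set y : R | t <= y] by [].
by apply: closed_comp => [x _|]; [exact: depth_continuous|exact: closed_ge].
Qed.

Section indicators.
Variables (D : set 'rV[R]_n) (M : R).
Hypotheses (oD : open D) (DM : forall x, D x -> `|x| <= M).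

Let mD : measurable D := measurable_rV_open oD.
Let fD : (mu D < +oo)%E := lebesgue_bounded_lt_oo mD DM.

(** On D the truncations of (k + 1) depth - 1 to [0, 1] tend to the indicator of
    U. *)
Lemma cc_approx_open U : open U -> cc_approx D (\1_U : _ -> R).
Proof.
move=> oU.
have oV : open (U `&` D) by exact: openI.
have mU := measurable_rV_open oU.
split; first exact: Li_indic.
move=> e e0.
pose a (k : nat) x : R := Num.min 1 (Num.max 0 (k.+1%:R * depth (U `&` D) x - 1)).
have ca k : continuous (a k).
  have c1 : continuous (fun x => k.+1%:R * depth (U `&` D) x - 1).
    have c0 := continuous_mulR (@cst_continuous 'rV[R]_n R k.+1%:R)
      (@depth_continuous (U `&` D)).
    by move=> x; apply: (@continuousB _ _ _ _ _ x (c0 x)); exact: cst_continuous.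
  have c2 : continuous (fun x => Num.max 0 (k.+1%:R * depth (U `&` D) x - 1) : R).
    move=> x; apply: (@continuous_max R 'rV[R]_n (fun=> 0)
      (fun x => k.+1%:R * depth (U `&` D) x - 1) x _ (c1 x)); exact: cst_continuous.
  move=> x; apply: (@continuous_min R 'rV[R]_n (fun=> 1)
    (fun x => Num.max 0 (k.+1%:R * depth (U `&` D) x - 1)) x _ (c2 x)); exact: cst_continuous.
have a01 k x : 0 <= a k x <= 1.
  by rewrite /a le_min ler01 le_max lexx/= ge_min lexx.
have sa k : compactly_supported D (a k).
  exists [set x | k.+1%:R^-1 <= depth (U `&` D) x].
  have ki : 0 < k.+1%:R^-1 :> R by rewrite invr_gt0 ltr0n.
  have [cK KV] := compact_depth (fun x (h : (U `&` D) x) => DM h.2) ki.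
  split => //.
  - by move=> x /KV[].
  - move=> x /= /negP; rewrite -ltNge => h; rewrite /a.
    have k0 : 0 < k.+1%:R :> R by rewrite ltr0n.
    have : k.+1%:R * depth (U `&` D) x - 1 <= 0.
      by rewrite subr_le0 mulrC -ler_pdivlMr// mul1r ltW.
    by move=> /max_idPl ->; apply/min_idPr.
have lim x : D x -> a k x @[k --> \oo] --> (\1_U x : R).
  move=> Dx; apply: cvg_near_cst; have [Ux|nUx] := pselect (U x).
    rewrite indicE mem_set//=.
    have d0 := depth_gt0 oV (conj Ux Dx).
    near=> k; rewrite /a; apply/min_idPl; rewrite le_max; apply/orP; right.
    rewrite lerBrDr -ler_pdivrMr//.
    apply: (@le_trans _ _ k%:R); last by rewrite ler_nat.
    by near: k; exact: nbhs_infty_ger.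
  rewrite indicE memNset//=; near=> k; rewrite /a.
  have := @depth_le (U `&` D) x x (fun h => nUx h.1).
  rewrite subrr normr0 => h.
  have -> : depth (U `&` D) x = 0 by apply/eqP; rewrite eq_le h depth_ge0.
  by rewrite mulr0 sub0r (max_idPl _) ?oppr_le0// (min_idPr _).
have mi : measurable_fun D (\1_U : _ -> R) by exact: measurable_indic.
have bd k x : D x -> `|a k x| <= 1.
  by move=> _; have /andP[a0 a1] := a01 k x; rewrite ger0_norm.
have [k _ /(_ k)/(_ (leqnn k)) /= hk] := Rdominated_convergence mD
  (fun k => measurable_rV_continuous mD (ca k)) mi lim (Li_cst 1 mD fD) bd e0.
exists (a k) => //.
by rewrite (eq_Rintegral _ (g := fun x => `|a k x - \1_U x|))// => x _; rewrite distrC.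
Unshelve. all: by end_near. Qed.

(** Dynkin's pi-lambda theorem, starting from open sets. *)
Lemma cc_approx_indic A : measurable A -> cc_approx D (\1_A : _ -> R).
Proof.
rewrite measurable_openE; move: A.
apply: (@dynkin_induction _ _ [set U : set 'rV[R]_n | open U]
  [set A | cc_approx D (\1_A : _ -> R)]) => /=.
- exact: measurable_openE.
- by move=> A B /= oA oB; exact: openI.
- by apply: cc_approx_open; exact: openT.
- by move=> U oU; exact: cc_approx_open.
- move=> A mA hA.
  have hT := cc_approx_open openT.
  apply: (cc_approx_eq mD _ (cc_approx_comb (-1) mD hT hA)) => x _ /=.
  rewrite !indicE in_setT in_setC; case: (x \in A) => /=; lra.
- move=> F mF tF hF.
  apply: cc_approx_lim => //.
    by apply: Li_indic => //; exact: bigcupT_measurable.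
  move=> e e0.
  pose G k := \big[setU/set0]_(i < k) F i.
  have mG k : measurable (G k) by apply: bigsetU_measurable => i _; exact: mF.
  have hG k : cc_approx D (\1_(G k) : _ -> R).
    elim: k => [|k IH].
      apply: (cc_approx_eq mD _ (cc_approx0 mD)) => x _.
      by rewrite /G big_ord0 indicE in_set0.
    apply: (cc_approx_eq mD _ (cc_approx_comb 1 mD IH (hF k))) => x _ /=.
    rewrite /G big_ord_recr/= mul1r !indicE in_setU.
    case: (boolP (x \in F k)) => xk; last by rewrite orbF addr0.
    rewrite orbT memNset ?add0r//; rewrite inE in xk.
    rewrite -bigcup_mkord => -[i /= ik Fi].
    have E : i = k by apply: tF => //; exists x.
    by rewrite E ltnn in ik.
  have lim x : D x -> (\1_(G k) x : R) @[k --> \oo] --> (\1_(\bigcup_k F k) x : R).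
    move=> _; apply: cvg_near_cst; have [[i _ Fi]|nF] := pselect ((\bigcup_k F k) x).
      have -> : \1_(\bigcup_k F k) x = 1 :> R by rewrite indicE mem_set//; exists i.
      near=> k; rewrite indicE mem_set// /G -bigcup_mkord; exists i => //=.
      by near: k; exact: nbhs_infty_gt.
    near=> k; rewrite !indicE !memNset// /G -bigcup_mkord => -[i _ Fi].
    by apply: nF; exists i.
  have mi A : measurable A -> measurable_fun D (\1_A : _ -> R).
    by move=> mA; exact: measurable_indic.
  have bd k x : D x -> `|\1_(G k) x : R| <= 1.
    by move=> _; rewrite indicE; case: (_ \in _); rewrite ?normr1 ?normr0.
  have [k _ /(_ k)/(_ (leqnn k)) /= hk] := Rdominated_convergence mD
    (fun k => mi _ (mG k)) (mi _ (bigcupT_measurable _ mF)) lim (Li_cst 1 mD fD) bd e0.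
  exists (\1_(G k)) => //.
  rewrite (eq_Rintegral _ (g := fun x => `|\1_(G k) x - \1_(\bigcup_k F k) x|))// => x _.
  by rewrite distrC.
Unshelve. all: by end_near. Qed.

Import HBSimple.

(** Simple functions are dense, and are combinations of indicators. *)
Lemma cc_dense f e : mu.-integrable D (EFin \o f) -> 0 < e ->
  exists2 a : 'rV[R]_n -> R, continuous a /\ compactly_supported D a &
    \int[mu]_(x in D) `|f x - a x| <= e.
Proof.
move=> lf e0; suff [_] : cc_approx D f by apply.
apply: cc_approx_lim => // {}e {}e0.
have [g [lg _ /fine_cvgP[_ /cvgrPdist_le/(_ _ e0)]]] :=
  approximation_sfun_integrable mD lf.
move=> [k _ /(_ k)/(_ (leqnn k)) /= hk].
exists (HBSimple.SimpleFun.sort (g k)); last first.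
  rewrite sub0r normrN in hk; apply: le_trans hk.
  by rewrite /Rintegral; exact: ler_norm.
have E : HBSimple.SimpleFun.sort (g k) =
   fun x => \sum_(y <- finmap.enum_fset (fset_set (range (g k)))) y * \1_(g k @^-1` [set y]) x.
  by apply/funext => x; rewrite fimfunE fsbig_finite.
pose G s x := \sum_(y <- s) y * \1_(g k @^-1` [set y]) x.
suff : forall s, cc_approx D (G s).
  move=> /(_ (finmap.enum_fset (fset_set (range (g k))))).
  by apply: cc_approx_eq => // x _; rewrite [in RHS]E.
elim=> [|y s IH].
  by apply: (cc_approx_eq mD _ (cc_approx0 mD)) => x _; rewrite /G big_nil.
have my : measurable (g k @^-1` [set y]) by exact: measurable_sfunP.
apply: (cc_approx_eq mD _ (cc_approx_comb y mD IH (cc_approx_indic my))) => x _ /=.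
by rewrite /G big_cons addrC.
Qed.

End indicators.
End density.

(** * Convolution with a smooth kernel *)

Section mollifier.
Context {R : realType} {n : nat}.
Notation mu := (@lebesgue_rV R n).
Implicit Types (x y h : 'rV[R]_n) (K G : 'rV[R]_n -> R).

Definition lin_form (w : 'I_n -> R) (h : 'rV[R]_n) : R^o :=
  \sum_j w j * h ord0 j.

Lemma lin_form_is_linear w : linear (lin_form w).
Proof.
move=> a u v; rewrite /lin_form /GRing.scale/= mulr_sumr -big_split/=.
by apply: eq_bigr => j _; rewrite !mxE; ring.
Qed.

HB.instance Definition _ w := GRing.isLinear.Build R 'rV[R]_n R^o _
  (lin_form w) (lin_form_is_linear w).

Lemma lin_form_continuous w : continuous (lin_form w).
Proof.
apply: smooth_continuous; apply: smooth_sum => j _.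
by apply: smoothM; [exact: smooth_cst|exact: smooth_coord].
Qed.

Lemma differentiable_lin_form (f : 'rV[R]_n -> R) x w :
  (forall e, 0 < e -> exists2 d : R, 0 < d & forall h, `|h| < d ->
     `|f (h + x) - f x - lin_form w h| <= e * `|h|) ->
  differentiable f x /\ 'd f x = lin_form w :> ('rV[R]_n -> R).
Proof.
move=> H.
have E : forall e : R, 0 < e -> \forall h \near (0 : 'rV[R]_n),
    `|f (h + x) - (f x + lin_form w h)| <= e * `|h|.
  move=> e e0; have [d d0 hd] := H _ e0.
  apply/nbhs_ballP; exists d => //= h; rewrite -ball_normE/= sub0r normrN => hh.
  by have := hd _ hh; rewrite /= opprD addrA.
have D : 'd (f : 'rV[R]_n -> R^o) x = lin_form w :> ('rV[R]_n -> R^o).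
  apply: (@diff_unique R 'rV[R]_n R^o f (lin_form w) x (@lin_form_continuous w)).
  by apply/eqaddoP.
split => //; apply/(@diff_locallyP R 'rV[R]_n R^o x f); rewrite D.
by split; [exact: lin_form_continuous|apply/eqaddoP].
Qed.

Lemma derive_partial (f : 'rV[R]_n -> R) x h : differentiable f x ->
  'D_h f x = lin_form (fun j => partial j f x) h.
Proof.
move=> df; rewrite deriveE// [in LHS](row_sum_delta h) linear_sum/=.
by apply: eq_bigr => j _; rewrite linearZ/= /partial deriveE// mulrC.
Qed.

Lemma lin_form_delta w j : lin_form w (delta_mx ord0 j) = w j.
Proof.
rewrite /lin_form (bigD1 j)//= mxE !eqxx mulr1 big1 ?addr0// => k kj.
by rewrite mxE (negbTE kj) andbF mulr0.
Qed.

Lemma lin_form_le w h (e : R) : (forall j, `|w j| <= e) ->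
  `|lin_form w h| <= n%:R * e * `|h|.
Proof.
move=> we; apply: (le_trans (ler_norm_sum _ _ _)).
rewrite -[n in n%:R]card_ord -mulrA mulr_natl -sumr_const.
apply: ler_sum => j _; rewrite normrM ler_pM//; exact: mx_norm_ge.
Qed.

Lemma lin_formB w w' h : lin_form (fun j => w j - w' j) h = lin_form w h - lin_form w' h.
Proof.
by rewrite /lin_form -sumrB; apply: eq_bigr => j _; rewrite mulrBl.
Qed.

(** By the mean value theorem the remainder is bounded by the oscillation of the
    partial derivatives, which are uniformly continuous. *)
Lemma smooth_unif_diff K (M e : R) : smooth K -> (forall x, M < `|x| -> K x = 0) ->
  0 < e -> exists2 d : R, 0 < d & forall h x, `|h| < d ->
    `|K (h + x) - K x - lin_form (fun j => partial j K x) h| <= e * `|h|.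
Proof.
move=> sK K0 e0.
have n0 : 0 < n.+1%:R :> R by rewrite ltr0n.
have en0 : 0 < e / n.+1%:R by exact: divr_gt0.
have hj j : exists2 d : R, 0 < d & forall x y, `|x - y| < d ->
    `|partial j K x - partial j K y| <= e / n.+1%:R.
  apply: (@supp_unif_continuous _ _ _ _ M) => //.
    by apply: smooth_continuous; exact: smooth_partial.
  by move=> x xM; exact: partial_supp K0 xM.
have [d d0 hd] := uniform_radius hj
  (fun j a b ba hj x y xy => hj x y (lt_le_trans xy ba)).
exists d => // h x hh.
have dK y : differentiable K y by exact: smooth_differentiable.
have [s /andP[s0 s1]] := MVT_line x ltr01 (fun y => diff_derivable (v := h) (dK y)).
rewrite scale1r mul1r => ->; rewrite derive_partial// -lin_formB.
apply: (@le_trans _ _ (n%:R * (e / n.+1%:R) * `|h|)).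
  apply: lin_form_le => j; apply: hd.
  rewrite addrK normrZ gtr0_norm//; apply: le_lt_trans hh.
  by rewrite ler_piMl// ltW.
rewrite ler_wpM2r// mulrA ler_pdivrMr// mulrC ler_wpM2l ?(ltW e0)//.
by rewrite ler_nat.
Qed.

(** The kernel is evaluated at y - x, so that this is the usual convolution with
    the reflection of K. *)
Definition conv G K x : R := \int[mu]_y (G y * K (y - x)).

Lemma continuous_shiftB K x : continuous K -> continuous (fun y => K (y - x)).
Proof.
move=> cK.
rewrite (_ : (fun y => K (y - x)) = K \o aff (- x) 1).
  move=> y; apply: continuous_comp; last exact: cK.
  by apply: differentiable_continuous; exact: differentiable_aff.
by apply/funext => y; rewrite /= /aff scale1r addrC.
Qed.

Lemma supp_bounded K (M : R) : continuous K -> (forall x, M < `|x| -> K x = 0) ->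
  exists2 B : R, 0 < B & forall x, `|K x| <= B.
Proof.
move=> cK K0.
have : compact (K @` [set x : 'rV[R]_n | `|x| <= M]).
  apply: continuous_compact; last exact: compact_closed_ball.
  exact: continuous_subspaceT.
move=> /compact_bounded[B [Br hB]].
have BB : B < Num.max B 0 + 1 by rewrite ltr_pwDr// le_max lexx.
have B0 : 0 < Num.max B 0 + 1 by rewrite ltr_pwDr// le_max lexx orbT.
exists (Num.max B 0 + 1) => // x.
have [xM|xM] := leP `|x| M; first by apply: (hB _ BB); exists x.
by rewrite K0// normr0 ltW.
Qed.

Lemma Li_conv_integrand G K (M : R) x : mu.-integrable setT (EFin \o G) ->
  continuous K -> (forall x, M < `|x| -> K x = 0) ->
  mu.-integrable setT (EFin \o (fun y => G y * K (y - x))).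
Proof.
move=> lG cK K0; have [B B0 hB] := supp_bounded cK K0.
apply: (Li_le measurableT _ _ (LiZ B measurableT (Li_norm measurableT lG))).
  apply: measurable_funM; first exact: Li_measurable lG.
  by apply: measurable_rV_continuous => //; exact: continuous_shiftB.
by move=> y _; rewrite normrM mulrC ler_wpM2r.
Qed.

(** Uniform differentiability of the kernel permits differentiation under the
    integral sign. *)
Lemma conv_differentiable G K (M : R) x : mu.-integrable setT (EFin \o G) ->
  smooth K -> (forall x, M < `|x| -> K x = 0) ->
  differentiable (conv G K) x /\
  forall j, partial j (conv G K) x = conv G (fun y => - partial j K y) x.
Proof.
move=> lG sK K0.
have cK := smooth_continuous sK.
have sNp j : smooth (fun y => - partial j K y).
  by apply: smoothN; exact: smooth_partial.
have Np0 j y : M < `|y| -> - partial j K y = 0.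
  by move=> yM; rewrite (partial_supp j K0 yM) oppr0.
pose w j := conv G (fun y => - partial j K y) x.
have mT := @measurableT _ 'rV[R]_n.
have lK y := Li_conv_integrand y lG cK K0.
have lP j := Li_conv_integrand x lG (smooth_continuous (sNp j)) (Np0 j).
have lnG := Li_norm mT lG.
have [dc dE] : differentiable (conv G K) x /\
    'd (conv G K) x = lin_form w :> ('rV[R]_n -> R).
  apply: differentiable_lin_form => e e0.
  pose I := \int[mu]_y `|G y|.
  have I0 : 0 <= I by exact: Rintegral_ge0.
  have I1 : 0 < I + 1 by rewrite ltr_pwDr.
  have [d d0 hd] := smooth_unif_diff sK K0 (divr_gt0 e0 I1).
  exists d => // h hh.
  have -> : lin_form w h = \int[mu]_y (\sum_j h ord0 j * (G y * - partial j K (y - x))).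
    rewrite Rintegral_sum//; last by move=> j _; exact: LiZ.
    by apply: eq_bigr => j _; rewrite RintegralZl// mulrC.
  have lS : mu.-integrable setT
      (EFin \o (fun y => \sum_j h ord0 j * (G y * - partial j K (y - x)))).
    by apply: Li_sum => // j _; exact: LiZ.
  have l1 := LiB mT (lK (h + x)) (lK x).
  rewrite /conv -RintegralB// -RintegralB//.
  apply: (le_trans (le_normr_Rintegral mT (LiB mT l1 lS))).
  apply: (@le_trans _ _ (\int[mu]_y (e / (I + 1) * `|h| * `|G y|))).
    apply: le_Rintegral => //; [exact: (Li_norm mT (LiB mT l1 lS))|exact: LiZ|].
    move=> y _.
    have -> : G y * K (y - (h + x)) - G y * K (y - x) -
        \sum_j h ord0 j * (G y * - partial j K (y - x)) =
      (K (- h + (y - x)) - K (y - x) -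
         lin_form (fun j => partial j K (y - x)) (- h)) * G y.
      rewrite (_ : y - (h + x) = - h + (y - x)); last by rewrite opprD addrCA addrA.
      rewrite !mulrBl [G y * _]mulrC [G y * _ in X in _ - X - _]mulrC; congr (_ - _).
      by rewrite /lin_form mulr_suml; apply: eq_bigr => j _; rewrite !mxE; ring.
    rewrite normrM ler_wpM2r//.
    by have := hd (- h) (y - x); rewrite normrN; apply.
  rewrite RintegralZl// -/I mulrAC -mulrA -[leRHS]mulr1 mulrA [_ * `|h|]mulrC -!mulrA.
  rewrite mulr1 [leRHS]mulrC ler_wpM2l// ler_piMr ?ltW//.
  by rewrite mulrC ltr_pdivrMr// mul1r ltrDl.
split => // j.
have -> : partial j (conv G K) x = 'd (conv G K) x (delta_mx ord0 j).
  exact: deriveE.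
have -> : 'd (conv G K) x (delta_mx ord0 j) = lin_form w (delta_mx ord0 j) :> R.
  by rewrite dE.
exact: lin_form_delta.
Qed.

Lemma conv_smooth G K (M : R) : mu.-integrable setT (EFin \o G) ->
  smooth K -> (forall x, M < `|x| -> K x = 0) -> smooth (conv G K).
Proof.
move=> lG sK K0.
refine (@smooth_coind _ _ R [set f : 'rV[R]_n -> R | exists K, [/\ smooth K,
  (forall x, M < `|x| -> K x = 0) & f = conv G K]] _ _ _); last by exists K.
move=> _ [L [sL L0 ->]]; split=> [x|j]; first by have [] := conv_differentiable x lG sL L0.
exists (fun y => - partial j L y); split.
- by apply: smoothN; exact: smooth_partial.
- by move=> y yM; rewrite (partial_supp j L0 yM) oppr0.
- by apply/funext => x; have [_] := conv_differentiable x lG sL L0.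
Qed.

End mollifier.

(** * Mollification *)

Section moll_kernel.
Context {R : realType} {n : nat}.
Notation mu := (@lebesgue_rV R n).
Implicit Types (x y : 'rV[R]_n).

(** Each factor is supported in [-1, 1], so that bump lives on the unit ball of
    the sup norm. *)
Definition bump (x : 'rV[R]_n) : R :=
  \prod_(k < n) (flat 0 (1 * x ord0 k + 1) * flat 0 (- 1 * x ord0 k + 1)).

Lemma smooth_bump : smooth bump.
Proof. by apply: smooth_prod => k _; apply: smoothM; exact: smooth_flat. Qed.

Lemma bump_ge0 x : 0 <= bump x.
Proof. by apply: prodr_ge0 => k _; rewrite mulr_ge0 ?flat_ge0. Qed.

Lemma bumpN x : bump (- x) = bump x.
Proof.
apply: eq_bigr => k _; rewrite mulrC !mxE.
by congr (flat 0 _ * flat 0 _); ring.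
Qed.

Lemma bump_eq0 x : 1 <= `|x| -> bump x = 0.
Proof.
move=> x1; have : ~ forall i j, `|x i j| < 1.
  by move=> h; have := mx_norm_lt ltr01 h; rewrite ltNge x1.
move=> /existsNP[i /existsNP[k /negP]]; rewrite (ord1 i) -leNgt => xk.
rewrite /bump (bigD1 k)//= mul1r mulN1r.
have [x0|x0] := leP 0 (x ord0 k).
  rewrite ger0_norm// in xk.
  by rewrite (@flat_eq0 _ 0 (- _ + 1)) ?mulr0 ?mul0r//; lra.
rewrite ltr0_norm// in xk.
by rewrite (@flat_eq0 _ 0 (x ord0 k + 1)) ?mul0r//; lra.
Qed.

Definition bump_mass : R := \int[mu]_x bump x.

Lemma Li_bump : mu.-integrable setT (EFin \o bump).
Proof.
apply: (@Li_supp _ _ _ _ 1) => //; first exact: smooth_continuous smooth_bump.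
by move=> x /ltW; exact: bump_eq0.
Qed.

Lemma bump_mass_gt0 : 0 < bump_mass.
Proof.
have b0 : 0 < bump 0.
  by apply: prodr_gt0 => k _; rewrite mxE !mulr0 add0r mulr_gt0 ?flat_gt0.
have b20 : 0 < bump 0 / 2 by lra.
have := smooth_continuous smooth_bump (x := 0) => /cvgrPdist_le/(_ _ b20).
move=> /nbhs_ballP[r /= r0 hr].
pose B := [set x : 'rV[R]_n | forall i, `](- (r / 2)), (r / 2)[%classic (x ord0 i)].
have mI (i : 'I_n) : measurable (`](- (r / 2)), (r / 2)[%classic : set R) by [].
have mB : measurable B by exact: (measurable_rect mI).
have EB : mu B = (\prod_(i < n) r)%:E.
  have -> : mu B = _ := lebesgue_rV_box mI.
  rewrite -prodEFin; apply: eq_bigr => i _.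
  rewrite lebesgue_measure_itv/= lte_fin ifT; last lra.
  by rewrite -EFinB; congr EFin; lra.
have fB : (mu B < +oo)%E by rewrite EB ltry.
apply: (@lt_le_trans _ _ (bump 0 / 2 * fine (mu B))).
  by rewrite mulr_gt0// EB/= prodr_gt0.
rewrite -Rintegral_cst//.
apply: (@le_trans _ _ (\int[mu]_(x in B) bump x)).
  apply: le_Rintegral => //.
  - exact: Li_cst.
  - by apply: (@LiS _ _ _ _ setT) => //; exact: Li_bump.
  - move=> x Bx; have := hr x; rewrite -ball_normE/= sub0r normrN => /(_ _).
    have xr : `|x| < r.
      apply: mx_norm_lt => // i j; rewrite (ord1 i).
      by have := Bx j; rewrite /= in_itv/= ltr_norml => /andP[]; lra.
    by move=> /(_ xr); rewrite ler_norml => /andP[]; lra.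
apply: Rintegral_subset => //; first exact: Li_bump.
by move=> x _; exact: bump_ge0.
Qed.

(** The standard mollifier; being even it is its own reflection, so that [conv]
    is the usual convolution with it. *)
Definition moll (e : R) (x : 'rV[R]_n) : R :=
  (bump_mass^-1 * e^-1 ^+ n) *: bump (aff 0 e^-1 x).

Lemma smooth_moll e : smooth (moll e).
Proof. exact: smooth_aff smooth_bump. Qed.

Lemma moll_ge0 e x : 0 < e -> 0 <= moll e x.
Proof.
move=> e0; rewrite mulr_ge0 ?bump_ge0// mulr_ge0 ?invr_ge0 ?ltW// ?bump_mass_gt0//.
by rewrite exprn_gt0 ?invr_gt0.
Qed.

Lemma mollN e x : moll e (- x) = moll e x.
Proof. by rewrite /moll /aff !add0r scalerN bumpN. Qed.

Lemma moll_eq0 e x : 0 < e -> e <= `|x| -> moll e x = 0.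
Proof.
move=> e0 ex; rewrite /moll bump_eq0 ?scaler0// /aff add0r normrZ.
by rewrite gtr0_norm ?invr_gt0// mulrC ler_pdivlMr// mul1r.
Qed.

Lemma Rintegral_moll e : 0 < e -> \int[mu]_x moll e x = 1.
Proof.
move=> e0; have ei0 : 0 < e^-1 by rewrite invr_gt0.
have := Rintegral_aff 0 ei0 measurableT Li_bump.
rewrite preimage_setT invrK => E.
have la : mu.-integrable setT (EFin \o (fun x => bump (aff 0 e^-1 x))).
  by have := integrable_aff 0 ei0 measurableT Li_bump; rewrite preimage_setT.
rewrite RintegralZl// E -/bump_mass -mulrA [e^-1 ^+ n * _]mulrA -exprMn mulVf ?gt_eqF//.
by rewrite expr1n mul1r mulVf// gt_eqF// bump_mass_gt0.
Qed.

Lemma Li_ext (D : set 'rV[R]_n) (f : 'rV[R]_n -> R) : measurable D ->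
  (forall x, ~ D x -> f x = 0) -> mu.-integrable D (EFin \o f) ->
  mu.-integrable setT (EFin \o f).
Proof.
move=> mD f0 /(integrable_mkcond _ mD); apply: eq_integrable => // x _ /=.
by rewrite /patch; case: ifPn => //; rewrite notin_setE => /f0 ->.
Qed.

Section fixed_scale.
Variables (e : R) (e0 : 0 < e).

Let K := moll e.
Let cK : continuous K. Proof. exact: smooth_continuous (smooth_moll e). Qed.
Let K0 x : e < `|x| -> K x = 0. Proof. by move=> /ltW; exact: moll_eq0. Qed.
Let lK : mu.-integrable setT (EFin \o K). Proof. exact: (@Li_supp _ _ _ _ e). Qed.

Lemma Rintegral_moll_shift x : \int[mu]_y moll e (y - x) = 1.
Proof.
rewrite -(Rintegral_moll e0) -[RHS]mul1r.
have := Rintegral_aff (- x) ltr01 measurableT lK.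
rewrite preimage_setT invr1 expr1n => <-.
by apply: eq_Rintegral => y _; rewrite /aff scale1r addrC.
Qed.

Lemma Li_moll_shift x : mu.-integrable setT (EFin \o (fun y => moll e (y - x))).
Proof.
have := integrable_aff (- x) ltr01 measurableT lK.
rewrite preimage_setT; apply: eq_integrable => // y _.
by rewrite /= /aff scale1r addrC.
Qed.

(** Young's inequality, by Tonelli's theorem. *)
Lemma conv_L1 (g : 'rV[R]_n -> R) : mu.-integrable setT (EFin \o g) ->
  mu.-integrable setT (EFin \o conv g (moll e)) /\
  \int[mu]_x `|conv g (moll e) x| <= \int[mu]_x `|g x|.
Proof.
move=> lg; have mT := @measurableT _ 'rV[R]_n.
have mg := Li_measurable lg.
have mK : measurable_fun setT K by exact: measurable_rV_continuous.
have lng := Li_norm mT lg.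
pose k (p : 'rV[R]_n * 'rV[R]_n) : \bar R := (`|g p.2| * K (p.2 - p.1))%:E.
have mk : measurable_fun setT k.
  apply/measurable_EFinP; apply: measurable_funM.
    by apply: measurableT_comp => //; exact: measurableT_comp.
  apply: measurableT_comp => //; apply: measurable_fun_rVP => i.
  rewrite (_ : (fun t => _) = fun p : 'rV[R]_n * 'rV[R]_n => p.2 ord0 i - p.1 ord0 i).
    apply: measurable_funB.
      exact: (measurableT_comp (measurable_coord i) measurable_snd).
    exact: (measurableT_comp (measurable_coord i) measurable_fst).
  by apply/funext => p; rewrite !mxE.
have k0 p : (0 <= k p)%E by rewrite lee_fin mulr_ge0// moll_ge0.
have := @fubini_tonelli _ _ _ _ R mu mu k mk k0.
have Ey y : (\int[mu]_x k (x, y) = `|g y|%:E)%E.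
  rewrite (_ : (fun x => k (x, y)) = fun x => (`|g y|%:E * (K (x - y))%:E)%E); last first.
    by apply/funext => x; rewrite /k/= EFinM -[K (x - y)]mollN opprB.
  rewrite ge0_integralZl//; last 2 first.
    by have /measurable_EFinP := Li_measurable (Li_moll_shift y).
    by move=> x _; rewrite lee_fin moll_ge0.
  have := Rintegral_moll_shift y; rewrite /Rintegral => E.
  rewrite -[X in (_ * X)%E]fineK ?E ?mule1//.
  exact: (integrable_fin_num mT (Li_moll_shift y)).
under [in RHS]eq_integral do rewrite Ey.
move=> E.
have lgK x : mu.-integrable setT (EFin \o (fun y => g y * K (y - x))).
  exact: Li_conv_integrand lg cK K0.
have le x : (`|conv g K x|%:E <= \int[mu]_y k (x, y))%E.
  have h := le_normr_Rintegral mT (lgK x).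
  rewrite -lee_fin in h; apply: (le_trans h).
  rewrite /Rintegral fineK; last first.
    exact: (integrable_fin_num mT (Li_norm mT (lgK x))).
  rewrite le_eqVlt; apply/orP; left; apply/eqP; apply: eq_integral => y _.
  by rewrite /k/= normrM (ger0_norm (moll_ge0 _ e0)).
have mc : measurable_fun setT (conv g K).
  apply: measurable_rV_continuous => //; apply: smooth_continuous.
  exact: (conv_smooth lg (smooth_moll e) K0).
have H : (\int[mu]_x `|conv g K x|%:E <= \int[mu]_x `|g x|%:E)%E.
  rewrite -E; apply: ge0_le_integral => //.
  - by apply/measurable_EFinP; exact: measurableT_comp.
  - exact: (@measurable_fun_fubini_tonelli_F _ _ 'rV[R]_n 'rV[R]_n R mu k mk k0).
have fg : (\int[mu]_x `|g x|%:E \is a fin_num)%E.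
  exact: (integrable_fin_num mT lng).
have lc : mu.-integrable setT (EFin \o conv g K).
  apply/integrableP; split; first exact/measurable_EFinP.
  apply: (le_lt_trans H); by rewrite ltey; move: fg; rewrite fin_numE => /andP[].
split => //; rewrite /Rintegral; apply: fine_le => //.
exact: (integrable_fin_num mT (Li_norm mT lc)).
Qed.

(** The kernel is a probability density supported in a ball of radius e. *)
Lemma conv_close (a : 'rV[R]_n -> R) (d w : R) x :
  mu.-integrable setT (EFin \o a) -> e <= d -> 0 <= w ->
  (forall x y, `|x - y| < d -> `|a x - a y| <= w) ->
  `|conv a (moll e) x - a x| <= w.
Proof.
move=> la ed w0 ha; have mT := @measurableT _ 'rV[R]_n.
have l1 := Li_conv_integrand x la cK K0.
have lm := Li_moll_shift x.
have l2 := LiZ (a x) mT lm.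
have -> : conv a (moll e) x - a x =
    \int[mu]_y (a y * K (y - x) - a x * K (y - x)).
  by rewrite RintegralB// RintegralZl// Rintegral_moll_shift mulr1.
apply: (le_trans (le_normr_Rintegral mT (LiB mT l1 l2))).
rewrite -[leRHS]mulr1 -(Rintegral_moll_shift x) -RintegralZl//.
apply: le_Rintegral => //; [exact: (Li_norm mT (LiB mT l1 l2))|exact: LiZ|].
move=> y _; rewrite -mulrBl normrM (ger0_norm (moll_ge0 _ e0)).
have [h|h] := ltP `|y - x| e.
  by rewrite ler_wpM2r ?moll_ge0// ha// (lt_le_trans h).
by rewrite /K moll_eq0// !mulr0.
Qed.

End fixed_scale.

(** Young's inequality reduces the claim to a continuous function with compact
    support, for which the convergence is uniform. *)
Lemma moll_cvg (D : set 'rV[R]_n) (M : R) (G : 'rV[R]_n -> R) (eta : R) :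
  open D -> (forall x, D x -> `|x| <= M) -> (forall x, ~ D x -> G x = 0) ->
  mu.-integrable D (EFin \o G) -> 0 < eta ->
  exists2 e0 : R, 0 < e0 & forall e, 0 < e -> e <= e0 ->
    \int[mu]_x `|conv G (moll e) x - G x| <= eta.
Proof.
move=> oD DM G0 lG eta0; have mD := measurable_rV_open oD.
have mT := @measurableT _ 'rV[R]_n.
have e30 : 0 < eta / 3 by lra.
have [a [ca sa] Ga] := cc_dense oD DM lG e30.
have lGT := Li_ext mD G0 lG.
have aD x : ~ D x -> a x = 0 by exact: compactly_supported_notin sa.
have aM x : M < `|x| -> a x = 0.
  by move=> xM; apply: aD => /DM; rewrite leNgt xM.
have laT := Li_supp mT ca aM.
have lGa := LiB mT lGT laT.
rewrite Rintegral_supp in Ga; last first.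
  by move=> x nD; rewrite G0// aD// subrr normr0.
pose B := [set x : 'rV[R]_n | `|x| <= M + 1].
have mB : measurable B by exact: measurable_norm_le.
have fB : (mu B < +oo)%E by apply: (lebesgue_bounded_lt_oo mB) => x; exact.
have m0 : 0 <= fine (mu B) by exact: fine_ge0.
have m1 : 0 < fine (mu B) + 1 by lra.
have [d d0 hd] := supp_unif_continuous ca aM (divr_gt0 e30 m1).
exists (Num.min d 1); first by rewrite lt_min d0/=.
move=> e e0; rewrite le_min => /andP[ed e1].
have [lc1 hc1] := conv_L1 e0 lGa.
have [lca _] := conv_L1 e0 laT.
have [lcG _] := conv_L1 e0 lGT.
have cK := smooth_continuous (smooth_moll e).
have K0 x : e < `|x| -> moll e x = 0 by move=> /ltW; exact: moll_eq0.
have cB x : conv (fun y => G y - a y) (moll e) x = conv G (moll e) x - conv a (moll e) x.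
  rewrite /conv -RintegralB//; last 2 first.
  - exact: (Li_conv_integrand x lGT cK K0).
  - exact: (Li_conv_integrand x laT cK K0).
  by apply: eq_Rintegral => y _; rewrite mulrBl.
have lcaa := LiB mT lca laT.
have hb : \int[mu]_x `|conv a (moll e) x - a x| <= eta / 3.
  rewrite -(@Rintegral_supp _ _ B); last first.
    move=> x /= /negP; rewrite -ltNge => xM.
    rewrite aM; last lra.
    rewrite subr0 /conv (@eq_Rintegral _ _ _ _ _ (fun=> 0)) ?Rintegral_cst ?mul0r ?normr0//.
    move=> y _; have [yx|yx] := leP e `|y - x|; first by rewrite moll_eq0 ?mulr0.
    rewrite aM ?mul0r//; have := ler_normD (x - y) y.
    by rewrite subrK distrC; lra.
  apply: (@le_trans _ _ (eta / 3 / (fine (mu B) + 1) * fine (mu B))).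
    apply: Rintegral_le_cst => //.
      by apply: (@LiS _ _ _ _ setT) => //; exact: Li_norm.
    move=> x _; apply: (conv_close e0 x laT ed) => //.
    by rewrite ltW// divr_gt0.
  by rewrite mulrAC ler_pdivrMr// ler_pM2l//; lra.
have l1 := Li_norm mT lc1; have l2 := Li_norm mT lcaa; have l3 := Li_norm mT lGa.
apply: (@le_trans _ _ (\int[mu]_x (`|conv (fun y => G y - a y) (moll e) x| +
    `|conv a (moll e) x - a x| + `|G x - a x|))).
  apply: le_Rintegral => //.
  - exact: (Li_norm mT (LiB mT lcG lGT)).
  - by apply: LiD => //; exact: LiD.
  move=> x _; rewrite cB.
  have -> : conv G (moll e) x - G x = conv G (moll e) x - conv a (moll e) x +
     (conv a (moll e) x - a x) - (G x - a x) by ring.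
  by rewrite (le_trans (ler_normB _ _))// lerD2r ler_normD.
rewrite RintegralD//; last exact: LiD.
by rewrite RintegralD//; lra.
Qed.

End moll_kernel.

(** * Weak gradients *)

Section weak.
Context {R : realType} {n : nat}.
Notation mu := (@lebesgue_rV R n).

Lemma Li_mul_bounded d (T : measurableType d) (m : {measure set T -> \bar R})
    (A : set T) (f g : T -> R) (B : R) :
  measurable A -> m.-integrable A (EFin \o f) -> measurable_fun A g ->
  (forall x, A x -> `|g x| <= B) ->
  m.-integrable A (EFin \o (fun x => f x * g x)).
Proof.
move=> mA lf mg gB; apply: (Li_le mA _ _ (LiZ B mA (Li_norm mA lf))).
  by apply: measurable_funM => //; exact: Li_measurable lf.
by move=> x Ax; rewrite normrM mulrC ler_wpM2r// gB.
Qed.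

Lemma Li_mul_test (A : set 'rV[R]_n) (f psi : 'rV[R]_n -> R) (M : R) :
  measurable A -> mu.-integrable A (EFin \o f) -> continuous psi ->
  (forall x, M < `|x| -> psi x = 0) ->
  mu.-integrable A (EFin \o (fun x => f x * psi x)).
Proof.
move=> mA lf cpsi p0; have [B _ hB] := supp_bounded cpsi p0.
by apply: (Li_mul_bounded (B := B)) => //; exact: measurable_rV_continuous.
Qed.

Lemma Rintegral_eq0_ae d (T : measurableType d) (m : {measure set T -> \bar R})
    (A : set T) (f : T -> R) : measurable A -> m.-integrable A (EFin \o f) ->
  \int[m]_(x in A) `|f x| = 0 -> ae_eq m A f (cst 0).
Proof.
move=> mA lf f0.
have mf : measurable_fun A (EFin \o f) by exact: measurable_int lf.
have E : (\int[m]_(x in A) `|(EFin \o f) x| = 0)%E.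
  rewrite -[LHS]fineK; last exact: (integrable_fin_num mA (Li_norm mA lf)).
  by rewrite -[fine _]/(\int[m]_(x in A) `|f x|) f0.
have := (ae_eq_integral_abs m mA mf).1 E; apply: filterS => x /= h Ax.
by have [] := h Ax.
Qed.

Section domain.
Variables (D : set 'rV[R]_n) (M : R).
Hypotheses (oD : open D) (DM : forall x, D x -> `|x| <= M).

Let mD : measurable D := measurable_rV_open oD.

Lemma test_moll_shift (e : R) x : 0 < e -> e < depth D x ->
  test_function D (fun y => moll e (y - x)).
Proof.
move=> e0 ex; split.
  rewrite (_ : (fun y => _) = fun y : 'rV[R]_n => 1 *: moll e (aff (- x) 1 y)).
    by apply: smooth_aff; exact: smooth_moll.
  by apply/funext => y; rewrite scale1r /aff scale1r addrC.
exists (aff x 1 @` [set y | `|y| <= e]); split.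
- apply: continuous_compact; last exact: compact_closed_ball.
  apply: continuous_subspaceT => y; apply: differentiable_continuous.
  exact: differentiable_aff.
- move=> _ [y ye <-]; apply: contrapT => nD; have := depth_le x nD.
  by rewrite /aff scale1r opprD addNKr normrN => h; have := le_trans h ye; rewrite leNgt ex.
- move=> y ny; rewrite moll_eq0// leNgt; apply/negP => h; apply: ny.
  by exists (y - x); [exact: ltW|rewrite /aff scale1r addrC subrK].
Qed.

Lemma depth_superlevel_measurable (t : R) :
  measurable (D `&` [set x | t < depth D x]).
Proof.
apply: measurable_superlevel => //; apply: measurable_rV_continuous => //.
exact: depth_continuous.
Qed.

(** Mollifying G means testing it against functions supported in D, as long as
    one stays away from the boundary of D; so the mollifications of G vanish
    there. *)
Lemma du_bois_reymond (G : 'rV[R]_n -> R) : mu.-integrable D (EFin \o G) ->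
  (forall psi : 'rV[R]_n -> R, test_function D psi ->
     \int[mu]_(x in D) (G x * psi x) = 0) ->
  \int[mu]_(x in D) `|G x| = 0.
Proof.
move=> lG G0; have mT := @measurableT _ 'rV[R]_n.
pose G' x := if x \in D then G x else 0.
have G'E x : D x -> G' x = G x by move=> Dx; rewrite /G' mem_set.
have G'0 x : ~ D x -> G' x = 0 by move=> Dx; rewrite /G' memNset.
have lG' : mu.-integrable D (EFin \o G').
  by apply: (eq_integrable mD (EFin \o G) _ _ lG) => x; rewrite inE => Dx /=; rewrite G'E.
pose A t := D `&` [set x | t < depth D x].
have mA t : measurable (A t) by exact: depth_superlevel_measurable.
have AD t : A t `<=` D by move=> x [].
have lnG := Li_norm mD lG.
have hA t : 0 < t -> \int[mu]_(x in A t) `|G x| = 0.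
  move=> t0; apply/eqP; rewrite eq_le Rintegral_ge0// andbT.
  apply/ler_addgt0Pl => eta eta0; rewrite addr0.
  have [e0 e00 he] := moll_cvg oD DM G'0 lG' eta0.
  have e1 : 0 < Num.min e0 (t / 2) by rewrite lt_min e00/= divr_gt0.
  have e2 : Num.min e0 (t / 2) <= e0 by rewrite ge_min lexx.
  have e3 : Num.min e0 (t / 2) < t.
    by rewrite gt_min; apply/orP; right; lra.
  move: (Num.min _ _) e1 e2 e3 => e e1 e2 e3.
  apply: le_trans (he e e1 e2).
  have lc : mu.-integrable setT (EFin \o (fun x => `|conv G' (moll e) x - G' x|)).
    apply: Li_norm => //; apply: LiB => //; last exact: (Li_ext mD G'0 lG').
    by have [] := conv_L1 e1 (Li_ext mD G'0 lG').
  rewrite (_ : \int[mu]_(x in A t) `|G x| =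
      \int[mu]_(x in A t) `|conv G' (moll e) x - G' x|); last first.
    apply: eq_Rintegral => x; rewrite inE => -[Dx xt].
    rewrite G'E// [conv _ _ _](_ : _ = 0) ?sub0r ?normrN//.
    rewrite /conv -(@Rintegral_supp _ _ D) => [|y nDy]; last by rewrite G'0 ?mul0r.
    rewrite -[RHS](G0 (fun y => moll e (y - x))); last first.
      by apply: test_moll_shift => //; exact: lt_trans e3 xt.
    by apply: eq_Rintegral => y; rewrite inE => Dy; rewrite G'E.
  by apply: Rintegral_subset.
pose f_ k x : R := `|G x| * \1_(A k.+1%:R^-1) x.
have mf k : measurable_fun D (f_ k).
  apply: measurable_funM; first exact: Li_measurable lnG.
  exact: measurable_indic.
apply/eqP; rewrite eq_le Rintegral_ge0// andbT.
apply/ler_addgt0Pl => e e0; rewrite addr0.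
have hcv x : D x -> f_ k x @[k --> \oo] --> `|G x|.
  move=> Dx; apply: cvg_near_cst; have d0 := depth_gt0 oD Dx.
  near=> k; rewrite /f_ indicE mem_set ?mulr1//; split => //=.
  by near: k; exact: (near_infty_natSinv_lt (PosNum d0)).
have fle k x : D x -> `|f_ k x| <= `|G x|.
  by move=> _; rewrite /f_ indicE; case: (x \in _); rewrite ?mulr1 ?mulr0 ?normr_id ?normr0.
have [k _ /(_ k (leqnn k)) hk] :=
  Rdominated_convergence mD mf (Li_measurable lnG) hcv lnG fle e0.
have lf : mu.-integrable D (EFin \o f_ k) by exact: (Li_le mD (mf k) (fle k) lnG).
have f0 : \int[mu]_(x in D) f_ k x = 0.
  rewrite (Rintegral_split mD (mA k.+1%:R^-1) (@AD _) lf).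
  rewrite (_ : \int[mu]_(x in A _) f_ k x = \int[mu]_(x in A k.+1%:R^-1) `|G x|); last first.
    by apply: eq_Rintegral => x xA; rewrite /f_ indicE xA mulr1.
  rewrite hA// add0r; transitivity (\int[mu]_(x in D `\` A k.+1%:R^-1) (0 : R)).
    by apply: eq_Rintegral => x; rewrite inE => -[_ nA]; rewrite /f_ indicE memNset// mulr0.
  by rewrite Rintegral_cst ?mul0r//; exact: measurableD.
apply: le_trans hk; rewrite -[leLHS]subr0 -f0 -RintegralB//.
apply: le_Rintegral => //; [exact: LiB|by apply: Li_norm => //; exact: LiB|].
by move=> x _; rewrite distrC ler_norm.
Unshelve. all: by end_near.
Qed.

End domain.
End weak.

Section weak_gradients.
Context {R : realType} {n N : nat}.
Notation mu := (@lebesgue_rV R n).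
Variables (D : set 'rV[R]_n) (M : R).
Hypotheses (oD : open D) (DM : forall x, D x -> `|x| <= M).
Implicit Types (u v phi : 'rV[R]_n -> 'rV[R]_N) (G H : 'rV[R]_n -> 'M[R]_(N, n)).

Let mD : measurable D := measurable_rV_open oD.
Let fD : (mu D < +oo)%E := lebesgue_bounded_lt_oo mD DM.

Lemma test_smooth (V : normedModType R) (psi : 'rV[R]_n -> V) : test_function D psi -> smooth psi.
Proof. by case. Qed.

Lemma test_supp (V : normedModType R) (psi : 'rV[R]_n -> V) x : test_function D psi ->
  M < `|x| -> psi x = 0.
Proof.
move=> [_ sp] xM; apply: (compactly_supported_notin sp) => /DM.
by rewrite leNgt xM.
Qed.

Lemma Li_test_mul (f psi : 'rV[R]_n -> R) : mu.-integrable D (EFin \o f) ->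
  test_function D psi -> mu.-integrable D (EFin \o (fun x => f x * psi x)).
Proof.
move=> lf tpsi; apply: (Li_mul_test (M := M)) => //.
  exact: smooth_continuous (test_smooth tpsi).
by move=> x; exact: test_supp.
Qed.

Lemma Li_test_partial (j : 'I_n) (f psi : 'rV[R]_n -> R) : mu.-integrable D (EFin \o f) ->
  test_function D psi -> mu.-integrable D (EFin \o (fun x => f x * partial j psi x)).
Proof.
move=> lf tpsi; apply: (Li_mul_test (M := M)) => //.
  by apply: smooth_continuous; apply: smooth_partial; exact: test_smooth tpsi.
by move=> x; apply: partial_supp => y; exact: test_supp.
Qed.

Lemma weak_gradient_unique u G H : weak_gradient D u G -> weak_gradient D u H ->
  ae_eq mu D G H.
Proof.
move=> [_ lG hG] [_ lH hH].
have hij i j : ae_eq mu D (fun x => G x i j - H x i j) (cst 0).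
  have lij := LiB mD (lG i j) (lH i j).
  apply: (Rintegral_eq0_ae mD lij); apply: (du_bois_reymond oD DM lij).
  move=> psi tpsi.
  rewrite (_ : \int[mu]_(x in D) _ = \int[mu]_(x in D) (G x i j * psi x - H x i j * psi x)).
    rewrite (RintegralB mD (Li_test_mul (lG i j) tpsi) (Li_test_mul (lH i j) tpsi)).
    have := hG i j psi tpsi; rewrite (hH i j psi tpsi) => /oppr_inj ->.
    by rewrite subrr.
  by apply: eq_Rintegral => x _; rewrite mulrBl.
have := filter_forall (ae_filter_ringOfSetsType mu)
  (fun i => filter_forall (ae_filter_ringOfSetsType mu) (hij i)).
apply: filterS => x h Dx; apply/matrixP => i j.
by have := h i j Dx => /= /subr0_eq.
Qed.

Lemma wgradP u : W11 D u -> weak_gradient D u (wgrad D u).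
Proof. by move=> [G hG]; apply: (@xgetPex _ _ [set G | weak_gradient D u G]); exists G. Qed.

Lemma weak_gradient_lin (c : R) u v G H : weak_gradient D u G -> weak_gradient D v H ->
  weak_gradient D (fun x => u x + c *: v x) (fun x => G x + c *: H x).
Proof.
move=> [lu lG hG] [lv lH hH].
have lin m k (f g : 'rV[R]_n -> 'M[R]_(m, k)) i j :
    mu.-integrable D (EFin \o (fun x => f x i j)) ->
    mu.-integrable D (EFin \o (fun x => g x i j)) ->
    mu.-integrable D (EFin \o (fun x => (f x + c *: g x) i j)).
  move=> lf lg; have := LiD mD lf (LiZ c mD lg).
  by apply: eq_integrable => // x _; rewrite /= !mxE.
split => [i j|i j|i j psi tpsi]; [exact: (lin _ _ _ _ _ _ (lu i j) (lv i j))|exact: (lin _ _ _ _ _ _ (lG i j) (lH i j))|].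
transitivity (\int[mu]_(x in D) (u x ord0 i * partial j psi x +
    c * (v x ord0 i * partial j psi x))).
  by apply: eq_Rintegral => x _; rewrite !mxE mulrDl mulrA.
have lup := Li_test_partial j (lu ord0 i) tpsi.
have lvp := Li_test_partial j (lv ord0 i) tpsi.
have lGp := Li_test_mul (lG i j) tpsi.
have lHp := Li_test_mul (lH i j) tpsi.
rewrite (RintegralD mD lup (LiZ c mD lvp)) (RintegralZl _ mD lvp).
rewrite hG// hH// mulrN -opprD; congr (- _).
rewrite -(RintegralZl _ mD lHp) -(RintegralD mD lGp (LiZ c mD lHp)).
by apply: eq_Rintegral => x _; rewrite !mxE mulrDl mulrA.
Qed.

Lemma weak_gradientD u v G H : weak_gradient D u G -> weak_gradient D v H ->
  weak_gradient D (u \+ v) (fun x => G x + H x).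
Proof.
move=> hG hH; have := weak_gradient_lin 1 hG hH.
by congr (weak_gradient _ _ _); apply/funext => x; rewrite scale1r.
Qed.

Lemma weak_gradientB u v G H : weak_gradient D u G -> weak_gradient D v H ->
  weak_gradient D (u \- v) (fun x => G x - H x).
Proof.
move=> hG hH; have := weak_gradient_lin (- 1) hG hH.
by congr (weak_gradient _ _ _); apply/funext => x; rewrite scaleN1r.
Qed.

Lemma jac_weak_gradient phi : test_function D phi -> weak_gradient D phi (jac phi).
Proof.
move=> tphi; have sphi := test_smooth tphi.
have sc i := smooth_rowP i sphi.
have p0 i x : M < `|x| -> phi x ord0 i = 0.
  by move=> xM; rewrite (test_supp tphi xM) mxE.
split.
- move=> i j; rewrite (ord1 i); apply: (Li_supp (M := M)) => //.
    exact: smooth_continuous (sc j).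
  by move=> x; exact: p0.
- move=> i j; apply: (Li_supp (M := M)) => //.
    rewrite (_ : (fun x => _) = partial j (fun x => phi x ord0 i)).
      by apply: smooth_continuous; exact: smooth_partial.
    by apply/funext => x; rewrite mxE.
  by move=> x xM; rewrite mxE; apply: partial_supp xM => y; exact: p0.
move=> i j psi tpsi.
rewrite (@Rintegral_supp _ _ D (fun x => phi x ord0 i * partial j psi x)); last first.
  move=> x nD; have -> : phi x = 0 := compactly_supported_notin tphi.2 nD.
  by rewrite mxE mul0r.
rewrite (@Rintegral_supp _ _ D (fun x => jac phi x i j * psi x)); last first.
  by move=> x nD; rewrite (compactly_supported_notin tpsi.2 nD) mulr0.
rewrite (@Rintegral_by_parts _ _ _ _ _ M).
- by congr (- _); apply: eq_Rintegral => x _; rewrite mxE.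
- by move=> x; exact: smooth_differentiable.
- by apply: smooth_continuous; exact: smooth_partial.
- by move=> x; apply: smooth_differentiable; exact: test_smooth tpsi.
- by apply: smooth_continuous; apply: smooth_partial; exact: test_smooth tpsi.
- by move=> x; exact: test_supp.
Qed.

Lemma compact_depth_gap (K : set 'rV[R]_n) : compact K -> K `<=` D ->
  exists2 t : R, 0 < t & forall x, K x -> t < depth D x.
Proof.
move=> cK KD.
have /compact_near_coveringP := cK.
move=> /(_ nat \oo (fun k x => k.+1%:R^-1 < depth D x) _) [].
  move=> x Kx; have d0 := depth_gt0 oD (KD _ Kx).
  have d20 : 0 < depth D x / 2 by rewrite divr_gt0.
  exists ([set y | depth D x / 2 < depth D y], [set k | k.+1%:R^-1 < depth D x / 2]).
    split => /=; last exact: (near_infty_natSinv_lt (PosNum d20)).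
    rewrite /=; have := @depth_continuous _ _ D x.
    move=> /(_ [set s | depth D x / 2 < s]); apply; apply: lt_nbhsr.
    by rewrite ltr_pdivrMr// ltr_pMr// ltr1n.
  by move=> [y k] /= [h1 h2]; exact: lt_trans h2 h1.
move=> k _ /(_ k (leqnn k)) h; exists k.+1%:R^-1; first by rewrite invr_gt0 ltr0n.
by move=> x Kx; exact: h.
Qed.

Lemma mx_norm_le_sum p q (z : 'M[R]_(p, q)) : `|z| <= \sum_i \sum_j `|z i j|.
Proof.
apply: mx_norm_le => [|i j]; first by apply: sumr_ge0 => i _; exact: sumr_ge0.
rewrite (bigD1 i)//= (bigD1 j)//= -addrA lerDl addr_ge0//.
  exact: sumr_ge0.
by apply: sumr_ge0 => k _; exact: sumr_ge0.
Qed.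

Lemma measurable_mx_norm p q (A : set 'rV[R]_n) (G : 'rV[R]_n -> 'M[R]_(p, q)) : measurable A ->
  (forall i j, measurable_fun A (fun x => G x i j)) ->
  measurable_fun A (fun x => `|G x|).
Proof.
move=> mA mG; apply: (measurable_comp_mx (F := fun z => `|z|)) => //.
by move=> z; exact: norm_continuous.
Qed.

Lemma Li_mx_norm p q (A : set 'rV[R]_n) (G : 'rV[R]_n -> 'M[R]_(p, q)) : measurable A -> mx_integrable A G ->
  mu.-integrable A (EFin \o (fun x => `|G x|)).
Proof.
move=> mA lG.
have lS : mu.-integrable A (EFin \o (fun x => \sum_i \sum_j `|G x i j|)).
  apply: Li_sum => // i _; apply: Li_sum => // j _; exact: (Li_norm mA (lG i j)).
apply: (Li_le mA _ _ lS); last by move=> x _; rewrite normr_id mx_norm_le_sum.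
by apply: measurable_mx_norm => // i j; exact: (Li_measurable (lG i j)).
Qed.

Lemma mx_integrableB p q (A : set 'rV[R]_n) (G H : 'rV[R]_n -> 'M[R]_(p, q)) : measurable A -> mx_integrable A G ->
  mx_integrable A H -> mx_integrable A (fun x => G x - H x).
Proof.
move=> mA lG lH i j; have := LiB mA (lG i j) (lH i j).
by apply: eq_integrable => // x _; rewrite /= !mxE.
Qed.

Lemma mx_integrableD p q (A : set 'rV[R]_n) (G H : 'rV[R]_n -> 'M[R]_(p, q)) : measurable A -> mx_integrable A G ->
  mx_integrable A H -> mx_integrable A (fun x => G x + H x).
Proof.
move=> mA lG lH i j; have := LiD mA (lG i j) (lH i j).
by apply: eq_integrable => // x _; rewrite /= !mxE.
Qed.

Lemma mx_integrable_cst p q (A : set 'rV[R]_n) (z : 'M[R]_(p, q)) : measurable A ->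
  (mu A < +oo)%E -> mx_integrable A (fun=> z).
Proof. by move=> mA fA i j; exact: Li_cst. Qed.

Lemma mx_integrableS p q (A B : set 'rV[R]_n) (G : 'rV[R]_n -> 'M[R]_(p, q)) : measurable A -> measurable B ->
  A `<=` B -> mx_integrable B G -> mx_integrable A G.
Proof. by move=> mA mB AB lG i j; exact: (LiS mB mA AB (lG i j)). Qed.

(** Mollifying a map with compact support in D and mollifying its weak gradient
    come to the same, since the kernel is itself a test function once it is
    centred away from the boundary. *)
Lemma compactly_supported_approx phi G (eta : R) : compactly_supported D phi ->
  weak_gradient D phi G -> 0 < eta ->
  exists2 psi : 'rV[R]_n -> 'rV[R]_N, test_function D psi &
    \int[mu]_(x in D) `|jac psi x - G x| <= eta.
Proof.
move=> sphi [lphi lG hG] eta0.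
have [K [cK KD phi0]] := sphi.
have mT := @measurableT _ 'rV[R]_n.
have [t t0 Kt] := compact_depth_gap cK KD.
have oDK : open (D `\` K).
  rewrite setDE; apply: openI => //; apply: closed_openC.
  exact: (compact_closed (@norm_hausdorff _ _) cK).
have DKM x : (D `\` K) x -> `|x| <= M by move=> [/DM].
have mDK := measurable_rV_open oDK.
have DKD : D `\` K `<=` D by move=> x [].
have G0 i j : \int[mu]_(x in D `\` K) `|G x i j| = 0.
  apply: (du_bois_reymond oDK DKM); first exact: (LiS mD mDK DKD (lG i j)).
  move=> psi tpsi; have tD := test_function_sub DKD tpsi.
  have sp x : ~ (D `\` K) x -> psi x = 0 by exact: compactly_supported_notin tpsi.2.
  transitivity (\int[mu]_(x in D) (G x i j * psi x)).
    rewrite (@Rintegral_supp _ _ D (fun x => G x i j * psi x)); last first.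
      by move=> x nD; rewrite sp ?mulr0// => -[].
    by apply: Rintegral_supp => x nD; rewrite sp ?mulr0.
  apply: oppr_inj; rewrite -(hG i j psi tD) oppr0.
  transitivity (\int[mu]_(x in D) (0 : R)); last by rewrite Rintegral_cst// mul0r.
  apply: eq_Rintegral => x _; have [Kx|nKx] := pselect (K x).
    have sK : compactly_supported (D `\` K) psi := tpsi.2.
    have [L [cL LD psi0]] := sK.
    have nL : ~ L x by move=> /LD[].
    by rewrite (partial_eq0 j (compactly_supported_near cL psi0 nL)) mulr0.
  by rewrite phi0// mxE mul0r.
have mK : measurable K.
  rewrite -[K]setCK; apply: measurableC; apply: measurable_rV_open.
  by apply: closed_openC; exact: (compact_closed (@norm_hausdorff _ _) cK).
(* G vanishes almost everywhere off K; this representative does so everywhere,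
   hence its mollifications vanish near the boundary of D. *)
pose H i j x : R := G x i j * \1_K x.
have H0 i j x : ~ D x -> H i j x = 0.
  by move=> nD; rewrite /H indicE memNset ?mulr0// => /KD.
have lH i j : mu.-integrable D (EFin \o H i j).
  apply: (Li_mul_bounded (B := 1) mD (lG i j)); first exact: measurable_indic.
  by move=> x _; rewrite indicE; case: (x \in K); rewrite ?normr1 ?normr0.
have lGH i j := LiB mD (lG i j) (lH i j).
have GH0 i j : \int[mu]_(x in D) `|G x i j - H i j x| = 0.
  rewrite (Rintegral_split mD mDK DKD (Li_norm mD (lGH i j))).
  rewrite (_ : \int[mu]_(x in _ `\` K) _ = \int[mu]_(x in D `\` K) `|G x i j|); last first.
    apply: eq_Rintegral => x; rewrite inE => -[_ nK].
    by rewrite /H indicE memNset// mulr0 subr0.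
  rewrite G0 add0r; transitivity (\int[mu]_(x in D `\` (D `\` K)) (0 : R)).
    apply: eq_Rintegral => x; rewrite inE => -[Dx nDK].
    have Kx : K x by apply: contrapT => nK; apply: nDK.
    by rewrite /H indicE mem_set// mulr1 subrr normr0.
  by rewrite Rintegral_cst ?mul0r//; exact: measurableD.
have GH_mul i j (psi : 'rV[R]_n -> R) : test_function D psi ->
    \int[mu]_(x in D) (G x i j * psi x) = \int[mu]_(x in D) (H i j x * psi x).
  move=> tpsi; apply/eqP; rewrite -subr_eq0 -normr_eq0.
  have [B B0 hB] := supp_bounded (smooth_continuous (test_smooth tpsi))
    (fun x => @test_supp _ psi x tpsi).
  rewrite -(RintegralB mD (Li_test_mul (lG i j) tpsi) (Li_test_mul (lH i j) tpsi)).
  have lB := LiB mD (Li_test_mul (lG i j) tpsi) (Li_test_mul (lH i j) tpsi).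
  rewrite eq_le normr_ge0 andbT; apply: (le_trans (le_normr_Rintegral mD lB)).
  rewrite -[leRHS](mulr0 B) -(GH0 i j) -(RintegralZl _ mD (Li_norm mD (lGH i j))).
  apply: (le_Rintegral mD (Li_norm mD lB) (LiZ B mD (Li_norm mD (lGH i j)))) => x _.
  by rewrite -mulrBl normrM mulrC ler_wpM2r.
pose eta' := eta / (N * n).+1%:R.
have eta'0 : 0 < eta' by rewrite divr_gt0.
have [e0 e00 he0] := uniform_radius
  (fun p : 'I_N * 'I_n => moll_cvg oD DM (@H0 p.1 p.2) (lH p.1 p.2) eta'0)
  (fun p a b ba h e e_gt0 eb => h e e_gt0 (le_trans eb ba)).
pose e : R := Num.min (t / 2) e0.
have e_gt0 : 0 < e by rewrite lt_min divr_gt0.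
have et : e <= t / 2 by rewrite ge_min lexx.
have ee0 : e <= e0 by rewrite ge_min lexx orbT.
have far x y : depth D x <= e -> K y -> e < `|y - x|.
  by move=> dx /Kt dy; have := depth_lip D y x; lra.
pose P (i : 'I_N) (y : 'rV[R]_n) : R := phi y ord0 i.
have lP i : mu.-integrable setT (EFin \o P i).
  apply: (Li_ext mD); last exact: lphi.
  by move=> x nD; rewrite /P phi0 ?mxE// => /KD.
have P0 i y : ~ K y -> P i y = 0 by move=> nK; rewrite /P phi0// mxE.
have K0 (x : 'rV[R]_n) : e < `|x| -> moll e x = 0 by move=> /ltW; exact: moll_eq0.
have sm := smooth_moll (R := R) (n := n) e.
pose psi x : 'rV[R]_N := \row_i conv (P i) (moll e) x.
have psiE i : (fun y => psi y ord0 i) = conv (P i) (moll e).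
  by apply/funext => y; rewrite mxE.
have tpsi : test_function D psi.
  split; first by apply: smooth_row => i; rewrite psiE; exact: (conv_smooth (lP i) sm K0).
  have [cd dD] := compact_depth DM e_gt0.
  exists [set x | e <= depth D x]; split => // x /= /negP; rewrite -ltNge => /ltW xe.
  apply/rowP => i; rewrite !mxE /conv; transitivity (\int[mu]_y (0 : R)).
    apply: eq_Rintegral => y _; have [Ky|nK] := pselect (K y); last by rewrite P0// mul0r.
    by rewrite K0 ?mulr0//; exact: far.
  by rewrite Rintegral_cst// mul0r.
have jacpsi x i j : jac psi x i j = conv (H i j) (moll e) x.
  rewrite mxE psiE; have [_ ->] := conv_differentiable x (lP i) sm K0.
  rewrite /conv; have [xe|xe] := leP (depth D x) e.
    apply: eq_Rintegral => y _; have [Ky|nK] := pselect (K y); last first.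
      by rewrite P0// mul0r /H indicE memNset// mulr0 mul0r.
    by rewrite (partial_supp j K0 (far x y xe Ky)) (K0 _ (far x y xe Ky)) oppr0 !mulr0.
  have tm := test_moll_shift e_gt0 xe.
  have pm y : partial j (fun y => moll e (y - x)) y = partial j (moll e) (y - x).
    have := partial_aff (- x) 1 j (fun z => smooth_differentiable z sm).
    rewrite (_ : (fun x0 => _) = fun y => moll e (y - x)); last first.
      by apply/funext => z; rewrite /aff scale1r addrC.
    by move=> ->; rewrite scale1r /aff scale1r addrC.
  rewrite -(@Rintegral_supp _ _ D (fun y => P i y * - partial j (moll e) (y - x))); last first.
    by move=> y nD; rewrite P0 ?mul0r// => /KD.
  transitivity (- \int[mu]_(y in D) (phi y ord0 i * partial j (fun y => moll e (y - x)) y)).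
    rewrite -mulN1r -(RintegralZl (- 1) mD (Li_test_partial j (lphi ord0 i) tm)).
    by apply: eq_Rintegral => y _; rewrite pm mulN1r mulrN.
  rewrite hG// opprK GH_mul//; apply: Rintegral_supp => y nD.
  by rewrite H0 ?mul0r.
exists psi => //.
have lc i j : mu.-integrable setT (EFin \o (fun x => `|conv (H i j) (moll e) x - H i j x|)).
  have lHT := Li_ext mD (@H0 i j) (lH i j).
  by apply: Li_norm => //; apply: LiB => //; have [] := conv_L1 e_gt0 lHT.
have lcD i j := LiS mT mD (@subsetT _ D) (lc i j).
have lsum i j := LiD mD (lcD i j) (Li_norm mD (lGH i j)).
have [_ ljac _] := jac_weak_gradient tpsi.
apply: (@le_trans _ _ (\int[mu]_(x in D) (\sum_i \sum_j
    (`|conv (H i j) (moll e) x - H i j x| + `|G x i j - H i j x|)))).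
  apply: le_Rintegral => //.
  - by apply: Li_mx_norm => //; exact: mx_integrableB.
  - by apply: Li_sum => // i _; apply: Li_sum.
  move=> x _; apply: (le_trans (mx_norm_le_sum _)).
  apply: ler_sum => i _; apply: ler_sum => j _.
  have -> : (jac psi x - G x) i j =
      (conv (H i j) (moll e) x - H i j x) - (G x i j - H i j x).
    transitivity (jac psi x i j - G x i j); first by rewrite mxE [X in _ + X]mxE.
    by rewrite jacpsi; ring.
  exact: ler_normB.
rewrite Rintegral_sum//; last by move=> i _; exact: Li_sum.
apply: (@le_trans _ _ (\sum_(i < N) \sum_(j < n) eta')).
  apply: ler_sum => i _; rewrite Rintegral_sum//; apply: ler_sum => j _.
  rewrite (RintegralD mD (lcD i j) (Li_norm mD (lGH i j))) GH0 addr0.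
  apply: le_trans (he0 (i, j) e e_gt0 ee0).
  exact: Rintegral_subset.
rewrite !sumr_const !card_ord -mulrnA -mulr_natr /eta' mulrAC ler_pdivrMr//.
by rewrite ler_pM2l// ler_nat mulnC.
Qed.

End weak_gradients.

(** * Boxes and grids *)

Section box.
Context {R : realType} {n : nat}.
Notation mu := (@lebesgue_rV R n).
Notation cube := (@unit_cube R n).
Implicit Types (c x y : 'rV[R]_n) (r : R).

(** Defined as a preimage of the unit cube so that the changes of variables
    apply as they are. *)
Definition box c r : set 'rV[R]_n := aff (- (r^-1 *: c)) r^-1 @^-1` cube.

Lemma boxP c r x : 0 < r ->
  box c r x <-> forall j, c ord0 j < x ord0 j < c ord0 j + r.
Proof.
move=> r0.
have E j : 0 < (aff (- (r^-1 *: c)) r^-1 x) ord0 j < 1 =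
    (c ord0 j < x ord0 j < c ord0 j + r).
  have -> : aff (- (r^-1 *: c)) r^-1 x ord0 j = (x ord0 j - c ord0 j) / r.
    by rewrite !mxE; ring.
  by rewrite pmulr_lgt0 ?invr_gt0// ltr_pdivrMr// mul1r subr_gt0 ltrBlDl.
by split => h j; have := h j; rewrite E.
Qed.

Lemma measurable_box c r : measurable (box c r).
Proof. by apply: measurable_preimage_aff; exact: measurable_cube. Qed.

Lemma box_image c r : r != 0 -> aff c r @` cube = box c r.
Proof.
move=> r0; apply/seteqP; split => [_ [y cy <-]|x bx].
  by rewrite /box/= affK.
by exists (aff (- (r^-1 *: c)) r^-1 x) => //; exact: aff_invK.
Qed.

Lemma lebesgue_box c r : 0 < r -> mu (box c r) = (r ^+ n)%:E.
Proof.
move=> r0; have ri0 : 0 < r^-1 by rewrite invr_gt0.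
have -> : mu (box c r) = _ := lebesgue_rV_aff (- (r^-1 *: c)) ri0 (@measurable_cube R n).
by have -> : lebesgue_rV n cube = 1%E := lebesgue_cube; rewrite invrK mule1.
Qed.

Lemma lebesgue_box_fin c r : 0 < r -> (mu (box c r) < +oo)%E.
Proof. by move=> r0; rewrite [mu _]lebesgue_box// ltry. Qed.

Lemma Rintegral_box_cst c r (a : R) : 0 < r ->
  \int[mu]_(x in box c r) a = a * r ^+ n.
Proof.
move=> r0; transitivity (a * fine (mu (box c r))).
  by apply: Rintegral_cst; exact: measurable_box.
by rewrite [mu _]lebesgue_box.
Qed.

Lemma Rintegral_box_outside c r (A : set 'rV[R]_n) f a : 0 < r -> measurable A ->
  A `<=` box c r -> (forall x, ~ A x -> f x = a) ->
  \int[mu]_(x in box c r `\` A) f x = (r ^+ n - fine (mu A)) * a.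
Proof.
move=> r0 mA AB fa; have mB := measurable_box c r.
have lc := Li_cst a mB (lebesgue_box_fin c r0).
have := Rintegral_split mB mA AB lc; rewrite Rintegral_box_cst// Rintegral_cst//.
rewrite [_ * r ^+ n]mulrC [a * _]mulrC mulrBl => ->; rewrite addrC addKr.
by apply: eq_Rintegral => x; rewrite inE => -[_ /fa].
Qed.

Lemma box_norm c r x : 0 < r -> box c r x -> `|x| <= `|c| + r.
Proof.
move=> r0 /(boxP _ _ r0) h; apply: mx_norm_le => [|i j]; first by rewrite addr_ge0// ltW.
rewrite (ord1 i); have := h j; have := mx_norm_ge c ord0 j.
by rewrite !ler_norml => /andP[h1 h2] /andP[h3 h4]; apply/andP; split; lra.
Qed.

Lemma box_diam c r x y : 0 < r -> box c r x -> box c r y -> `|x - y| <= r.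
Proof.
move=> r0 /(boxP _ _ r0) hx /(boxP _ _ r0) hy; apply: mx_norm_le => [|i j]; first exact: ltW.
rewrite (ord1 i) !mxE; have := hx j; have := hy j.
by rewrite ler_norml => /andP[h1 h2] /andP[h3 h4]; apply/andP; split; lra.
Qed.

Lemma preimage_box c r : r != 0 -> aff c r @^-1` box c r = cube.
Proof.
by move=> r0; apply/seteqP; split => x; rewrite /box/= affK.
Qed.

Lemma Rintegral_box c r f : 0 < r -> mu.-integrable (box c r) (EFin \o f) ->
  \int[mu]_(x in box c r) f x = r ^+ n * \int[mu]_(y in cube) f (aff c r y).
Proof.
move=> r0 lf; have := Rintegral_aff c r0 (measurable_box c r) lf.
rewrite preimage_box ?gt_eqF// => ->.
by rewrite mulrA -exprMn divff ?gt_eqF// expr1n mul1r.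
Qed.

Lemma Li_box_inv c r g : 0 < r -> mu.-integrable cube (EFin \o g) ->
  mu.-integrable (box c r) (EFin \o (fun x => g (aff (- (r^-1 *: c)) r^-1 x))).
Proof.
move=> r0 lg; have ri0 : 0 < r^-1 by rewrite invr_gt0.
exact: (integrable_aff (- (r^-1 *: c)) ri0 (@measurable_cube R n) lg).
Qed.

Lemma Rintegral_box_inv c r g : 0 < r -> mu.-integrable cube (EFin \o g) ->
  \int[mu]_(x in box c r) g (aff (- (r^-1 *: c)) r^-1 x) = r ^+ n * \int[mu]_(y in cube) g y.
Proof.
move=> r0 lg; have ri0 : 0 < r^-1 by rewrite invr_gt0.
by rewrite (Rintegral_aff (- (r^-1 *: c)) ri0 (@measurable_cube R n) lg) invrK.
Qed.

Lemma bounded_in_box (D : set 'rV[R]_n) (M : R) : (forall x, D x -> `|x| <= M) ->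
  exists (c : 'rV[R]_n) (r : R), 0 < r /\ D `<=` box c r.
Proof.
move=> DM; have M0 := normr_ge0 M; have MM := ler_norm M.
have r0 : 0 < 2 * (`|M| + 1) by lra.
exists (const_mx (- (`|M| + 1))), (2 * (`|M| + 1)); split => // x /DM xM.
apply/(boxP _ _ r0) => j; rewrite mxE; have := le_trans (mx_norm_ge x ord0 j) xM.
by rewrite ler_norml => /andP[? ?]; apply/andP; split; lra.
Qed.

Lemma Rintegral_mul_indic (A D : set 'rV[R]_n) f : measurable D -> measurable A ->
  A `<=` D -> mu.-integrable D (EFin \o f) ->
  mu.-integrable D (EFin \o (fun x => f x * \1_A x)) /\
  \int[mu]_(x in D) (f x * \1_A x) = \int[mu]_(x in A) f x.
Proof.
move=> mD mA AD lf.
have l1 : mu.-integrable D (EFin \o (fun x => f x * \1_A x)).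
  apply: (Li_mul_bounded (B := 1) mD lf); first exact: measurable_indic.
  by move=> x _; rewrite indicE; case: (x \in A); rewrite ?normr1 ?normr0.
split => //; rewrite (Rintegral_split mD mA AD l1).
rewrite (_ : \int[mu]_(x in A) _ = \int[mu]_(x in A) f x); last first.
  by apply: eq_Rintegral => x xA; rewrite indicE xA mulr1.
rewrite (_ : \int[mu]_(x in D `\` A) _ = \int[mu]_(x in D `\` A) (0 : R)).
  by rewrite Rintegral_cst ?mul0r ?addr0//; exact: measurableD.
apply: eq_Rintegral => x; rewrite inE => -[_ nA].
by rewrite indicE memNset// mulr0.
Qed.

End box.

Section grid.
Context {R : realType} {n : nat}.
Notation mu := (@lebesgue_rV R n).
Notation cube := (@unit_cube R n).
Variables (c : 'rV[R]_n) (r : R) (p : nat).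
Hypotheses (r0 : 0 < r) (p0 : (0 < p)%N).
Notation idx := {ffun 'I_n -> 'I_p}.

Definition mesh : R := r / p%:R.
Definition corner (a : idx) : 'rV[R]_n := c + mesh *: \row_j (a j)%:R.
Definition cell (a : idx) : set 'rV[R]_n := box (corner a) mesh.

Let pR0 : 0 < p%:R :> R. Proof. by rewrite ltr0n. Qed.

Lemma mesh_gt0 : 0 < mesh. Proof. exact: divr_gt0. Qed.

Let s0 := mesh_gt0.

Lemma cellP a x : cell a x <-> forall j,
  c ord0 j + mesh * (a j)%:R < x ord0 j < c ord0 j + mesh * ((a j)%:R + 1).
Proof.
split=> [/(boxP _ _ s0) h j|h]; last apply/(boxP _ _ s0) => j.
  by have := h j; rewrite !mxE mulrDr mulr1 addrA.
by have := h j; rewrite !mxE mulrDr mulr1 addrA.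
Qed.

Lemma cell_sub a : cell a `<=` box c r.
Proof.
move=> x /cellP h; apply/(boxP _ _ r0) => j; have /andP[h1 h2] := h j.
have a0 : 0 <= mesh * (a j)%:R by rewrite mulr_ge0// ltW.
have a1 : mesh * ((a j)%:R + 1) <= r.
  by rewrite /mesh mulrAC ler_pdivrMr// ler_pM2l// natr1 ler_nat.
by apply/andP; split; lra.
Qed.

Lemma cell_inj a b x : cell a x -> cell b x -> a = b.
Proof.
move=> /cellP ha /cellP hb; apply/ffunP => j; apply/val_inj/eqP => /=.
have le (k l : nat) : c ord0 j + mesh * k%:R < x ord0 j ->
    x ord0 j < c ord0 j + mesh * (l%:R + 1) -> (k <= l)%N.
  move=> h1 h2; have := lt_trans h1 h2.
  by rewrite ltrD2l ltr_pM2l// natr1 ltr_nat ltnS.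
have /andP[a1 a2] := ha j; have /andP[b1 b2] := hb j.
by rewrite eqn_leq !le.
Qed.

Lemma lebesgue_cell a : fine (mu (cell a)) = mesh ^+ n.
Proof. by rewrite [mu _]lebesgue_box. Qed.

Lemma sum_cells (K : R) : \sum_(a : idx) mesh ^+ n * K = r ^+ n * K.
Proof.
rewrite sumr_const card_ffun !card_ord -mulr_natl natrX mulrA; congr (_ * _).
by rewrite -exprMn /mesh mulrC divfK// gt_eqF.
Qed.

(** The cells are disjoint and their measures add up to that of the box, so that
    the faces between them are negligible. *)
Lemma grid_split (f : 'rV[R]_n -> R) : mu.-integrable (box c r) (EFin \o f) ->
  \int[mu]_(x in box c r) f x = \sum_a \int[mu]_(x in cell a) f x.
Proof.
move=> lf; have mB := measurable_box c r.
have mC a : measurable (cell a) := measurable_box _ _.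
have fB := lebesgue_box_fin c r0.
pose w x : R := 1 - \sum_a \1_(cell a) x.
have sum1 x a : cell a x -> \sum_b \1_(cell b) x = 1 :> R.
  move=> ax; rewrite (bigD1 a)//= indicE mem_set// big1 ?addr0// => b ba.
  rewrite indicE memNset// => bx; move/eqP: ba; apply; exact: cell_inj bx ax.
have w0 x : 0 <= w x <= 1.
  have [[a ax]|h] := pselect (exists a, cell a x).
    by rewrite /w (sum1 _ _ ax) subrr lexx/=.
  rewrite /w big1 ?subr0 ?lexx ?ler01// => a _.
  by rewrite indicE memNset// => ax; apply: h; exists a.
have lw : mu.-integrable (box c r) (EFin \o w).
  apply: LiB => //; first exact: Li_cst.
  by apply: Li_sum => // a _; exact: Li_indic.
have iw : \int[mu]_(x in box c r) `|w x| = 0.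
  transitivity (\int[mu]_(x in box c r) (1 - \sum_a \1_(cell a) x)).
    by apply: eq_Rintegral => x _; rewrite ger0_norm//; have /andP[] := w0 x.
  rewrite RintegralB//; last 2 first.
  - exact: Li_cst.
  - by apply: Li_sum => // a _; exact: Li_indic.
  rewrite [X in X - _](Rintegral_box_cst c 1 r0) mul1r.
  rewrite Rintegral_sum//; last first.
    by move=> a _; exact: Li_indic.
  rewrite (eq_bigr (fun=> mesh ^+ n * 1)) ?sum_cells ?mulr1 ?subrr// => a _.
  rewrite Rintegral_indic// (setIidl (@cell_sub a)).
  exact: lebesgue_cell.
have w_ae := Rintegral_eq0_ae mB lw iw.
have lfw : mu.-integrable (box c r) (EFin \o (fun x => f x * w x)).
  apply: (Li_mul_bounded (B := 1) mB lf); first exact: Li_measurable lw.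
  by move=> x _; rewrite ger0_norm; have /andP[] := w0 x.
have fw0 : \int[mu]_(x in box c r) (f x * w x) = 0.
  have -> : \int[mu]_(x in box c r) (f x * w x) = \int[mu]_(x in box c r) (0 : R).
    rewrite /Rintegral; congr fine; apply: ae_eq_integral => //.
    - by have /integrableP[] := lfw.
    - by apply: filterS w_ae => x /= h Bx; rewrite h// mulr0.
  by rewrite Rintegral_cst// mul0r.
have lfC a := (Rintegral_mul_indic mB (mC a) (@cell_sub a) lf).1.
rewrite -(eq_bigr _ (fun a _ => (Rintegral_mul_indic mB (mC a) (@cell_sub a) lf).2)).
rewrite -Rintegral_sum//.
have lsum : mu.-integrable (box c r) (EFin \o (fun x => \sum_a f x * \1_(cell a) x)).
  by apply: Li_sum => // a _; exact: lfC.
apply/eqP; rewrite -subr_eq0 -(RintegralB mB lf lsum).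
apply/eqP; rewrite -[RHS]fw0; apply: eq_Rintegral => x _.
by rewrite /w mulrBr mulr1 mulr_sumr.
Qed.

Context {N : nat}.
Variable psi : idx -> 'rV[R]_n -> 'rV[R]_N.

Definition grid_map (x : 'rV[R]_n) : 'rV[R]_N :=
  \sum_a rescale (psi a) (corner a) mesh x.

Lemma grid_map_test (Omega : set 'rV[R]_n) :
  (forall a, test_function Omega (rescale (psi a) (corner a) mesh)) ->
  test_function Omega grid_map /\
  forall x, jac grid_map x = \sum_a jac (rescale (psi a) (corner a) mesh) x.
Proof.
move=> tpsi; rewrite /grid_map.
elim: (index_enum _) => [|a l [tl jl]].
  rewrite (_ : (fun x => _) = fun=> 0); last by apply/funext => x; rewrite big_nil.
  by split=> [|x]; [exact: test_function0|rewrite big_nil jac0].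
rewrite (_ : (fun x => _) = fun x => rescale (psi a) (corner a) mesh x +
   \sum_(a <- l) rescale (psi a) (corner a) mesh x); last first.
  by apply/funext => x; rewrite big_cons.
split; first exact: test_functionD.
move=> x; rewrite big_cons jacD ?jl//; [exact: (test_smooth (tpsi a))|exact: (test_smooth tl)].
Qed.

Lemma rescale_test_cell a : test_function cube (psi a) ->
  test_function (cell a) (rescale (psi a) (corner a) mesh).
Proof.
by move=> /(test_function_rescale (corner a) (lt0r_neq0 s0)); rewrite box_image ?lt0r_neq0.
Qed.

(** The copies have disjoint supports. *)
Lemma jac_grid_map (Omega : set 'rV[R]_n) a x :
  (forall a, test_function cube (psi a)) ->
  (forall a, test_function Omega (rescale (psi a) (corner a) mesh)) ->
  cell a x ->
  jac grid_map x = jac (psi a) (aff (- (mesh^-1 *: corner a)) mesh^-1 x).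
Proof.
move=> tpsi tO ax; rewrite (grid_map_test tO).2 (bigD1 a)//= big1 ?addr0.
  by rewrite jac_rescale ?lt0r_neq0//; exact: (test_smooth (tpsi a)).
move=> b ba; have [_ [K [cK KC h]]] := rescale_test_cell (tpsi b).
apply: jac_eq0 cK h _ => /KC bx; move/eqP: ba; apply; exact: cell_inj bx ax.
Qed.

End grid.

(** * A Lusin type property of gradients *)

Section jac_integrable.
Context {R : realType} {n N : nat}.
Notation mu := (@lebesgue_rV R n).
Variables (D : set 'rV[R]_n) (M : R).
Hypothesis DM : forall x, D x -> `|x| <= M.

Lemma jac_supp (phi : 'rV[R]_n -> 'rV[R]_N) x : test_function D phi -> ~ D x -> jac phi x = 0.
Proof. by move=> [_ [K [cK KD h]]] nD; apply: jac_eq0 cK h _ => /KD. Qed.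

Lemma jac_integrable (A : set 'rV[R]_n) (phi : 'rV[R]_n -> 'rV[R]_N) : measurable A ->
  test_function D phi -> mx_integrable A (jac phi).
Proof.
move=> mA tphi i j; apply: (Li_supp (M := M)) => //.
  exact: jac_comp_continuous (test_smooth tphi).
by move=> x xM; rewrite (jac_supp tphi) ?mxE// => /DM; rewrite leNgt xM.
Qed.

Lemma Li_jac_norm (A : set 'rV[R]_n) (phi : 'rV[R]_n -> 'rV[R]_N) : measurable A ->
  test_function D phi -> mu.-integrable A (EFin \o (fun x => `|jac phi x|)).
Proof. by move=> mA tphi; apply: Li_mx_norm => //; exact: jac_integrable. Qed.

Lemma jac_bounded (phi : 'rV[R]_n -> 'rV[R]_N) : test_function D phi ->
  exists2 B : R, 0 < B & forall x, `|jac phi x| <= B.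
Proof.
move=> tphi; have cJ x : {for x, continuous (fun x => `|jac phi x|)}.
  apply: (@continuous_comp _ _ _ (jac phi)); last exact: norm_continuous.
  exact: jac_continuous (test_smooth tphi) _.
have J0 x : M < `|x| -> `|jac phi x| = 0.
  by move=> xM; rewrite (jac_supp tphi) ?normr0// => /DM; rewrite leNgt xM.
have [B B0 hB] := supp_bounded cJ J0.
by exists B => // x; have := hB x; rewrite normr_id.
Qed.

End jac_integrable.

Section lusin.
Context {R : realType} {n N : nat}.
Notation mu := (@lebesgue_rV R n).
Notation cube := (@unit_cube R n).
Variables (D : set 'rV[R]_n) (M : R).
Hypotheses (oD : open D) (DM : forall x, D x -> `|x| <= M).

Let mD : measurable D := measurable_rV_open oD.
Let fD : (mu D < +oo)%E := lebesgue_bounded_lt_oo mD DM.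

(** The approximating field vanishes near the boundary, so that the cells of a
    fine grid that reach beyond D carry the field zero. *)
Lemma cc_dense_mx (z : 'rV[R]_n -> 'M[R]_(N, n)) (e : R) : mx_integrable D z -> 0 < e ->
  exists (a : 'rV[R]_n -> 'M[R]_(N, n)) (t : R),
   [/\ 0 < t, forall x, depth D x <= t -> a x = 0,
    (forall w : R, 0 < w -> exists2 d : R, 0 < d & forall x y, `|x - y| < d -> `|a x - a y| <= w),
    mx_integrable setT a & \int[mu]_(x in D) `|z x - a x| <= e].
Proof.
move=> lz e0; pose e' := e / (N * n).+1%:R.
have e'0 : 0 < e' by rewrite divr_gt0.
have /choice[f hf] : forall p : 'I_N * 'I_n, exists f : 'rV[R]_n -> R,
    [/\ continuous f, compactly_supported D f & \int[mu]_(x in D) `|z x p.1 p.2 - f x| <= e'].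
  by move=> [i j]; have [f [cf sf] h] := cc_dense oD DM (lz i j) e'0; exists f.
have [t t0 ht] : exists2 t : R, 0 < t & forall p x, depth D x <= t -> f p x = 0.
  apply: uniform_radius => [p|p a b ba h x xb]; last exact: h (le_trans xb ba).
  have [_ [K [cK KD f0]] _] := hf p; have [t t0 h] := compact_depth_gap oD cK KD.
  by exists t => // x; rewrite leNgt => /negP xt; apply: f0 => /h.
have fM p x : M < `|x| -> f p x = 0.
  have [_ sf _] := hf p.
  by move=> xM; apply: (compactly_supported_notin sf) => /DM; rewrite leNgt xM.
pose a (x : 'rV[R]_n) : 'M[R]_(N, n) := \matrix_(i, j) f (i, j) x.
have lfT p (A : set 'rV[R]_n) : measurable A -> mu.-integrable A (EFin \o f p).
  by move=> mA; apply: (Li_supp (M := M)) => //; [case: (hf p)|exact: fM].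
exists a, t; split => //.
- by move=> x xt; apply/matrixP => i j; rewrite !mxE ht.
- move=> w w0.
  have [d d0 hd] : exists2 d : R, 0 < d & forall p x y, `|x - y| < d -> `|f p x - f p y| <= w.
    apply: uniform_radius => [p|p b c cb h x y xy]; last exact: h (lt_le_trans xy cb).
    by have [cf _ _] := hf p; exact: supp_unif_continuous cf (@fM p) w0.
  exists d => // x y xy; apply: mx_norm_le => [|i j]; first exact: ltW.
  by rewrite !mxE hd.
- move=> i j; have := lfT (i, j) setT measurableT.
  by apply: eq_integrable => // x _; rewrite /= mxE.
have lzf i j := LiB mD (lz i j) (lfT (i, j) D mD).
apply: (@le_trans _ _ (\int[mu]_(x in D) (\sum_i \sum_j `|z x i j - f (i, j) x|))).
  apply: le_Rintegral => //.
  - apply: Li_mx_norm => //; apply: mx_integrableB => // i j.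
    have := lfT (i, j) D mD.
    by apply: eq_integrable => // x _; rewrite /= mxE.
  - by apply: Li_sum => // i _; apply: Li_sum => // j _; exact: (Li_norm mD (lzf i j)).
  move=> x _; apply: (le_trans (mx_norm_le_sum _)).
  by apply: ler_sum => i _; apply: ler_sum => j _; rewrite !mxE.
rewrite Rintegral_sum//; last first.
  by move=> i _; apply: Li_sum => // j _; exact: (Li_norm mD (lzf i j)).
apply: (@le_trans _ _ (\sum_(i < N) \sum_(j < n) e')).
  apply: ler_sum => i _; rewrite Rintegral_sum//; last by move=> j _; exact: (Li_norm mD (lzf i j)).
  by apply: ler_sum => j _; case: (hf (i, j)).
rewrite !sumr_const !card_ord -mulrnA -mulr_natr /e' mulrAC ler_pdivrMr//.
by rewrite ler_pM2l// ler_nat mulnC.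
Qed.

Lemma small_mesh (r e : R) : 0 < r -> 0 < e -> exists2 p : nat, (0 < p)%N & r / p%:R < e.
Proof.
move=> r0 e0; have er0 : 0 < e / r by rewrite divr_gt0.
have [k _ /(_ k (leqnn k))/= h] := near_infty_natSinv_lt (PosNum er0).
exists k.+1 => //; move: h => /=.
by rewrite ltr_pdivlMr// mulrC.
Qed.

(** The field is replaced first by a continuous one, then by one that is
    constant on the cells of a fine grid; [cell_potential] realises each
    constant on most of its cell. The L^1 bound survives because the constant in
    [cell_potential] does not depend on the measure of the set that is left
    out. *)
Lemma lusin_gradient (z : 'rV[R]_n -> 'M[R]_(N, n)) (tau : R) : mx_integrable D z -> 0 < tau ->
  exists (psi : 'rV[R]_n -> 'rV[R]_N) (A : set 'rV[R]_n),
   [/\ test_function D psi, measurable A /\ A `<=` D, fine (mu A) <= tau,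
     (forall x, D x -> ~ A x -> `|jac psi x - z x| <= tau) &
     \int[mu]_(x in D) `|jac psi x| <= @cell_const R n * (\int[mu]_(x in D) `|z x|) + tau].
Proof.
move=> lz tau0.
set C := @cell_const R n; have C0 : 0 < C := cell_const_gt0.
have [c [r [r0 DB]]] := bounded_in_box DM.
have mB := measurable_box c r.
have fB := lebesgue_box_fin c r0.
have rn0 : 0 < r ^+ n by rewrite exprn_gt0.
(* By Markov's inequality the first bound makes the set where |z - a| > tau / 2
   small; the second one serves the L^1 estimate. *)
pose e := Num.min (tau * tau / 4) (tau / (2 * C)).
have e0 : 0 < e by rewrite lt_min !divr_gt0 ?mulr_gt0.
have et : e <= tau * tau / 4 by rewrite ge_min lexx.
have eC : C * e <= tau / 2.
  have : e <= tau / (2 * C) by rewrite ge_min lexx orbT.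
  by rewrite ler_pdivlMr ?mulr_gt0//; move: (e) (C) => u v; lra.
have [a [t [t0 a0 ua la az]]] := cc_dense_mx lz e0.
pose w := Num.min (tau / 2) (tau / (2 * (C * r ^+ n))).
have w0 : 0 < w by rewrite lt_min !divr_gt0 ?mulr_gt0.
have wt : w <= tau / 2 by rewrite ge_min lexx.
have wC : C * (w * r ^+ n) <= tau / 2.
  have : w <= tau / (2 * (C * r ^+ n)) by rewrite ge_min lexx orbT.
  by rewrite ler_pdivlMr ?mulr_gt0//; move: (w) (C) (r ^+ n) => u v s; lra.
have [d d0 hd] := ua w w0.
have dt0 : 0 < Num.min d t by rewrite lt_min d0.
have [p p0] := small_mesh r0 dt0; rewrite lt_min => /andP[pd pt].
have s0 : 0 < mesh r p := mesh_gt0 r0 p0.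
(* At most a fraction k of each cell is lost, so at most k r^n = tau / 2 of the
   whole box. *)
pose k := tau / (2 * r ^+ n).
have k0 : 0 < k by rewrite divr_gt0 ?mulr_gt0.
pose xc (b : {ffun 'I_n -> 'I_p}) := aff (corner c r b) (mesh r p) (const_mx 2^-1).
have cxc b : cell c r b (xc b).
  rewrite /cell /box /xc/= affK ?lt0r_neq0// => j; rewrite mxE.
  by apply/andP; split; lra.
(* Where a vanishes the zero map is taken, so that cells that reach beyond D
   contribute nothing. *)
have /choice[f hf] : forall b, exists f : ('rV[R]_n -> 'rV[R]_N) * set 'rV[R]_n,
   [/\ test_function cube f.1, [/\ measurable f.2, f.2 `<=` cube & fine (mu f.2) <= k],
      forall y, cube y -> ~ f.2 y -> jac f.1 y = a (xc b),
      \int[mu]_(y in cube) `|jac f.1 y| <= C * `|a (xc b)| &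
      a (xc b) = 0 -> f.1 = fun=> 0].
  move=> b; have [ab0|ab0] := eqVneq (a (xc b)) 0.
    exists (fun=> 0, set0); split => //=.
    - exact: test_function0.
    - by split => //; rewrite measure0 ltW.
    - by move=> y _ _; rewrite ab0 jac0.
    - rewrite ab0 normr0 mulr0 (@eq_Rintegral _ _ _ _ _ (fun=> 0)).
        by rewrite Rintegral_cst ?mul0r//; exact: measurable_cube.
      by move=> y _; rewrite jac0 normr0.
  have [f [tf [A [mA Ac Ak Aj]] If]] := cell_potential (a (xc b)) k0.
  by exists (f, A); split => //= h; rewrite h eqxx in ab0.
pose psi b := (f b).1; pose A0 b := (f b).2.
have tpsi b : test_function cube (psi b) by case: (hf b).
have tO b : test_function D (rescale (psi b) (corner c r b) (mesh r p)).
  have [ab0|ab0] := eqVneq (a (xc b)) 0.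
    have [_ _ _ _ /(_ ab0)] := hf b; rewrite -/(psi b) => ->.
    rewrite (_ : rescale _ _ _ = fun=> 0); first exact: test_function0.
    by apply/funext => x; rewrite /rescale scaler0.
  have tb : test_function (cell c r b) (rescale (psi b) (corner c r b) (mesh r p)).
    exact: (rescale_test_cell c (psi := psi) (a := b) r0 p0 (tpsi b)).
  apply: (test_function_sub _ tb) => x bx.
  apply: contrapT => nD; move/eqP: ab0; apply; apply: a0.
  apply: (le_trans (depth_le (xc b) nD)); apply/ltW.
  by apply: le_lt_trans pt; exact: (box_diam s0 (cxc b) bx).
pose Psi := grid_map c r psi.
have tPsi : test_function D Psi := (grid_map_test tO).1.
have jPsi b x : cell c r b x -> jac Psi x = jac (psi b) (aff (- ((mesh r p)^-1 *: corner c r b)) (mesh r p)^-1 x).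
  by move=> bx; exact: (jac_grid_map r0 p0 tpsi tO bx).
pose A' b := aff (- ((mesh r p)^-1 *: corner c r b)) (mesh r p)^-1 @^-1` A0 b.
have mA' b : measurable (A' b).
  by apply: measurable_preimage_aff; case: (hf b) => _ [].
have mcell (b : {ffun 'I_n -> 'I_p}) : measurable (cell c r b) := measurable_box _ _.
pose G := \bigcup_(b in [set: {ffun 'I_n -> 'I_p}]) (cell c r b `\` A' b).
have mG : measurable G.
  by apply: fin_bigcup_measurable => // b _; apply: measurableD.
pose A1 := D `\` G.
have mA1 : measurable A1 by exact: measurableD.
have mza : measurable_fun D (fun x => `|z x - a x|).
  apply: measurable_mx_norm => // i j.
  have lij := mx_integrableB mD lz (mx_integrableS mD measurableT (@subsetT _ D) la).
  exact: (Li_measurable (lij i j)).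
pose A2 := D `&` [set x | tau / 2 < `|z x - a x|].
have mA2 : measurable A2 by exact: measurable_superlevel.
have lza : mx_integrable D (fun x => z x - a x).
  exact: (mx_integrableB mD lz (mx_integrableS mD measurableT (@subsetT _ D) la)).
have lnza := Li_mx_norm mD lza.
have A1t : fine (mu A1) <= tau / 2.
  have A1B : A1 `<=` box c r by move=> x [/DB].
  have E : \int[mu]_(x in box c r) \1_A1 x = fine (mu A1).
    by rewrite Rintegral_indic// (setIidl A1B).
  have li := Li_indic mB fB mA1.
  rewrite -E (grid_split r0 p0 li).
  rewrite (_ : tau / 2 = r ^+ n * k); last by rewrite /k; field; rewrite gt_eqF.
  rewrite -(sum_cells r p0); apply: ler_sum => b _.
  have [_ [mA Ac Ak] _ _ _] := hf b.
  have lA0 := Li_indic (@measurable_cube R n) (@lebesgue_cube_fin R n) mA.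
  apply: (@le_trans _ _ (\int[mu]_(x in cell c r b)
      \1_(A0 b) (aff (- ((mesh r p)^-1 *: corner c r b)) (mesh r p)^-1 x))).
    apply: le_Rintegral => //.
    - have sub : cell c r b `<=` box c r by exact: cell_sub.
      exact: (LiS mB (mcell b) sub li).
    - exact: (Li_box_inv (corner c r b) s0 lA0).
    move=> x bx; rewrite !indicE; have [|//] := boolP (x \in A1).
    rewrite inE => -[_ nG]; rewrite mem_set//.
    by apply: contrapT => nA; apply: nG; exists b.
  rewrite (Rintegral_box_inv (corner c r b) s0 lA0) ler_wpM2l//.
    by rewrite exprn_ge0// ltW.
  by rewrite Rintegral_indic ?(setIidl Ac)//; exact: measurable_cube.
have A2t : fine (mu A2) <= tau / 2.
  have t20 : 0 < tau / 2 by rewrite divr_gt0.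
  have := markov_superlevel mD fD (ltW t20) lnza (fun x _ => normr_ge0 _).
  move=> /le_trans/(_ az) h; have := le_trans h et.
  rewrite (_ : tau * tau / 4 = tau / 2 * (tau / 2)); last by field.
  by rewrite ler_pM2l.
exists Psi, (A1 `|` A2); split => //.
- split; first exact: measurableU.
  by move=> x [[]|[]].
- have fA1 : (mu A1 < +oo)%E by apply: (fin_measure_subset mD mA1 _ fD) => x [].
  have fA2 : (mu A2 < +oo)%E by apply: (fin_measure_subset mD mA2 _ fD) => x [].
  have h : (mu (A1 `|` A2) <= mu A1 + mu A2)%E by exact: measureU2.
  apply: (@le_trans _ _ (fine (mu A1 + mu A2)%E)).
    apply: fine_le => //; last by rewrite fin_numD !ge0_fin_numE// fA1 fA2.
    by rewrite ge0_fin_numE//; apply: (le_lt_trans h); exact: lte_add_pinfty.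
  by rewrite fineD ?ge0_fin_numE//; lra.
- move=> x Dx nA; have Gx : G x by apply: contrapT => nG; apply: nA; left.
  have zx : `|z x - a x| <= tau / 2.
    by rewrite leNgt; apply/negP => h; apply: nA; right.
  have [b _ [bx nAb]] := Gx.
  have -> : jac Psi x = a (xc b).
    rewrite (jPsi b)//; have [_ _ hj _ _] := hf b; exact: hj.
  have ab : `|a (xc b) - a x| <= w.
    by apply: hd; apply: le_lt_trans pd; exact: (box_diam s0 (cxc b) bx).
  have -> : a (xc b) - z x = (a (xc b) - a x) - (z x - a x).
    by rewrite opprB addrA subrK.
  by apply: (le_trans (ler_normB _ _)); lra.
have lJB := Li_jac_norm DM mB tPsi.
have -> : \int[mu]_(x in D) `|jac Psi x| = \int[mu]_(x in box c r) `|jac Psi x|.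
  rewrite (@Rintegral_supp _ _ D (fun x => `|jac Psi x|)); last first.
    by move=> x nD; rewrite (jac_supp tPsi nD) normr0.
  rewrite (@Rintegral_supp _ _ (box c r) (fun x => `|jac Psi x|))// => x nB.
  by rewrite (jac_supp tPsi) ?normr0// => /DB.
have lnaB : mu.-integrable (box c r) (EFin \o (fun x => `|a x|)).
  exact: (Li_mx_norm mB (mx_integrableS mB measurableT (@subsetT _ _) la)).
have lawB : mu.-integrable (box c r) (EFin \o (fun x => `|a x| + w)).
  by apply: LiD => //; exact: Li_cst.
have lnaD : mu.-integrable D (EFin \o (fun x => `|a x|)).
  exact: (Li_mx_norm mD (mx_integrableS mD measurableT (@subsetT _ _) la)).
have lnz := Li_mx_norm mD lz.
have aD : \int[mu]_(x in box c r) `|a x| <= \int[mu]_(x in D) `|z x| + e.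
  have -> : \int[mu]_(x in box c r) `|a x| = \int[mu]_(x in D) `|a x|.
    have aD0 x : ~ D x -> `|a x| = 0.
      move=> nD; rewrite a0 ?normr0//; apply: le_trans (depth_le x nD) _.
      by rewrite subrr normr0 ltW.
    rewrite (@Rintegral_supp _ _ D (fun x => `|a x|))//.
    by rewrite (@Rintegral_supp _ _ (box c r) (fun x => `|a x|))// => x nB; apply: aD0 => /DB.
  apply: (@le_trans _ _ (\int[mu]_(x in D) (`|z x| + `|z x - a x|))).
    apply: le_Rintegral => //; first exact: LiD.
    by move=> x _; rewrite -[X in `|X| <= _](subKr (z x)); exact: ler_normB.
  by rewrite RintegralD// lerD2l.
rewrite (grid_split r0 p0 lJB).
apply: (@le_trans _ _ (\sum_b C * \int[mu]_(x in cell c r b) (`|a x| + w))).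
  apply: ler_sum => b _.
  have ljb : mu.-integrable cube (EFin \o (fun y => `|jac (psi b) y|)).
    exact: (Li_jac_norm (@cube_norm R n) (@measurable_cube R n) (tpsi b)).
  have -> : \int[mu]_(x in cell c r b) `|jac Psi x| =
      mesh r p ^+ n * \int[mu]_(y in cube) `|jac (psi b) y|.
    rewrite -(Rintegral_box_inv (corner c r b) s0 ljb).
    by apply: eq_Rintegral => x; rewrite inE => bx; rewrite (jPsi b).
  have [_ _ _ hI _] := hf b.
  apply: (@le_trans _ _ (mesh r p ^+ n * (C * `|a (xc b)|))).
    by rewrite ler_wpM2l// exprn_ge0// ltW.
  rewrite mulrCA ler_pM2l//.
  have -> : mesh r p ^+ n * `|a (xc b)| = \int[mu]_(x in cell c r b) `|a (xc b)|.
    transitivity (`|a (xc b)| * fine (mu (cell c r b))).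
      by rewrite lebesgue_cell// mulrC.
    by rewrite Rintegral_cst.
  have sub : cell c r b `<=` box c r by exact: cell_sub.
  apply: le_Rintegral => //.
  - by apply: Li_cst => //; exact: (fin_measure_subset mB (mcell b) sub fB).
  - exact: (LiS mB (mcell b) sub lawB).
  move=> x bx; have := hd (xc b) x (le_lt_trans (box_diam s0 (cxc b) bx) pd).
  have := ler_normD (a (xc b) - a x) (a x); rewrite subrK; lra.
rewrite -mulr_sumr -(grid_split r0 p0 lawB).
have -> : \int[mu]_(x in box c r) (`|a x| + w) = \int[mu]_(x in box c r) `|a x| + w * r ^+ n.
  rewrite RintegralD//; last exact: Li_cst.
  by rewrite [X in _ + X](Rintegral_box_cst c w r0).
apply: (@le_trans _ _ (C * (\int[mu]_(x in D) `|z x| + e + w * r ^+ n))).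
  by rewrite ler_pM2l// lerD2r.
by rewrite !mulrDr; lra.
Qed.

End lusin.

(** * Integrands of linear growth *)

Section norms.
Context {R : realType}.

Lemma enorm_ge0 p q (z : 'M[R]_(p, q)) : 0 <= enorm z.
Proof. exact: sqrtr_ge0. Qed.

Lemma mx_norm_le_enorm p q (z : 'M[R]_(p, q)) : `|z| <= enorm z.
Proof.
apply: mx_norm_le => [|i j]; first exact: enorm_ge0.
rewrite -sqrtr_sqr; apply: ler_wsqrtr.
rewrite (bigD1 i)//= (bigD1 j)//= -addrA lerDl addr_ge0//.
  by apply: sumr_ge0 => k _; exact: sqr_ge0.
by apply: sumr_ge0 => k _; apply: sumr_ge0 => l _; exact: sqr_ge0.
Qed.

Lemma enorm_le_mx_norm p q (z : 'M[R]_(p, q)) : enorm z <= (p * q)%:R * `|z|.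
Proof.
have k0 : 0 <= (p * q)%:R * `|z| by rewrite mulr_ge0.
rewrite -(ger0_norm k0) -sqrtr_sqr; apply: ler_wsqrtr.
apply: (@le_trans _ _ (\sum_(i < p) \sum_(j < q) `|z| ^+ 2)).
  apply: ler_sum => i _; apply: ler_sum => j _.
  by rewrite -real_normK ?num_real// ler_pXn2r ?nnegrE// mx_norm_ge.
have -> : \sum_(i < p) \sum_(j < q) `|z| ^+ 2 = (p * q)%:R * `|z| ^+ 2.
  by rewrite !sumr_const !card_ord -mulrnA mulnC mulr_natl.
rewrite exprMn ler_wpM2r ?sqr_ge0//.
by rewrite -natrX ler_nat; case: (p * q)%N => // k; rewrite leq_pmulr.
Qed.

Lemma Eint_le p q (z : 'M[R]_(p, q)) : Eint z <= enorm z.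
Proof.
rewrite /Eint lerBlDr; have e0 := enorm_ge0 z.
have k0 : 0 <= enorm z + 1 by rewrite addr_ge0.
rewrite -(ger0_norm k0) -sqrtr_sqr; apply: ler_wsqrtr.
by move: (enorm z) e0 => e e0; nra.
Qed.

Lemma Eint_ge p q (z : 'M[R]_(p, q)) : enorm z - 1 <= Eint z.
Proof.
rewrite /Eint lerD2r; have e0 := enorm_ge0 z.
by rewrite -{1}(ger0_norm e0) -sqrtr_sqr; apply: ler_wsqrtr; rewrite lerDr.
Qed.

Lemma Eint_ge0 p q (z : 'M[R]_(p, q)) : 0 <= Eint z.
Proof.
rewrite /Eint subr_ge0 -[leLHS]sqrtr1; apply: ler_wsqrtr.
by rewrite lerDl sqr_ge0.
Qed.

Lemma continuous_sum (T : topologicalType) (I : Type) (r : seq I) (f : I -> T -> R) :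
  (forall i, continuous (f i)) -> continuous (fun x => \sum_(i <- r) f i x).
Proof.
move=> cf; elim: r => [|i r IH] x.
  rewrite (_ : (fun x => _) = fun=> 0); first exact: cvg_cst.
  by apply/funext => y; rewrite big_nil.
rewrite (_ : (fun x => _) = fun x => f i x + \sum_(i <- r) f i x); last first.
  by apply/funext => y; rewrite big_cons.
exact: (cvgD (cf i x) (IH x)).
Qed.

Lemma enorm_continuous p q : continuous (@enorm R p q).
Proof.
have cS : continuous (fun z : 'M[R]_(p, q) => \sum_i \sum_j z i j ^+ 2).
  apply: continuous_sum => i; apply: continuous_sum => j z.
  exact: (cvgM (@coord_continuous _ _ _ i j z) (@coord_continuous _ _ _ i j z)).
by move=> z; apply: (continuous_comp (cS z)); exact: sqrt_continuous.
Qed.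

Lemma Eint_continuous p q : continuous (@Eint R p q).
Proof.
have c1 : continuous (fun z : 'M[R]_(p, q) => 1 + enorm z ^+ 2).
  move=> z; have cz := @enorm_continuous p q z.
  exact: (cvgD (cvg_cst _) (cvgM cz cz)).
rewrite (_ : @Eint R p q = fun z => Num.sqrt (1 + enorm z ^+ 2) - 1)//.
move=> z; have := continuous_comp (c1 z) (@sqrt_continuous R _).
move=> h; have h2 : {for z, continuous (fun _ : 'M[R]_(p, q) => 1 : R)} by exact: cst_continuous.
exact: (continuousB h h2).
Qed.

(** Rearranging the entries in a row preserves the norm. *)
Lemma compact_mx_ball p q (M : R) : compact [set z : 'M[R]_(p, q) | `|z| <= M].
Proof.
rewrite (_ : [set z | _] = vec_mx @` [set v : 'rV[R]_(p * q) | `|v| <= M]).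
  apply: continuous_compact; last exact: compact_closed_ball.
  apply: continuous_subspaceT => v.
  apply/(@cvgrPdist_le _ _ _ _ (@nbhs_filter _ (v : 'rV[R]_(p * q)))) => e e0.
  apply/nbhs_ballP; exists e => //= w; rewrite -ball_normE/= => h.
  apply: (le_trans _ (ltW h));
  have -> : vec_mx v - vec_mx w = vec_mx (v - w) :> 'M[R]_(p, q) by rewrite linearB.
  apply: mx_norm_le => // i j; rewrite mxE.
  exact: mx_norm_ge.
apply/seteqP; split => [z zM|_ [v vM <-]] /=.
  exists (mxvec z); last exact: mxvecK.
  apply: mx_norm_le => [|i j]; first exact: le_trans zM.
  rewrite (ord1 i); case/mxvec_indexP: j => k l; rewrite mxvecE.
  by apply: le_trans zM; exact: mx_norm_ge.
apply: mx_norm_le => [|i j]; first exact: le_trans vM.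
by rewrite mxE; apply: le_trans vM; exact: mx_norm_ge.
Qed.

End norms.

Section growth.
Context {R : realType} {n N : nat}.
Notation mu := (@lebesgue_rV R n).

Definition linear_growth (H : 'M[R]_(N, n) -> R) (L : R) :=
  [/\ continuous H, 0 < L & forall z, `|H z| <= L * (1 + `|z|)].

Variables (D : set 'rV[R]_n).
Hypotheses (mD : measurable D) (fD : (mu D < +oo)%E).
Variables (H : 'M[R]_(N, n) -> R) (L : R).
Hypothesis HL : linear_growth H L.

Lemma Li_growth (G : 'rV[R]_n -> 'M[R]_(N, n)) : mx_integrable D G ->
  mu.-integrable D (EFin \o (fun x => H (G x))).
Proof.
move=> lG; have [cH L0 hH] := HL.
have lg : mu.-integrable D (EFin \o (fun x => L * (1 + `|G x|))).
  by apply: LiZ => //; apply: LiD => //; [exact: Li_cst|exact: Li_mx_norm].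
apply: (Li_le mD _ _ lg) => [|x _]; last exact: hH.
by apply: (measurable_comp_mx mD cH) => i j; exact: (Li_measurable (lG i j)).
Qed.

Lemma Rintegral_growth (G : 'rV[R]_n -> 'M[R]_(N, n)) : mx_integrable D G ->
  `|\int[mu]_(x in D) H (G x)| <= L * (fine (mu D) + \int[mu]_(x in D) `|G x|).
Proof.
move=> lG; have [cH L0 hH] := HL; have lnG := Li_mx_norm mD lG.
have l1 : mu.-integrable D (EFin \o (fun x => 1 + `|G x|)).
  by apply: LiD => //; exact: Li_cst.
apply: (le_trans (le_normr_Rintegral mD (Li_growth lG))).
have -> : fine (mu D) + \int[mu]_(x in D) `|G x| = \int[mu]_(x in D) (1 + `|G x|).
  rewrite RintegralD//; last exact: Li_cst.
  by rewrite Rintegral_cst// mul1r.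
rewrite -RintegralZl//; apply: le_Rintegral => //.
- by apply: Li_norm => //; exact: Li_growth.
- exact: LiZ.
Qed.

(** Where |G| <= K the uniform continuity of H applies; the set where |G| > K is
    small, and there, as on A, the linear growth of H bounds the integrand. *)
Lemma superposition_close (G : 'rV[R]_n -> 'M[R]_(N, n)) (eta : R) :
  mx_integrable D G -> 0 < eta -> exists2 tau : R, 0 < tau &
  forall (G' : 'rV[R]_n -> 'M[R]_(N, n)) (A : set 'rV[R]_n), mx_integrable D G' ->
    measurable A -> A `<=` D -> fine (mu A) <= tau ->
    (forall x, D x -> ~ A x -> `|G' x - G x| <= tau) ->
    \int[mu]_(x in D) `|H (G' x) - H (G x)| <=
      eta + L * \int[mu]_(x in A) `|G' x - G x|.
Proof.
move=> lG eta0; have [cH L0 hH] := HL; have lnG := Li_mx_norm mD lG.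
(* The final estimate contains 3 + 2 multiples of L e1 from S, 2 + 2 from A, and
   w times the measure of D, at most eta / 4. *)
pose e1 := eta / (32 * (L + 1)).
have L10 : 0 < L + 1 by lra.
have e10 : 0 < e1 by rewrite divr_gt0// mulr_gt0.
have e1L : L * e1 <= eta / 32.
  rewrite /e1 mulrA ler_pdivrMr ?mulr_gt0//.
  by rewrite (_ : eta / 32 * (32 * (L + 1)) = (L + 1) * eta); [nra|field].
have [t0 t00 ht0] := Rintegral_abs_cont mD fD lnG e10.
pose t := Num.min t0 e1.
have t_gt0 : 0 < t by rewrite lt_min t00.
have tt0 : t <= t0 by rewrite ge_min lexx.
have te1 : t <= e1 by rewrite ge_min lexx orbT.
have habs A : measurable A -> A `<=` D -> fine (mu A) <= t -> \int[mu]_(x in A) `|G x| <= e1.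
  move=> mA AD At; have := ht0 A mA AD (le_trans At tt0).
  have -> : \int[mu]_(x in A) `| `|G x| | = \int[mu]_(x in A) `|G x|.
    by apply: eq_Rintegral => x _; rewrite normr_id.
  exact.
pose I := \int[mu]_(x in D) `|G x|.
have I0 : 0 <= I by exact: Rintegral_ge0.
(* The level K is such that, by Markov's inequality, |G| exceeds it on a set of
   measure at most t only. *)
pose K := (I + 1) / t.
have K0 : 0 < K by rewrite divr_gt0// ltr_pwDr.
pose S := D `&` [set x | K < `|G x|].
have mS : measurable S by apply: measurable_superlevel => //; exact: Li_measurable lnG.
have SD : S `<=` D by move=> x [].
have St : fine (mu S) <= t.
  have := markov_superlevel mD fD (ltW K0) lnG (fun x _ => normr_ge0 _).
  rewrite -/S -/I => h; rewrite -(ler_pM2l K0); apply: (le_trans h).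
  by rewrite /K divfK ?gt_eqF//; lra.
have hS := habs S mS SD St.
pose m := fine (mu D); have m0 : 0 <= m by exact: fine_ge0.
have m10 : 0 < m + 1 by lra.
pose w := eta / (4 * (m + 1)).
have w0 : 0 < w by rewrite divr_gt0// mulr_gt0.
have wm : w * m <= eta / 4.
  rewrite /w mulrAC ler_pdivrMr ?mulr_gt0//.
  by rewrite (_ : eta / 4 * (4 * (m + 1)) = eta * (m + 1)); [nra|field].
have [d d0 hd] := compact_unif_continuous (@compact_mx_ball R N n K)
  (fun z _ => cH z) w0.
pose tau := Num.min (Num.min (d / 2) 1) t.
have d20 : 0 < d / 2 by rewrite divr_gt0.
have tau0 : 0 < tau by rewrite lt_min t_gt0 lt_min d20 ltr01.
have taut : tau <= t by rewrite ge_min lexx orbT.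
have tau1 : tau <= 1 by rewrite !ge_min lexx orbT.
have taud : tau < d.
  have : tau <= d / 2 by rewrite !ge_min lexx.
  by lra.
exists tau => // G' A lG' mA AD Atau hG'.
have At := le_trans Atau taut.
have hA := habs A mA AD At.
have lGG := Li_mx_norm mD (mx_integrableB mD lG' lG).
have lHH := Li_norm mD (LiB mD (Li_growth lG') (Li_growth lG)).
pose fS x := L * (3 + 2 * `|G x|).
pose fA x := L * (2 + 2 * `|G x| + `|G' x - G x|).
have l2 := LiZ 2 mD lnG.
have lfS : mu.-integrable D (EFin \o fS).
  by apply: LiZ => //; apply: LiD => //; exact: Li_cst.
have lfA : mu.-integrable D (EFin \o fA).
  by apply: LiZ => //; apply: LiD => //; apply: LiD => //; exact: Li_cst.
have [lS1 iS1] := Rintegral_mul_indic mD mS SD lfS.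
have [lA1 iA1] := Rintegral_mul_indic mD mA AD lfA.
have lw := Li_cst w mD fD.
have fS0 x : 0 <= fS x by rewrite mulr_ge0 ?(ltW L0)// addr_ge0// mulr_ge0.
have fA0 x : 0 <= fA x by rewrite mulr_ge0 ?(ltW L0)// !addr_ge0// mulr_ge0.
have pw x : D x -> `|H (G' x) - H (G x)| <= w + fS x * \1_S x + fA x * \1_A x.
  move=> Dx.
  have hsum : `|H (G' x) - H (G x)| <= L * (2 + `|G' x| + `|G x|).
    apply: (le_trans (ler_normB _ _)); have := hH (G' x); have := hH (G x).
    by rewrite !mulrDr; lra.
  have hG2 : `|G' x| <= `|G x| + `|G' x - G x|.
    by have := ler_normD (G x) (G' x - G x); rewrite addrC subrK.
  have fSS : 0 <= fS x * \1_S x by rewrite indicE mulr_ge0.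
  have fAA : 0 <= fA x * \1_A x by rewrite indicE mulr_ge0.
  have [Ax|nA] := pselect (A x).
    have : `|H (G' x) - H (G x)| <= fA x.
      apply: (le_trans hsum); rewrite /fA ler_pM2l//; lra.
    rewrite [X in _ -> _ <= _ + fA x * X]indicE mem_set// mulr1; lra.
  have hx := hG' x Dx nA.
  have [GK|GK] := leP `|G x| K.
    have : `|H (G' x) - H (G x)| <= w.
      by rewrite distrC; apply: hd => //; rewrite distrC (le_lt_trans hx).
    by lra.
  have Sx : S x by [].
  have : `|H (G' x) - H (G x)| <= fS x.
    apply: (le_trans hsum); rewrite /fS ler_pM2l//; lra.
  rewrite [X in _ -> _ <= _ + fS x * X + _]indicE mem_set// mulr1; lra.
apply: (@le_trans _ _ (\int[mu]_(x in D) (w + fS x * \1_S x + fA x * \1_A x))).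
  apply: le_Rintegral => //.
  by apply: LiD => //; exact: LiD.
rewrite RintegralD//; last exact: LiD.
rewrite RintegralD// iS1 iA1 Rintegral_cst// -/m.
have fSm : (mu S < +oo)%E by exact: (fin_measure_subset mD mS SD fD).
have fAm : (mu A < +oo)%E by exact: (fin_measure_subset mD mA AD fD).
have IS : \int[mu]_(x in S) fS x = L * (3 * fine (mu S) + 2 * \int[mu]_(x in S) `|G x|).
  have lGS := LiS mD mS SD lnG.
  rewrite /fS RintegralZl//; last by apply: LiD => //; [exact: Li_cst|exact: LiZ].
  rewrite RintegralD//; [|exact: Li_cst|exact: LiZ].
  by rewrite Rintegral_cst// RintegralZl.
have IA : \int[mu]_(x in A) fA x = L * (2 * fine (mu A) + 2 * \int[mu]_(x in A) `|G x|
    + \int[mu]_(x in A) `|G' x - G x|).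
  have lGA := LiS mD mA AD lnG; have lGGA := LiS mD mA AD lGG.
  have l3 : mu.-integrable A (EFin \o (fun x => 2 + 2 * `|G x|)).
    by apply: LiD => //; [exact: Li_cst|exact: LiZ].
  rewrite /fA RintegralZl//; last exact: LiD.
  rewrite RintegralD// RintegralD//; [|exact: Li_cst|exact: LiZ].
  by rewrite Rintegral_cst// RintegralZl.
rewrite IS IA !mulrDr.
have hc (k u : R) : 0 <= k -> u <= e1 -> L * (k * u) <= k * (eta / 32).
  move=> k0 ue; rewrite mulrCA ler_wpM2l//; apply: le_trans e1L.
  by rewrite ler_pM2l.
have h1 := hc 3 _ (ler0n _ 3) (le_trans St te1).
have h2 := hc 2 _ (ler0n _ 2) hS.
have h3 := hc 2 _ (ler0n _ 2) (le_trans At te1).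
have h4 := hc 2 _ (ler0n _ 2) hA.
move: wm h1 h2 h3 h4 eta0; clear.
lra.
Qed.

End growth.

(** * Energies, Poincare's inequality, quasiconvexity on domains *)

Section energy.
Context {R : realType} {n N : nat}.
Notation mu := (@lebesgue_rV R n).
Variables (D : set 'rV[R]_n) (M : R).
Hypotheses (oD : open D) (DM : forall x, D x -> `|x| <= M).
Implicit Types (u v phi : 'rV[R]_n -> 'rV[R]_N) (G : 'rV[R]_n -> 'M[R]_(N, n)).

Let mD : measurable D := measurable_rV_open oD.
Let fD : (mu D < +oo)%E := lebesgue_bounded_lt_oo mD DM.

Lemma enorm_growth p q : linear_growth (@enorm R p q) ((p * q)%:R + 1).
Proof.
split; [exact: enorm_continuous|by rewrite ltr_pwDr|move=> z].
rewrite ger0_norm ?enorm_ge0//; apply: (le_trans (enorm_le_mx_norm z)).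
have k0 : 0 <= (p * q)%:R :> R by rewrite ler0n.
have z0 := normr_ge0 z; nra.
Qed.

Lemma Li_enorm p q (f : 'rV[R]_n -> 'M[R]_(p, q)) (A : set 'rV[R]_n) : measurable A ->
  mx_integrable A f -> mu.-integrable A (EFin \o (fun x => enorm (f x))).
Proof.
move=> mA lf.
have lS := LiZ (p * q)%:R mA (Li_mx_norm mA lf).
apply: (Li_le mA _ _ lS) => [|x _]; last first.
  by rewrite ger0_norm ?enorm_ge0// enorm_le_mx_norm.
apply: (measurable_comp_mx mA (@enorm_continuous R p q)).
by move=> i j; exact: (Li_measurable (lf i j)).
Qed.

(** Weak gradients are unique up to null sets, which integrals do not see. *)
Lemma integral_wgrad u G (H : 'M[R]_(N, n) -> R) (L : R) : linear_growth H L ->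
  weak_gradient D u G ->
  (\int[mu]_(x in D) (H (wgrad D u x))%:E = (\int[mu]_(x in D) H (G x))%:E)%E.
Proof.
move=> HL hG; have hw : weak_gradient D u (wgrad D u) by apply: wgradP; exists G.
have [_ lw _] := hw; have [_ lG _] := hG.
have lHw := Li_growth mD fD HL lw; have lHG := Li_growth mD fD HL lG.
rewrite /Rintegral fineK; last exact: (integrable_fin_num mD lHG).
apply: ae_eq_integral => //.
- by have /integrableP[] := lHw.
- by have /integrableP[] := lHG.
by apply: filterS (weak_gradient_unique oD DM hw hG) => x h Dx; rewrite h.
Qed.

Lemma energyE u G (F : 'M[R]_(N, n) -> R) (L : R) : linear_growth F L ->
  weak_gradient D u G -> energy F D u = (\int[mu]_(x in D) F (G x))%:E.
Proof. exact: integral_wgrad. Qed.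

Lemma W11normE u G : weak_gradient D u G ->
  W11norm D u = (\int[mu]_(x in D) enorm (u x) + \int[mu]_(x in D) enorm (G x))%:E.
Proof.
move=> hG; have [lu lG _] := hG.
rewrite /W11norm (integral_wgrad (enorm_growth N n) hG) EFinD; congr (_ + _)%E.
rewrite /Rintegral fineK//; apply: (integrable_fin_num mD); exact: Li_enorm.
Qed.

(** The derivative of x_j |f| is integrated by parts, with |f| replaced by the
    smooth function sqrt(f^2 + e^2) - e. *)
Lemma poincare (f : 'rV[R]_n -> R) (j : 'I_n) : 0 <= M -> test_function D f ->
  \int[mu]_(x in D) `|f x| <= M * \int[mu]_(x in D) `|partial j f x|.
Proof.
move=> M0 tf; have sf := test_smooth tf.
have mT := @measurableT _ 'rV[R]_n.
have fM x : M < `|x| -> f x = 0 by move=> xM; exact: (test_supp DM tf xM).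
have pM x : M < `|x| -> partial j f x = 0 by move=> xM; exact: partial_supp xM.
have cf := smooth_continuous sf.
have cp : continuous (partial j f) by apply: smooth_continuous; exact: smooth_partial.
have lf : mu.-integrable D (EFin \o f) by exact: (Li_supp mD cf fM).
have lp : mu.-integrable D (EFin \o partial j f) by exact: (Li_supp mD cp pM).
apply/ler_addgt0Pl => eta eta0.
pose m := fine (mu D); have m0 : 0 <= m by exact: fine_ge0.
have m1 : 0 < m + 1 by lra.
pose e := eta / (m + 1); have e0 : 0 < e by exact: divr_gt0.
have em : e * m <= eta by rewrite /e mulrAC ler_pdivrMr//; nra.
pose q x := f x * f x + e ^+ 2.
have e20 : 0 < e ^+ 2 by rewrite exprn_gt0.
have q0 x : 0 < q x by rewrite ltr_wpDl// -expr2 sqr_ge0.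
have sq : smooth q by apply: smoothD; [exact: smoothM|exact: smooth_cst].
have dq x : differentiable q x by exact: smooth_differentiable.
have df x : differentiable f x by exact: smooth_differentiable.
pose s x := Num.sqrt (q x) - e.
have dsq x : derivable (@Num.sqrt R) (q x) 1 by have [] := is_derive1_sqrt (q0 x).
have ds x : differentiable s x.
  apply: differentiableB; last exact: differentiable_cst.
  apply: differentiable_comp => //; exact/derivable1_diffP.
have sq0 x : 0 < Num.sqrt (q x) by rewrite sqrtr_gt0.
have ps x : partial j s x = f x / Num.sqrt (q x) * partial j f x.
  have -> : partial j s x = partial j (Num.sqrt \o q) x.
    have d1 : differentiable (Num.sqrt \o q) x.
      by apply: differentiable_comp => //; exact/derivable1_diffP.
    rewrite /partial /s (deriveB (diff_derivable d1) (derivable_cst _ _ _)).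
    by rewrite derive_cst subr0.
  rewrite partial_comp1// derive1E (derive_sqrt (q0 x)).
  rewrite /q partialD; last 2 first.
  - by move=> y; exact: (differentiableM (df y) (df y)).
  - by move=> y; exact: differentiable_cst.
  rewrite partial_cst addr0 partialM//.
  by rewrite -/(q x); field; rewrite gt_eqF.
have cs : continuous (partial j s).
  rewrite (_ : partial j s = fun x => f x / Num.sqrt (q x) * partial j f x); last exact/funext.
  move=> x; have c1 := continuous_comp (smooth_continuous sq (x := x)) (@sqrt_continuous R _).
  exact: (cvgM (cvgM (cf x) (cvgV (lt0r_neq0 (sq0 x)) c1)) (cp x)).
have s0 x : M < `|x| -> s x = 0.
  by move=> xM; rewrite /s /q fM// mul0r add0r sqrtr_sqr gtr0_norm// subrr.
have h1 := @Rintegral_by_parts _ _ (fun x => x ord0 j) s j M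
  (fun x => smooth_differentiable x (smooth_coord j)) _ ds cs s0.
have c1 : continuous (partial j (fun x : 'rV[R]_n => x ord0 j)).
  by apply: smooth_continuous; apply: smooth_partial; exact: smooth_coord.
have {h1} := h1 c1; rewrite partial_coord eqxx => h1.
have sD x : ~ D x -> s x = 0.
  move=> nD; rewrite /s /q (compactly_supported_notin tf.2 nD) mul0r add0r.
  by rewrite sqrtr_sqr gtr0_norm// subrr.
have cs' : continuous s by move=> x; exact: differentiable_continuous.
have lsD : mu.-integrable D (EFin \o s) by exact: (Li_supp mD cs' s0).
have Es : \int[mu]_(x in D) s x = - \int[mu]_x (x ord0 j * partial j s x).
  rewrite h1 opprK (Rintegral_supp sD); apply: eq_Rintegral => x _.
  by rewrite mul1r.
have fs x : `|f x| <= e + s x.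
  rewrite /s addrCA subrr addr0 -sqrtr_sqr; apply: ler_wsqrtr.
  by rewrite /q expr2 lerDl ltW.
apply: (@le_trans _ _ (\int[mu]_(x in D) (e + s x))).
  by apply: le_Rintegral => //; [exact: Li_norm|apply: LiD => //; exact: Li_cst].
rewrite RintegralD//; last exact: Li_cst.
rewrite Rintegral_cst// -/m; apply: lerD => //.
rewrite Es -RintegralZl//; last exact: Li_norm.
apply: (le_trans (ler_norm _)); rewrite normrN.
have pD x : ~ D x -> partial j s x = 0.
  move=> nD; rewrite ps (compactly_supported_notin tf.2 nD).
  by rewrite mul0r mul0r.
rewrite -(@Rintegral_supp _ _ D (fun x => x ord0 j * partial j s x)); last first.
  by move=> x /pD ->; rewrite mulr0.
have lxp : mu.-integrable D (EFin \o (fun x : 'rV[R]_n => x ord0 j * partial j s x)).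
  have cx : continuous (fun x : 'rV[R]_n => x ord0 j * partial j s x).
    move=> x; have cj := smooth_continuous (smooth_coord (R := R) j).
    exact: (cvgM (cj x) (cs x)).
  apply: (Li_supp (M := M)) => // x xM.
  by rewrite ps (fM _ xM) !mul0r mulr0.
apply: (le_trans (le_normr_Rintegral mD lxp)).
apply: le_Rintegral => //; first exact: Li_norm.
  by apply: LiZ => //; exact: Li_norm.
move=> x Dx; rewrite normrM ler_pM//; first exact: le_trans (mx_norm_ge x ord0 j) (DM Dx).
rewrite ps normrM ler_piMl// normrM normfV (gtr0_norm (sq0 x)) ler_pdivrMr// mul1r.
by rewrite -sqrtr_sqr; apply: ler_wsqrtr; rewrite /q expr2 lerDl ltW.
Qed.

End energy.

Section quasiconvexity.
Context {R : realType} {n N : nat}.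
Notation mu := (@lebesgue_rV R n).
Notation cube := (@unit_cube R n).
Implicit Types (phi : 'rV[R]_n -> 'rV[R]_N).

Lemma weak_gradient_addl (D : set 'rV[R]_n) (z0 : 'M[R]_(N, n)) G : measurable D ->
  (mu D < +oo)%E -> mx_integrable D G -> mx_integrable D (fun x => z0 + G x).
Proof. by move=> mD fD lG; apply: mx_integrableD => //; exact: mx_integrable_cst. Qed.

Lemma linear_growth_shift (H : 'M[R]_(N, n) -> R) (L : R) z0 : linear_growth H L ->
  linear_growth (fun z => H (z0 + z)) (L * (1 + `|z0|)).
Proof.
move=> [cH L0 hH]; split.
- move=> z; apply: continuous_comp; last exact: cH.
  exact: (cvgD (cvg_cst _) cvg_id).
- by rewrite mulr_gt0// ltr_pwDl.
move=> z; apply: (le_trans (hH _)); rewrite -mulrA ler_pM2l//.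
have := ler_normD z0 z; have := normr_ge0 z; have := normr_ge0 z0; nra.
Qed.

Lemma test_lipschitz phi : test_function cube phi -> [lipschitz phi x | x in cube].
Proof.
move=> tphi; have sp := test_smooth tphi.
have [B B0 hB] := jac_bounded (@cube_norm R n) tphi.
have key x y : `|phi x - phi y| <= n%:R * B * `|x - y|.
  apply: mx_norm_le => [|i j]; first by rewrite !mulr_ge0// ltW.
  rewrite (ord1 i) !mxE.
  have sj := smooth_rowP j sp.
  have df z : differentiable (fun y => phi y ord0 j) z by exact: smooth_differentiable.
  have [t _] := MVT_line y ltr01 (fun z => diff_derivable (v := x - y) (df z)).
  rewrite scale1r subrK mul1r => ->; rewrite derive_partial//.
  apply: lin_form_le => k; have := le_trans (mx_norm_ge (jac phi (t *: (x - y) + y)) j k).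
  by rewrite mxE; apply; exact: hB.
exists (n%:R * B); split; first exact: num_real.
move=> K BK [x y] /= _; apply: (le_trans (key x y)).
by rewrite ler_wpM2r// ltW.
Qed.

Lemma quasiconvex_test (H : 'M[R]_(N, n) -> R) (L : R) z0 : linear_growth H L ->
  quasiconvex_at H z0 -> forall phi, test_function cube phi ->
  H z0 <= \int[mu]_(x in cube) H (z0 + jac phi x).
Proof.
move=> HL qc phi tphi; have := qc phi tphi.2 (test_lipschitz tphi).
have hG := jac_weak_gradient (@open_cube R n) (@cube_norm R n) tphi.
by rewrite (integral_wgrad (@open_cube R n) (@cube_norm R n) (linear_growth_shift z0 HL) hG).
Qed.

(** A box that contains D is blown down to the unit cube; on the rest of the box
    the gradient vanishes, which contributes the same amount to both sides. *)
Lemma quasiconvex_domain (D : set 'rV[R]_n) (M : R) (H : 'M[R]_(N, n) -> R) (L : R) z0 :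
  open D -> (forall x, D x -> `|x| <= M) -> linear_growth H L ->
  quasiconvex_at H z0 -> forall phi, test_function D phi ->
  fine (mu D) * H z0 <= \int[mu]_(x in D) H (z0 + jac phi x).
Proof.
move=> oD DM HL qc phi tphi.
have mD := measurable_rV_open oD; have fD := lebesgue_bounded_lt_oo mD DM.
have [c [r [r0 DB]]] := bounded_in_box DM.
have mB := measurable_box c r.
have fB := lebesgue_box_fin c r0.
have ri0 : r^-1 != 0 by rewrite invr_eq0 gt_eqF.
pose psi := rescale phi (- (r^-1 *: c)) r^-1.
have tpsi : test_function cube psi.
  have := test_function_rescale (- (r^-1 *: c)) ri0 tphi.
  by apply: test_function_sub => _ [x /DB bx <-].
have jpsi y : jac psi y = jac phi (aff c r y).
  rewrite jac_rescale//; last exact: test_smooth tphi.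
  by rewrite invrK scalerN scalerA divff ?gt_eqF// scale1r opprK.
have HL' := linear_growth_shift z0 HL.
have BM x : box c r x -> `|x| <= `|c| + r by exact: box_norm.
have tB := test_function_sub DB tphi.
have lB := Li_growth mB fB HL' (jac_integrable BM mB tB).
have E := Rintegral_box r0 lB.
have h := quasiconvex_test HL qc tpsi.
have E2 := Rintegral_split mB mD DB lB.
have rn0 : 0 < r ^+ n by rewrite exprn_gt0.
have h2 : r ^+ n * H z0 <= \int[mu]_(x in box c r) H (z0 + jac phi x).
  have hh : \int[mu]_(x in cube) H (z0 + jac psi x) =
      \int[mu]_(y in cube) H (z0 + jac phi (aff c r y)).
    by apply: eq_Rintegral => y _; rewrite jpsi.
  by rewrite hh in h; rewrite E; exact: (ler_wpM2l (ltW rn0) h).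
have E3 := Rintegral_box_outside r0 mD DB
  (fun x nD => congr1 (fun z => H (z0 + z)) (jac_supp tphi nD)).
rewrite addr0 in E3.
move: E2 h2; by rewrite E3 => ->; rewrite mulrBl addrCA lerDl subr_ge0.
Qed.

End quasiconvexity.

(** * Boundedness of minimizing sequences *)

Section growths.
Context {R : realType} {n N : nat}.
Notation mu := (@lebesgue_rV R n).

Lemma growth_enorm (F : 'M[R]_(N, n) -> R) (L : R) : continuous F -> 0 < L ->
  (forall z, `|F z| <= L * (enorm z + 1)) -> linear_growth F (L * ((N * n)%:R + 1)).
Proof.
move=> cF L0 hF; split => //; first by rewrite mulr_gt0// ltr_pwDr.
move=> z; apply: (le_trans (hF z)); rewrite -mulrA ler_pM2l//.
have k0 : 0 <= (N * n)%:R :> R by rewrite ler0n.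
have := enorm_le_mx_norm z; have z0 := normr_ge0 z; nra.
Qed.

Lemma Eint_growth : linear_growth (@Eint R N n) ((N * n)%:R + 1).
Proof.
have -> : (N * n)%:R + 1 = 1 * ((N * n)%:R + 1) :> R by rewrite mul1r.
apply: growth_enorm => //; first exact: Eint_continuous.
move=> z; rewrite ger0_norm ?Eint_ge0// mul1r; apply: (le_trans (Eint_le z)).
by rewrite lerDl.
Qed.

Lemma growth_sub_Eint (F : 'M[R]_(N, n) -> R) (L l : R) : linear_growth F L -> 0 < l ->
  linear_growth (fun z => F z - l * Eint z) (L + l * ((N * n)%:R + 1)).
Proof.
move=> [cF L0 hF] l0; have [cE LE0 hE] := Eint_growth; split.
- move=> z; have cz : {for z, continuous (fun z => l * @Eint R N n z)}.
    exact: (cvgM (cvg_cst l) (cE z)).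
  exact: (continuousB (cF z) cz).
- by rewrite addr_gt0// mulr_gt0.
move=> z; apply: (le_trans (ler_normB _ _)); rewrite mulrDl lerD//.
by rewrite normrM gtr0_norm// -mulrA ler_pM2l.
Qed.

End growths.

Section sufficiency.
Context {R : realType} {n N : nat}.
Notation mu := (@lebesgue_rV R n).
Variables (D : set 'rV[R]_n) (M : R).
Hypotheses (oD : open D) (DM : forall x, D x -> `|x| <= M).
Implicit Types (u v phi : 'rV[R]_n -> 'rV[R]_N) (G : 'rV[R]_n -> 'M[R]_(N, n)).

Let mD : measurable D := measurable_rV_open oD.
Let fD : (mu D < +oo)%E := lebesgue_bounded_lt_oo mD DM.

Lemma Rintegral_norm_enorm p q (f : 'rV[R]_n -> 'M[R]_(p, q)) : mx_integrable D f ->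
  \int[mu]_(x in D) `|f x| <= \int[mu]_(x in D) enorm (f x).
Proof.
move=> lf; apply: le_Rintegral => //; [exact: Li_mx_norm|exact: Li_enorm|].
by move=> x _; exact: mx_norm_le_enorm.
Qed.

Lemma Rintegral_enorm_norm p q (f : 'rV[R]_n -> 'M[R]_(p, q)) : mx_integrable D f ->
  \int[mu]_(x in D) enorm (f x) <= (p * q)%:R * \int[mu]_(x in D) `|f x|.
Proof.
move=> lf; have lnf := Li_mx_norm mD lf; rewrite -RintegralZl//.
apply: le_Rintegral => //; [exact: Li_enorm|exact: LiZ|].
by move=> x _; exact: enorm_le_mx_norm.
Qed.

Lemma Rintegral_normD p q (f h : 'rV[R]_n -> 'M[R]_(p, q)) : mx_integrable D f ->
  mx_integrable D h ->
  \int[mu]_(x in D) `|f x + h x| <= \int[mu]_(x in D) `|f x| + \int[mu]_(x in D) `|h x|.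
Proof.
move=> lf lh; have lnf := Li_mx_norm mD lf; have lnh := Li_mx_norm mD lh.
rewrite -RintegralD//; apply: le_Rintegral => //; [|exact: LiD|].
  by apply: Li_mx_norm => //; exact: mx_integrableD.
by move=> x _; exact: ler_normD.
Qed.

Lemma Rintegral_normB p q (f h : 'rV[R]_n -> 'M[R]_(p, q)) : mx_integrable D f ->
  mx_integrable D h ->
  \int[mu]_(x in D) `|f x - h x| <= \int[mu]_(x in D) `|f x| + \int[mu]_(x in D) `|h x|.
Proof.
move=> lf lh; have lnf := Li_mx_norm mD lf; have lnh := Li_mx_norm mD lh.
rewrite -RintegralD//; apply: le_Rintegral => //; [|exact: LiD|].
  by apply: Li_mx_norm => //; exact: mx_integrableB.
by move=> x _; exact: ler_normB.
Qed.

Lemma W11_0_approx v G (e : R) : W11_0 D v -> weak_gradient D v G -> 0 < e ->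
  exists2 phi, test_function D phi &
    \int[mu]_(x in D) `|v x - phi x| <= e /\ \int[mu]_(x in D) `|G x - jac phi x| <= e.
Proof.
move=> [_ hv] hG e0; have [phi tphi hphi] := hv e e0; exists phi => //.
have hJ := jac_weak_gradient oD DM tphi.
have hB := weak_gradientB oD DM hG hJ.
have [lvp lGJ _] := hB.
move: hphi; rewrite (W11normE oD DM hB) lte_fin => h.
have h1 := Rintegral_norm_enorm lvp; have h2 := Rintegral_norm_enorm lGJ.
have n1 : 0 <= \int[mu]_(x in D) `|(v \- phi)%R x| by exact: Rintegral_ge0.
have n2 : 0 <= \int[mu]_(x in D) `|G x - jac phi x| by exact: Rintegral_ge0.
by split; [apply: le_trans h1 _|apply: le_trans h2 _]; apply/ltW;
   apply: le_lt_trans h; rewrite ?lerDl ?lerDr; [apply: le_trans h2|apply: le_trans h1].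
Qed.

Lemma poincare_rV phi (j : 'I_n) : 0 <= M -> test_function D phi ->
  \int[mu]_(x in D) `|phi x| <= N%:R * (M * \int[mu]_(x in D) `|jac phi x|).
Proof.
move=> M0 tphi; have [lphi lJ _] := jac_weak_gradient oD DM tphi.
have lnJ := Li_mx_norm mD lJ.
have tc i : test_function D (fun x => phi x ord0 i).
  split; first exact: smooth_rowP (test_smooth tphi).
  have [_ [K [cK KD p0]]] := tphi; exists K; split => // x nK.
  by rewrite p0// mxE.
have ln i : mu.-integrable D (EFin \o (fun x => `|phi x ord0 i|)).
  exact: (Li_norm mD (lphi ord0 i)).
apply: (@le_trans _ _ (\int[mu]_(x in D) \sum_(i < N) `|phi x ord0 i|)).
  apply: le_Rintegral => //; [exact: Li_mx_norm|by apply: Li_sum|].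
  by move=> x _; have := mx_norm_le_sum (phi x); rewrite big_ord1.
rewrite Rintegral_sum//.
rewrite -[N in N%:R]card_ord mulr_natl -sumr_const; apply: ler_sum => i _.
apply: (le_trans (poincare oD DM j M0 (tc i))); apply: ler_wpM2l => //.
apply: le_Rintegral => //; last first.
  by move=> x _; have := mx_norm_ge (jac phi x) i j; rewrite mxE.
have := Li_norm mD (lJ i j); apply: eq_integrable => // x _.
by rewrite /= mxE.
Qed.

Variables (F : 'M[R]_(N, n) -> R) (L l : R) (z0 : 'M[R]_(N, n)).
Hypotheses (FL : linear_growth F L) (l0 : 0 < l).
Let H z := F z - l * Eint z.
Hypothesis qc : quasiconvex_at H z0.
Let L' := L + l * ((N * n)%:R + 1).
Let HL : linear_growth H L' := growth_sub_Eint FL l0.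

(** The gradient of the map differs from z0 + jac phi, where phi is a test
    function near v, by a field z of bounded L^1 norm. For a test function psi
    whose gradient is close to z off a small set, the H-energy of the map is
    comparable to that of z0 + jac (phi + psi), to which quasiconvexity
    applies. *)
Lemma energy_lower_bound (G0 : 'rV[R]_n -> 'M[R]_(N, n)) : mx_integrable D G0 ->
  exists C : R, forall v G, W11_0 D v -> weak_gradient D v G ->
    - C <= \int[mu]_(x in D) H (G0 x + G x).
Proof.
move=> lG0; have [_ L'0 _] := HL.
pose I0 := \int[mu]_(x in D) `|G0 x|.
pose m := fine (mu D); have m0 : 0 <= m by exact: fine_ge0.
pose Z := I0 + 1 + `|z0| * m.
pose K := @cell_const R n.
exists (- (m * H z0) + 1 + L' * (K * Z + 1 + Z)) => v G vW hG.
have [_ lG _] := hG.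
have [phi tphi [_ hphi]] := W11_0_approx vW hG ltr01.
have lJ := jac_integrable DM mD tphi.
have lz0 := mx_integrable_cst z0 mD fD.
have lU := mx_integrableD mD lG0 lG.
pose z x := G0 x + (G x - jac phi x) - z0.
have lGJ := mx_integrableB mD lG lJ.
have lz : mx_integrable D z := mx_integrableB mD (mx_integrableD mD lG0 lGJ) lz0.
have Zz : \int[mu]_(x in D) `|z x| <= Z.
  apply: (le_trans (Rintegral_normB (mx_integrableD mD lG0 lGJ) lz0)).
  rewrite Rintegral_cst//; apply: lerD => //.
  by apply: (le_trans (Rintegral_normD lG0 lGJ)); rewrite lerD2l.
have [tau tau0 hN] := superposition_close mD fD HL lU ltr01.
have t10 : 0 < Num.min tau 1 by rewrite lt_min tau0/=.
have [psi [A [tpsi [mA AD] At hA hI]]] := lusin_gradient oD DM lz t10.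
have tau1 : Num.min tau 1 <= 1 by rewrite ge_min lexx orbT.
have taut : Num.min tau 1 <= tau by rewrite ge_min lexx.
pose chi x := phi x + psi x.
have tchi : test_function D chi := test_functionD tphi tpsi.
have jchi x : jac chi x = jac phi x + jac psi x.
  by rewrite /chi jacD//; [exact: (test_smooth tphi)|exact: (test_smooth tpsi)].
have lchi := weak_gradient_addl z0 mD fD (jac_integrable DM mD tchi).
have lpsi := jac_integrable DM mD tpsi.
have Ez x : z0 + jac chi x - (G0 x + G x) = jac psi x - z x.
  rewrite jchi /z; move: (jac phi x) (jac psi x) (G0 x) (G x) => p s a b.
  by apply/matrixP => i j; rewrite !mxE; ring.
have := hN _ A lchi mA AD (le_trans At taut) _.
have h1 x : D x -> ~ A x -> `|z0 + jac chi x - (G0 x + G x)| <= tau.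
  by move=> Dx nA; rewrite Ez; apply: le_trans taut; exact: hA.
move=> /(_ h1) h2.
have lHc := Li_growth mD fD HL lchi; have lHu := Li_growth mD fD HL lU.
have q := quasiconvex_domain oD DM HL qc tchi.
have h3 : \int[mu]_(x in D) H (z0 + jac chi x) - \int[mu]_(x in D) H (G0 x + G x) <=
    1 + L' * (K * Z + 1 + Z).
  rewrite -(RintegralB mD lHc lHu); apply: (le_trans (ler_norm _)).
  apply: (le_trans (le_normr_Rintegral mD (LiB mD lHc lHu))); apply: (le_trans h2).
  rewrite lerD2l ler_pM2l//.
  have lpz := mx_integrableB mD lpsi lz.
  apply: (@le_trans _ _ (\int[mu]_(x in D) `|jac psi x - z x|)).
    rewrite (_ : \int[mu]_(x in A) _ = \int[mu]_(x in A) `|jac psi x - z x|).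
      exact: (Rintegral_subset mD mA AD (Li_mx_norm mD lpz)).
    by apply: eq_Rintegral => x _; rewrite Ez.
  apply: (le_trans (Rintegral_normB lpsi lz)); apply: lerD => //.
  apply: (le_trans hI); apply: lerD => //; apply: ler_wpM2l => //.
  exact: ltW cell_const_gt0.
move: q h3; rewrite -/m; move: (\int[mu]_(x in D) H (z0 + jac chi x)) => a.
move: (\int[mu]_(x in D) H (G0 x + G x)) (m * H z0) (L' * _) => b c d; lra.
Qed.

(** As l times the E-energy is the F-energy minus the H-energy, the lower bound
    for the latter controls the gradient; Poincare's inequality does the
    rest. *)
Lemma norm_bound (g : 'rV[R]_n -> 'rV[R]_N) (j : 'I_n) (S : R) : 0 <= M -> W11 D g ->
  exists B : R, forall u, dirichlet_class D g u -> (energy F D u <= S%:E)%E ->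
    (W11norm D u <= B%:E)%E.
Proof.
move=> M0 [G0 hg]; have [lg lG0 _] := hg.
have [C hC] := energy_lower_bound lG0.
pose m := fine (mu D).
pose B1 := (S + C) / l + m.
pose I0 := \int[mu]_(x in D) `|G0 x|.
pose B2 := 1 + N%:R * (M * (B1 + I0 + 1)).
exists ((1 * N)%:R * (\int[mu]_(x in D) `|g x| + B2) + B1) => _ [v vW <-].
have [[G hG] _] := vW; have [lv lG _] := hG.
have hu := weak_gradientD oD DM hg hG; have [lu lU _] := hu.
rewrite (energyE oD DM FL hu) lee_fin => hS.
rewrite (W11normE oD DM hu) lee_fin.
have lF := Li_growth mD fD FL lU; have lE := Li_growth mD fD Eint_growth lU.
have := hC v G vW hG; rewrite /H RintegralB//; last exact: LiZ.
rewrite RintegralZl// => hl.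
have hE : \int[mu]_(x in D) Eint (G0 x + G x) <= (S + C) / l.
  rewrite ler_pdivlMr// mulrC; move: hS hl.
  move: (\int[mu]_(x in D) F (G0 x + G x)) (l * _) => a b; lra.
have h1 : \int[mu]_(x in D) enorm (G0 x + G x) <= B1.
  apply: (@le_trans _ _ (\int[mu]_(x in D) (Eint (G0 x + G x) + 1))).
    apply: le_Rintegral => //; [exact: Li_enorm|by apply: LiD => //; exact: Li_cst|].
    by move=> x _; rewrite -lerBlDr; exact: Eint_ge.
  rewrite RintegralD//; last exact: Li_cst.
  by rewrite Rintegral_cst// mul1r lerD2r.
have [phi tphi [hv hJ]] := W11_0_approx vW hG ltr01.
have lJ := jac_integrable DM mD tphi.
have [lphi _ _] := jac_weak_gradient oD DM tphi.
have hGn : \int[mu]_(x in D) `|G x| <= B1 + I0.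
  have := Rintegral_normB lU lG0.
  rewrite (_ : \int[mu]_(x in D) _ = \int[mu]_(x in D) `|G x|); last first.
    by apply: eq_Rintegral => x _; rewrite addrC addKr.
  move=> /le_trans; apply; rewrite lerD2r.
  by apply: le_trans h1; exact: Rintegral_norm_enorm.
have hJn : \int[mu]_(x in D) `|jac phi x| <= B1 + I0 + 1.
  have := Rintegral_normB lG (mx_integrableB mD lG lJ).
  rewrite (_ : \int[mu]_(x in D) _ = \int[mu]_(x in D) `|jac phi x|); last first.
    by apply: eq_Rintegral => x _; rewrite subKr.
  by move=> /le_trans; apply; exact: lerD.
have hvn : \int[mu]_(x in D) `|v x| <= B2.
  have := Rintegral_normD (mx_integrableB mD lv lphi) lphi.
  rewrite (_ : \int[mu]_(x in D) _ = \int[mu]_(x in D) `|v x|); last first.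
    by apply: eq_Rintegral => x _; rewrite subrK.
  move=> /le_trans; apply; apply: lerD => //.
  apply: (le_trans (poincare_rV j M0 tphi)).
  by do 2 apply: ler_wpM2l => //.
apply: lerD => //; apply: (le_trans (Rintegral_enorm_norm lu)).
apply: ler_wpM2l => //; apply: (le_trans (Rintegral_normD lg lv)).
by rewrite lerD2l.
Qed.

(** Whether or not the infimum is finite, the energies are eventually at most e
    0 + 1. *)
Lemma minimizing_bounded (g : 'rV[R]_n -> 'rV[R]_N) (j : 'I_n)
    (u_ : nat -> 'rV[R]_n -> 'rV[R]_N) : 0 <= M -> W11 D g ->
  minimizing_sequence F D g u_ -> W11_bounded D u_.
Proof.
move=> M0 Wg [cu cvu].
have fe k : exists e : R, energy F D (u_ k) = e%:E.
  have [v [[G hG] _] <-] := cu k; have [G0 hg] := Wg.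
  by exists (\int[mu]_(x in D) F (G0 x + G x)); exact: (energyE oD DM FL (weak_gradientD oD DM hg hG)).
have /choice[e he] := fe.
have [K hK] : exists K, forall k, (K <= k)%N -> e k <= e 0%N + 1.
  have lt : (ereal_inf (energy F D @` dirichlet_class D g) < (e 0%N + 1)%:E)%E.
    apply: (@le_lt_trans _ _ (e 0%N)%:E); last by rewrite lte_fin ltrDl.
    by apply: ereal_inf_lbound; exists (u_ 0%N).
  have := cvu [set x | (x < (e 0%N + 1)%:E)%E]; case.
    by apply: open_nbhs_nbhs; split => //; exact: open_ereal_lt_ereal.
  move=> K _ hK; exists K => k /hK /=; rewrite he lte_fin; exact: ltW.
pose S := \sum_(k < K) `|e k| + (`|e 0%N| + 1).
have hS k : e k <= S.
  have p0 : 0 <= \sum_(k < K) `|e k| by exact: sumr_ge0.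
  have [kK|kK] := leqP K k.
    have := hK k kK; have := ler_norm (e 0%N); rewrite /S; lra.
  rewrite /S (bigD1 (Ordinal kK))//= -addrA; apply: (le_trans (ler_norm _)).
  by rewrite lerDl addr_ge0 ?addr_ge0//; exact: sumr_ge0.
have [B hB] := norm_bound j S M0 Wg.
by exists B => k; apply: hB => //; rewrite he lee_fin.
Qed.

End sufficiency.

(** * The gain from a failure of quasiconvexity *)

Section gain.
Context {R : realType} {n N : nat}.
Notation mu := (@lebesgue_rV R n).
Notation cube := (@unit_cube R n).
Implicit Types (phi : 'rV[R]_n -> 'rV[R]_N) (z : 'M[R]_(N, n)).

Let oC := @open_cube R n.
Let mC := @measurable_cube R n.
Let fC := @lebesgue_cube_fin R n.
Let CM := @cube_norm R n.

Lemma halfway (a b c : R) : b < c -> a - b <= (c - b) / 2 -> a < c.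
Proof. by lra. Qed.

Lemma quarter_gain (g a : R) : g / 2 <= a -> 2 * (g / 8) - a <= - (g / 4).
Proof. by lra. Qed.

Lemma third (k a b i : R) : k < (a - i) / 3 -> a - b <= (a - i) / 3 ->
  i + (a - i) / 3 <= b - k.
Proof. by lra. Qed.

(** By Markov's inequality convergence in L^1 implies convergence in measure. *)
Lemma superposition_L1 (D : set 'rV[R]_n) (H : 'M[R]_(N, n) -> R) (L : R)
    (G : 'rV[R]_n -> 'M[R]_(N, n)) (eta : R) : measurable D -> (mu D < +oo)%E ->
  linear_growth H L -> mx_integrable D G -> 0 < eta ->
  exists2 d : R, 0 < d & forall G', mx_integrable D G' ->
    \int[mu]_(x in D) `|G' x - G x| <= d ->
    \int[mu]_(x in D) `|H (G' x) - H (G x)| <= eta.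
Proof.
move=> mD fD HL lG eta0; have [_ L0 _] := HL.
have e20 : 0 < eta / 2 by rewrite divr_gt0.
have [tau tau0 ht] := superposition_close mD fD HL lG e20.
pose d := Num.min (tau * tau) (eta / (2 * L)).
exists d; first by rewrite lt_min mulr_gt0//= divr_gt0// mulr_gt0.
move=> G' lG' hG'; have lGG := Li_mx_norm mD (mx_integrableB mD lG' lG).
pose A := D `&` [set x | tau < `|G' x - G x|].
have mA : measurable A by apply: measurable_superlevel => //; exact: Li_measurable lGG.
have AD : A `<=` D by move=> x [].
have At : fine (mu A) <= tau.
  have := markov_superlevel mD fD (ltW tau0) lGG (fun x _ => normr_ge0 _).
  move=> /le_trans/(_ hG'); have : d <= tau * tau by rewrite ge_min lexx.
  by move=> h1 /le_trans/(_ h1); rewrite ler_pM2l.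
have hA x : D x -> ~ A x -> `|G' x - G x| <= tau.
  by move=> Dx nA; rewrite leNgt; apply/negP => h; apply: nA.
apply: (le_trans (ht G' A lG' mA AD At hA)).
have : L * \int[mu]_(x in A) `|G' x - G x| <= eta / 2.
  apply: (@le_trans _ _ (L * d)).
    rewrite ler_pM2l//; apply: le_trans hG'; exact: Rintegral_subset.
  have : d <= eta / (2 * L) by rewrite ge_min lexx orbT.
  by rewrite ler_pdivlMr ?mulr_gt0// mulrC -mulrA ler_pdivlMr// mulrC [L * d]mulrC.
move: (L * _) => a; lra.
Qed.

Variables (H : 'M[R]_(N, n) -> R) (L : R).
Hypothesis HL : linear_growth H L.

(** Either phi has no integrable weak gradient, in which case wgrad is 0 and the
    inequality cannot fail, or phi is a limit of test functions. *)
Lemma not_quasiconvex z : ~ quasiconvex_at H z ->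
  exists2 phi, test_function cube phi & \int[mu]_(x in cube) H (z + jac phi x) < H z.
Proof.
move=> /existsNP[phi /not_implyP[sphi /not_implyP[_ /negP]]]; rewrite -ltNge => lt.
have HL' := linear_growth_shift z HL.
have [[G hG]|nW] := pselect (W11 cube phi); last first.
  exfalso; move: lt; rewrite (_ : wgrad cube phi = fun=> 0); last first.
    by apply: xgetPN => G hG; apply: nW; exists G.
  have lH : mu.-integrable cube (EFin \o (fun=> H z)) by exact: Li_cst.
  have -> : (\int[mu]_(x in cube) (H (z + (0 : 'M[R]_(N, n))))%:E = (H z)%:E)%E.
    rewrite addr0 -[in RHS](@Rintegral_cube_cst R n (H z)) /Rintegral fineK//.
    exact: (integrable_fin_num mC lH).
  by rewrite ltxx.
move: lt; rewrite (integral_wgrad oC CM HL' hG) lte_fin => lt.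
have [_ lG _] := hG.
set I := \int[mu]_(x in cube) _ in lt.
have g0 : 0 < (H z - I) / 2 by rewrite divr_gt0// subr_gt0.
have [d d0 hd] := superposition_L1 mC fC HL' lG g0.
have [psi tpsi hpsi] := compactly_supported_approx oC CM sphi hG d0.
exists psi => //; have lpsi := jac_integrable CM mC tpsi.
have h := hd _ lpsi hpsi.
have l1 := Li_growth mC fC HL' lpsi; have l2 := Li_growth mC fC HL' lG.
have := le_trans (Rintegral_le_norm mC (LiB mC l1 l2)) h.
rewrite (RintegralB mC l1 l2) -/I.
exact: halfway lt.
Qed.

(** A test function that gives a gain at one point gives a third of it nearby,
    and balls are compact. *)
Lemma uniform_gain (K : R) : (forall z, ~ quasiconvex_at H z) ->
  exists (gam B : R), [/\ 0 < gam, 0 <= B & forall z, `|z| <= K ->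
    exists phi, [/\ test_function cube phi, forall x, `|jac phi x| <= B &
      \int[mu]_(x in cube) H (z + jac phi x) <= H z - gam]].
Proof.
move=> nq; have [cH L0 _] := HL.
(* A single k bounds the gradient and, inversely, the gain, so that one limit
   serves for both. *)
pose P (k : nat) z := exists phi, [/\ test_function cube phi, forall x, `|jac phi x| <= k%:R &
      \int[mu]_(x in cube) H (z + jac phi x) <= H z - k.+1%:R^-1].
have /compact_near_coveringP := @compact_mx_ball R N n K.
move=> /(_ nat \oo P _) [].
  move=> z1 _; have [phi tphi gphi] := not_quasiconvex (nq z1).
  have [B B0 hB] := jac_bounded CM tphi.
  set I := \int[mu]_(x in cube) _ in gphi.
  pose g0 := (H z1 - I) / 3.
  have g00 : 0 < g0 by rewrite divr_gt0// subr_gt0.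
  have [d d0 hd] := compact_unif_continuous (@compact_mx_ball R N n (`|z1| + B))
    (fun z _ => cH z) g00.
  exists (ball z1 d, [set k : nat | k.+1%:R^-1 < g0 /\ B <= k%:R]).
    split => /=; first exact: nbhsx_ballx.
    near=> k; split.
      by near: k; exact: (near_infty_natSinv_lt (PosNum g00)).
    by near: k; exact: nbhs_infty_ger.
  move=> [z k] /= [z1z [kg kB]]; rewrite -ball_normE/= in z1z.
  exists phi; split => // [x|]; first exact: le_trans kB.
  have lphi := jac_integrable CM mC tphi.
  have l1 := Li_growth mC fC (linear_growth_shift z1 HL) lphi.
  have l2 := Li_growth mC fC (linear_growth_shift z HL) lphi.
  have h1 : H z1 - H z <= g0.
    apply: (le_trans (ler_norm _)); apply: hd => //=; first by rewrite lerDl ltW.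
  have h2 : \int[mu]_(x in cube) H (z + jac phi x) <= I + g0.
    apply: (@le_trans _ _ (\int[mu]_(x in cube) (H (z1 + jac phi x) + g0))).
      apply: le_Rintegral => //; first by apply: LiD => //; exact: Li_cst.
      move=> x _; rewrite -lerBlDl; apply: (le_trans (ler_norm _)).
      rewrite distrC; apply: hd => /=.
        by apply: (le_trans (ler_normD _ _)); rewrite lerD2l.
      by rewrite opprD addrACA subrr addr0.
    rewrite RintegralD//; last exact: Li_cst.
    by rewrite Rintegral_cube_cst.
  by apply: (le_trans h2); exact: third kg h1.
move=> k _ /(_ k (leqnn k)) hk.
exists k.+1%:R^-1, k%:R; split => // z zK; exact: hk.
Unshelve. all: by end_near.
Qed.

Lemma box01 : box 0 1 = cube :> set 'rV[R]_n.
Proof. by rewrite /box scaler0 oppr0 invr1; apply/seteqP; split => x; rewrite /= /aff add0r scale1r. Qed.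

Lemma jac_unif_continuous phi (w : R) : test_function cube phi -> 0 < w ->
  exists2 d : R, 0 < d & forall x y, `|x - y| < d -> `|jac phi x - jac phi y| <= w.
Proof.
move=> tphi w0; apply: (supp_unif_continuous (M := 1)) => //.
  exact: jac_continuous (test_smooth tphi).
by move=> x x1; apply: (jac_supp tphi) => /cube_norm; rewrite leNgt x1.
Qed.

(** On the cells of a fine grid jac phi is almost constant, and on at least half
    of the cube its value on the cell has norm at most K; each such cell yields
    most of the gain. *)
Lemma grid_gain phi (K K' gam B : R) : test_function cube phi -> 0 < gam -> 0 <= B ->
  K' < K ->
  (forall z, `|z| <= K -> exists psi, [/\ test_function cube psi, forall x, `|jac psi x| <= B &
      \int[mu]_(x in cube) H (z + jac psi x) <= H z - gam]) ->
  2^-1 <= 1 - fine (mu (cube `&` [set x | K' < `|jac phi x|])) ->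
  exists2 chi, test_function cube chi &
    \int[mu]_(x in cube) H (jac chi x) <= \int[mu]_(x in cube) H (jac phi x) - gam / 4.
Proof.
move=> tphi gam0 B0 KK hK half; have [cH L0 _] := HL.
have [B1 B10 hB1] := jac_bounded CM tphi.
(* Replacing jac phi by its value at the centre of a cell, before and after the
   insertion, costs w each time, and gam / 2 - 2 w = gam / 4. *)
pose w := gam / 8; have w0 : 0 < w by rewrite divr_gt0.
have [dH dH0 hH] := compact_unif_continuous (@compact_mx_ball R N n (B1 + B))
    (fun z _ => cH z) w0.
pose e := Num.min (dH / 2) (K - K').
have e0 : 0 < e by rewrite lt_min divr_gt0//= subr_gt0.
have eH : e < dH by rewrite gt_min; apply/orP; left; lra.
have eK : e <= K - K' by rewrite ge_min lexx orbT.
have [d d0 hd] := jac_unif_continuous tphi e0.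
have [p p0 pd] := small_mesh ltr01 d0.
pose s : R := mesh 1 p; have s0 : 0 < s := mesh_gt0 ltr01 p0.
pose xc (b : {ffun 'I_n -> 'I_p}) := aff (corner 0 1 b) s (const_mx 2^-1 : 'rV[R]_n).
have cxc b : cell 0 1 b (xc b).
  rewrite /cell /box /xc/= affK ?lt0r_neq0// => j; rewrite mxE.
  by apply/andP; split; lra.
pose za b := jac phi (xc b).
have /choice[psi hpsi] : forall b : {ffun 'I_n -> 'I_p}, exists psi : 'rV[R]_n -> 'rV[R]_N,
   [/\ test_function cube psi, forall x, `|jac psi x| <= B &
      \int[mu]_(x in cube) H (za b + jac psi x) <= H (za b) - gam * (`|za b| <= K)%R%:R].
  move=> b; have [zK|zK] := leP `|za b| K.
    by have [psi [t1 t2 t3]] := hK _ zK; exists psi; split => //; rewrite mulr1.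
  exists (fun=> 0); split => [|x|]; first exact: test_function0.
    by rewrite jac0 normr0.
  rewrite mulr0 subr0 (_ : \int[mu]_(x in cube) _ = H (za b))//.
  transitivity (\int[mu]_(x in cube) H (za b)).
    by apply: eq_Rintegral => x _; rewrite jac0 addr0.
  by rewrite Rintegral_cube_cst.
have tpsi b : test_function cube (psi b) by case: (hpsi b).
have cell_cube (b : {ffun 'I_n -> 'I_p}) : cell (0 : 'rV[R]_n) 1 b `<=` cube.
  by move=> x bx; rewrite -box01; exact: (cell_sub ltr01 p0 bx).
have tO b : test_function cube (rescale (psi b) (corner 0 1 b) s).
  apply: (test_function_sub (cell_cube b)).
  exact: (rescale_test_cell 0 (psi := psi) (a := b) ltr01 p0 (tpsi b)).
pose Psi := grid_map 0 1 psi.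
have tPsi : test_function cube Psi := (grid_map_test tO).1.
have jPsi b x : cell 0 1 b x -> jac Psi x = jac (psi b) (aff (- (s^-1 *: corner 0 1 b)) s^-1 x).
  by move=> bx; exact: (jac_grid_map ltr01 p0 tpsi tO bx).
pose chi x := phi x + Psi x.
have tchi : test_function cube chi := test_functionD tphi tPsi.
have jchi x : jac chi x = jac phi x + jac Psi x.
  by rewrite /chi jacD//; [exact: (test_smooth tphi)|exact: (test_smooth tPsi)].
exists chi => //.
have lchi := Li_growth mC fC HL (jac_integrable CM mC tchi).
have lphi := Li_growth mC fC HL (jac_integrable CM mC tphi).
have mcell (b : {ffun 'I_n -> 'I_p}) : measurable (cell (0 : 'rV[R]_n) 1 b) := measurable_box _ _.
have fcell (b : {ffun 'I_n -> 'I_p}) : (mu (cell (0 : 'rV[R]_n) 1 b) < +oo)%E.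
  exact: (fin_measure_subset mC (mcell b) (cell_cube b) fC).
have sn0 : 0 <= s ^+ n by rewrite exprn_ge0// ltW.
have muC (b : {ffun 'I_n -> 'I_p}) : fine (mu (cell (0 : 'rV[R]_n) 1 b)) = s ^+ n.
  exact: lebesgue_cell.
have near_za b x : cell 0 1 b x -> `|za b - jac phi x| <= e.
  by move=> bx; apply: hd; apply: le_lt_trans pd; exact: (box_diam s0 (cxc b) bx).
pose good b : R := (`|za b| <= K)%R%:R.
have upper b : \int[mu]_(x in cell 0 1 b) H (jac chi x) <=
    \int[mu]_(x in cell 0 1 b) H (jac phi x) + s ^+ n * (2 * w - gam * good b).
  have lgb := Li_growth mC fC (linear_growth_shift (za b) HL) (jac_integrable CM mC (tpsi b)).
  have [_ hB hI] := hpsi b.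
  have h1 : \int[mu]_(x in cell 0 1 b) H (jac chi x) <=
      s ^+ n * (H (za b) - gam * good b) + w * s ^+ n.
    have lb := Li_box_inv (corner 0 1 b) s0 lgb.
    have lwb := Li_cst w (mcell b) (fcell b).
    have Eb := Rintegral_box_inv (corner 0 1 b) s0 lgb.
    apply: (@le_trans _ _ (\int[mu]_(x in cell 0 1 b)
        (H (za b + jac (psi b) (aff (- (s^-1 *: corner 0 1 b)) s^-1 x)) + w))).
      apply: le_Rintegral => //.
      - exact: (LiS mC (mcell b) (cell_cube b) lchi).
      - exact: (LiD (mcell b) lb lwb).
      move=> x bx; rewrite -lerBlDl; apply: (le_trans (ler_norm _)).
      rewrite distrC jchi (jPsi b x bx); apply: hH => /=.
        by apply: (le_trans (ler_normD _ _)); apply: lerD; [exact: hB1|exact: hB].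
      rewrite opprD addrACA subrr addr0; exact: le_lt_trans (near_za b x bx) eH.
    rewrite (RintegralD (mcell b) lb lwb).
    rewrite (Rintegral_cst _ (mcell b)) muC lerD2r [X in X <= _]Eb.
    by rewrite ler_wpM2l.
  have h2 : s ^+ n * H (za b) - w * s ^+ n <= \int[mu]_(x in cell 0 1 b) H (jac phi x).
    have -> : s ^+ n * H (za b) - w * s ^+ n = \int[mu]_(x in cell 0 1 b) (H (za b) - w).
      by rewrite (Rintegral_cst _ (mcell b)) muC mulrBl [s ^+ n * _]mulrC.
    apply: (le_Rintegral (mcell b) (Li_cst _ (mcell b) (fcell b))
      (LiS mC (mcell b) (cell_cube b) lphi)) => x bx.
    rewrite lerBlDr -lerBlDl; apply: (le_trans (ler_norm _)).
    apply: hH => /=; last exact: le_lt_trans (near_za b x bx) eH.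
    by apply: (le_trans (hB1 _)); rewrite lerDl.
  move: h1 h2; move: (\int[mu]_(x in _) _) (\int[mu]_(x in _) _) => X Y h1 h2.
  have -> : s ^+ n * (2 * w - gam * good b) =
    (s ^+ n * (H (za b) - gam * good b) + w * s ^+ n) - (s ^+ n * H (za b) - w * s ^+ n).
    by ring.
  by rewrite addrA lerBrDr [X + _]addrC; exact: lerD.
have goods : 2^-1 <= \sum_b s ^+ n * good b.
  pose S := cube `&` [set x | K' < `|jac phi x|].
  have lJ := Li_jac_norm CM mC tphi.
  have mS : measurable S by apply: measurable_superlevel => //; exact: Li_measurable lJ.
  have SC : S `<=` cube by move=> x [].
  have lS : mu.-integrable cube (EFin \o (fun x => 1 - \1_S x)).
    by apply: LiB => //; [exact: Li_cst|exact: Li_indic].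
  apply: (le_trans half); rewrite -/S.
  have -> : 1 - fine (mu S) = \int[mu]_(x in cube) (1 - \1_S x).
    rewrite RintegralB//; [|exact: Li_cst|exact: Li_indic].
    by rewrite Rintegral_indic// (setIidl SC) Rintegral_cube_cst.
  have lS' : mu.-integrable (box 0 1) (EFin \o (fun x => 1 - \1_S x)) by rewrite box01.
  have -> : \int[mu]_(x in cube) (1 - \1_S x) =
      \sum_(b : {ffun 'I_n -> 'I_p}) \int[mu]_(x in cell 0 1 b) (1 - \1_S x).
    by rewrite -(grid_split ltr01 p0 lS') box01.
  apply: ler_sum => b _; rewrite mulrC -(muC b) -(Rintegral_cst _ (mcell b)).
  apply: (le_Rintegral (mcell b) (LiS mC (mcell b) (cell_cube b) lS)
    (Li_cst _ (mcell b) (fcell b))) => x bx.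
  rewrite indicE; have [xS|xS] := boolP (x \in S).
    by rewrite subrr ler0n.
  rewrite subr0 /good; have [//|zK] := leP `|za b| K.
  exfalso; move/negP: xS; apply; rewrite inE; split; first exact: cell_cube bx.
  rewrite /=; have := near_za b x bx; have := ler_normD (za b - jac phi x) (jac phi x).
  rewrite subrK; lra.
have lchi' : mu.-integrable (box 0 1) (EFin \o (fun x => H (jac chi x))) by rewrite box01.
have lphi' : mu.-integrable (box 0 1) (EFin \o (fun x => H (jac phi x))) by rewrite box01.
have Echi := grid_split ltr01 p0 lchi'; have Ephi := grid_split ltr01 p0 lphi'.
rewrite box01 in Echi Ephi; rewrite Echi Ephi.
apply: (@le_trans _ _ (\sum_b (\int[mu]_(x in cell 0 1 b) H (jac phi x) +
    s ^+ n * (2 * w - gam * good b)))).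
  by apply: ler_sum => b _; exact: upper.
rewrite big_split/= lerD2l.
have -> : \sum_b s ^+ n * (2 * w - gam * good b) = 2 * w - gam * \sum_b s ^+ n * good b.
  have E2w : \sum_(b : {ffun 'I_n -> 'I_p}) s ^+ n * (2 * w) = 2 * w.
    by rewrite sum_cells// expr1n mul1r.
  rewrite -[X in _ = X - _]E2w mulr_sumr -sumrB; apply: eq_bigr => b _.
  by move: (s ^+ n) (good b) => u v; ring.
have : gam * 2^-1 <= gam * \sum_b s ^+ n * good b by rewrite ler_pM2l.
exact: quarter_gain.
Qed.

End gain.

(** * Increasing the E-energy at little cost *)

Lemma gain_contradiction (R : realType) (g e i x y : R) : 0 < g -> e <= g / 8 ->
  i <= x -> x <= y - g / 4 -> y < i + e -> False.
Proof. by lra. Qed.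

Section necessity.
Context {R : realType} {n N : nat}.
Notation mu := (@lebesgue_rV R n).
Notation cube := (@unit_cube R n).
Hypothesis n0 : (0 < n)%N.
Implicit Types (phi : 'rV[R]_n -> 'rV[R]_N) (z : 'M[R]_(N, n)).

Let oC := @open_cube R n.
Let mC := @measurable_cube R n.
Let fC := @lebesgue_cube_fin R n.
Let CM := @cube_norm R n.

Variables (F : 'M[R]_(N, n) -> R) (L : R).
Hypothesis FL : linear_growth F L.

Let EL := @Eint_growth R n N.

(** As F - l E is bounded below, a near-minimiser of F - (l/2) E has bounded
    E-energy, hence a bounded gradient on half of the cube; if quasiconvexity
    failed at every point, [grid_gain] would take it below the infimum. *)
Lemma quasiconvex_of_bounded_below (l C : R) : 0 < l ->
  (forall phi, test_function cube phi ->
     - C <= \int[mu]_(x in cube) (F (jac phi x) - l * Eint (jac phi x))) ->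
  exists z0, quasiconvex_at (fun z => F z - l / 2 * Eint z) z0.
Proof.
move=> l0 hC; apply: contrapT => /forallNP nq.
have l20 : 0 < l / 2 by rewrite divr_gt0.
pose H z := F z - l / 2 * Eint z.
have HL := growth_sub_Eint FL l20; rewrite -/H in HL.
have lJ phi (K : 'M[R]_(N, n) -> R) LK : test_function cube phi -> linear_growth K LK ->
    mu.-integrable cube (EFin \o (fun x => K (jac phi x))).
  by move=> tphi KL; exact: (Li_growth mC fC KL (jac_integrable CM mC tphi)).
have E0 phi : 0 <= \int[mu]_(x in cube) Eint (jac phi x).
  by apply: Rintegral_ge0 => x _; exact: Eint_ge0.
have split phi (a : R) : test_function cube phi ->
    \int[mu]_(x in cube) (F (jac phi x) - a * Eint (jac phi x)) =
    \int[mu]_(x in cube) F (jac phi x) - a * \int[mu]_(x in cube) Eint (jac phi x).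
  move=> tphi; have l1 := lJ phi _ _ tphi FL; have l2 := lJ phi _ _ tphi EL.
  by rewrite (RintegralB mC l1 (LiZ a mC l2)) (RintegralZl a mC l2).
pose S := [set s | exists2 phi, test_function cube phi & s = \int[mu]_(x in cube) H (jac phi x)].
have Slb : lbound S (- C).
  move=> _ [phi tphi ->]; apply: (le_trans (hC phi tphi)); rewrite !split//.
  by rewrite lerD2l lerN2 ler_wpM2r//; lra.
have S0 : S !=set0.
  by exists (\int[mu]_(x in cube) H (jac (fun=> 0 : 'rV[R]_N) x)); exists (fun=> 0) => //; exact: test_function0.
have hi : has_inf S by split => //; exists (- C).
(* The energies of F - (l/2) E and F - l E differ by l/2 times the E-energy. *)
pose I := inf S; pose T := 2 * (I + 1 + C) / l.
(* By Markov's inequality the gradient exceeds this level on at most half of the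
   cube. *)
pose K' := 2 * (`|T| + 1).
have T0 := normr_ge0 T.
have K'0 : 0 < K' by rewrite mulr_gt0// ltr_pwDr.
have [gam [B [gam0 B0 hB]]] := uniform_gain HL (K' + 1) nq.
have e0 : 0 < Num.min 1 (gam / 8) by rewrite lt_min ltr01/= divr_gt0.
have [_ [phi tphi ->]] := inf_adherent e0 hi; rewrite -/I => hphi.
have e1 : Num.min 1 (gam / 8) <= 1 by rewrite ge_min lexx.
have eg : Num.min 1 (gam / 8) <= gam / 8 by rewrite ge_min lexx orbT.
move: (Num.min _ _) e0 hphi e1 eg => e e0 hphi e1 eg.
have hE : \int[mu]_(x in cube) Eint (jac phi x) <= T.
  rewrite /T ler_pdivlMr//; have := hC phi tphi; move: hphi; rewrite !split//.
  move: (\int[mu]_(x in cube) F _) (\int[mu]_(x in cube) Eint _) => a b h1 h2.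
  have -> : b * l = 2 * ((a - l / 2 * b) - (a - l * b)) by field.
  by rewrite ler_pM2l//; lra.
have lnJ := Li_jac_norm CM mC tphi.
have hJ : \int[mu]_(x in cube) `|jac phi x| <= `|T| + 1.
  have lE := lJ phi _ _ tphi EL; have lc := Li_cst (1 : R) mC fC.
  apply: (@le_trans _ _ (\int[mu]_(x in cube) (Eint (jac phi x) + 1))).
    apply: (le_Rintegral mC lnJ (LiD mC lE lc)) => x _; rewrite -lerBlDr.
    by apply: le_trans (Eint_ge _); rewrite lerD2r mx_norm_le_enorm.
  rewrite (RintegralD mC lE lc) Rintegral_cube_cst lerD2r.
  exact: le_trans hE (ler_norm _).
have half : 2^-1 <= 1 - fine (mu (cube `&` [set x | K' < `|jac phi x|])).
  have := markov_superlevel mC fC (ltW K'0) lnJ (fun x _ => normr_ge0 _).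
  move=> /le_trans/(_ hJ); move: (fine _) => a.
  have T1 : 0 < `|T| + 1 by rewrite ltr_pwDr.
  rewrite /K' mulrAC -[X in _ <= X]mul1r ler_pM2r// => h; lra.
have KK : K' < K' + 1 by rewrite ltrDl.
have [chi tchi hchi] := grid_gain HL tphi gam0 B0 KK hB half.
have := ge_inf (E := S) _ (x := \int[mu]_(x in cube) H (jac chi x)).
move=> /(_ _ _)h; have {}h : I <= \int[mu]_(x in cube) H (jac chi x).
  by apply: h; [exists (- C)|exists chi].
exact: gain_contradiction gam0 eg h hchi hphi.
Qed.

Lemma Rintegral_concentrate (K : 'M[R]_(N, n) -> R) LK phi c (rho r : R) :
  linear_growth K LK -> test_function cube phi -> 0 < rho -> rho <= r ->
  \int[mu]_(x in box c r) K (jac (rescale phi c rho) x) =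
    rho ^+ n * \int[mu]_(y in cube) K (jac phi y) + (r ^+ n - rho ^+ n) * K 0.
Proof.
move=> KL tphi rho0 rr; have r0 := lt_le_trans rho0 rr.
have sub : box c rho `<=` box c r.
  move=> x /(boxP _ _ rho0) h; apply/(boxP _ _ r0) => j.
  by have /andP[-> h2] := h j; apply: (lt_le_trans h2); rewrite lerD2l.
have mB := measurable_box c r; have mB' := measurable_box c rho.
have fB := lebesgue_box_fin c r0.
have BM x : box c r x -> `|x| <= `|c| + r by exact: box_norm.
have trho : test_function (box c rho) (rescale phi c rho).
  by rewrite -box_image ?lt0r_neq0//; apply: test_function_rescale; rewrite ?lt0r_neq0.
have tr := test_function_sub sub trho.
have lK := Li_growth mB fB KL (jac_integrable BM mB tr).
have lphi := Li_growth mC fC KL (jac_integrable CM mC tphi).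
rewrite (Rintegral_split mB mB' sub lK); congr (_ + _).
  rewrite -(Rintegral_box_inv c rho0 lphi); apply: eq_Rintegral => x _.
  by rewrite jac_rescale ?lt0r_neq0//; exact: test_smooth tphi.
rewrite (Rintegral_box_outside r0 mB' sub
  (fun x nB => congr1 K (jac_supp trho nB))).
by rewrite [mu _]lebesgue_box.
Qed.

Hypothesis unbounded : forall l C : R, 0 < l -> exists2 phi, test_function cube phi &
  \int[mu]_(x in cube) (F (jac phi x) - l * Eint (jac phi x)) < - C.

(** Shrinking phi by the factor rho multiplies its energies by rho^n; the factor
    is chosen such that the E-energy becomes T. *)
Lemma concentrate c (r T l : R) : 0 < r -> 0 < T -> 0 < l ->
  exists chi, [/\ test_function (box c r) chi,
    T <= \int[mu]_(x in box c r) Eint (jac chi x) &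
    \int[mu]_(x in box c r) F (jac chi x) <= l * T + `|F 0| * r ^+ n].
Proof.
move=> r0 T0 l0; have [cF L0 hF] := FL.
have rn0 : 0 < r ^+ n by rewrite exprn_gt0.
pose q := T / r ^+ n; have q0 : 0 < q by rewrite divr_gt0.
(* By the linear growth of F an energy below - C forces an E-energy of at least
   q + 1, whence rho <= r below. *)
pose C := 2 * L + (L + l) * (q + 1).
have [phi tphi hphi] := unbounded C l0.
have lphi := jac_integrable CM mC tphi.
have lF := Li_growth mC fC FL lphi; have lE := Li_growth mC fC EL lphi.
move: hphi; rewrite (RintegralB mC lF (LiZ l mC lE)) (RintegralZl l mC lE).
set IF := \int[mu]_(x in cube) F _; set IE := \int[mu]_(x in cube) Eint _ => hphi.
have hIF : - (L * (2 + IE)) <= IF.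
  have lc := Li_cst (2 : R) mC fC.
  have l2 := LiZ L mC (LiD mC lc lE).
  have -> : - (L * (2 + IE)) = \int[mu]_(x in cube) - (L * (2 + Eint (jac phi x))).
    have -> : \int[mu]_(x in cube) - (L * (2 + Eint (jac phi x))) =
        \int[mu]_(x in cube) ((- 1) * (L * (2 + Eint (jac phi x)))).
      by apply: eq_Rintegral => x _; rewrite mulN1r.
    rewrite (RintegralZl (- 1) mC l2) (RintegralZl L mC (LiD mC lc lE)).
    by rewrite (RintegralD mC lc lE) Rintegral_cube_cst mulN1r.
  apply: (le_Rintegral mC (LiN mC l2) lF) => x _.
  rewrite lerNl; apply: (le_trans _ (le_trans (hF (jac phi x)) _)).
    by rewrite -normrN ler_norm.
  rewrite ler_pM2l//; have := Eint_ge (jac phi x); have := mx_norm_le_enorm (jac phi x).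
  lra.
have Ll0 : 0 < L + l by rewrite addr_gt0.
have hIE : q + 1 <= IE.
  rewrite -(ler_pM2l Ll0).
  by move: hphi hIF; rewrite /C; move: (q) (IF) (IE) => a b c' ; nra.
have IE0 : 0 < IE by lra.
have hIF2 : IF <= l * IE.
  have : 0 <= C by rewrite addr_ge0// mulr_ge0 ?(ltW L0) ?(ltW Ll0)//; lra.
  by move: hphi; move: (l * IE) => a; lra.
pose t := T / IE; have t0 : 0 < t by rewrite divr_gt0.
pose rho := t `^ (n%:R^-1).
have rho0 : 0 < rho by exact: powR_gt0.
have rhon : rho ^+ n = t.
  rewrite -powR_mulrn ?(ltW rho0)// /rho -powRrM mulVf ?pnatr_eq0 -?lt0n//.
  by rewrite powRr1// ltW.
have rhor : rho <= r.
  rewrite -(@ler_pXn2r _ n) ?nnegrE ?(ltW rho0) ?(ltW r0)// rhon /t ler_pdivrMr//.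
  by rewrite -ler_pdivrMl// mulrC -/q; lra.
have E00 : Eint (0 : 'M[R]_(N, n)) = 0.
  have e0 := Eint_ge0 (0 : 'M[R]_(N, n)); have := Eint_le (0 : 'M[R]_(N, n)).
  have := enorm_le_mx_norm (0 : 'M[R]_(N, n)); rewrite normr0 mulr0.
  by move=> h1 h2; apply/eqP; rewrite eq_le e0 (le_trans h2 h1).
exists (rescale phi c rho); split.
- have sub : box c rho `<=` box c r.
    move=> x /(boxP _ _ rho0) h; apply/(boxP _ _ r0) => j.
    by have /andP[-> h2] := h j; apply: (lt_le_trans h2); rewrite lerD2l.
  apply: (test_function_sub sub).
  by rewrite -box_image ?lt0r_neq0//; apply: test_function_rescale; rewrite ?lt0r_neq0.
- rewrite (Rintegral_concentrate c EL tphi rho0 rhor) E00 mulr0 addr0 rhon -/IE.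
  by rewrite /t divfK// gt_eqF.
- rewrite (Rintegral_concentrate c FL tphi rho0 rhor) rhon -/IF; apply: lerD.
    have -> : l * T = t * (l * IE) by rewrite mulrCA /t divfK// gt_eqF.
    by rewrite ler_pM2l.
  have tr : t <= r ^+ n by rewrite -rhon ler_pXn2r ?nnegrE ?(ltW rho0) ?(ltW r0).
  apply: (@le_trans _ _ ((r ^+ n - t) * `|F 0|)).
    by rewrite ler_wpM2l ?subr_ge0// ler_norm.
  by rewrite mulrC ler_wpM2l// gerBl ltW.
Qed.

Lemma open_box (c : 'rV[R]_n) (r : R) : open (box c r).
Proof.
apply: open_comp oC => x _; apply: differentiable_continuous.
exact: differentiable_aff.
Qed.

(** In a small box the gradient of a Lusin type map nearly cancels G, at a cost
    that tends to 0 with the box; a concentrated test function is put on top of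
    it. *)
Lemma perturb (D : set 'rV[R]_n) (M : R) (G : 'rV[R]_n -> 'M[R]_(N, n)) (eta T : R) :
  open D -> D !=set0 -> (forall x, D x -> `|x| <= M) -> mx_integrable D G ->
  0 < eta -> 0 < T ->
  exists psi, [/\ test_function D psi,
    \int[mu]_(x in D) F (G x + jac psi x) <= \int[mu]_(x in D) F (G x) + eta &
    T <= \int[mu]_(x in D) Eint (G x + jac psi x)].
Proof.
move=> oD [x0 Dx0] DM lG eta0 T0; have [_ L0 _] := FL;
pose LE : R := (N * n)%:R + 1; have EL' : linear_growth (@Eint R N n) LE := EL.
have [_ LE0 _] := EL'.
have mD := measurable_rV_open oD; have fD := lebesgue_bounded_lt_oo mD DM.
have lnG := Li_mx_norm mD lG.
pose C := @cell_const R n.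
have C0 : 0 <= C by exact: ltW cell_const_gt0.
(* The errors in the E-energy and in the F-energy turn out to be at most k a1
   and k a2. *)
pose a1 := 1 + LE * (C + 2); pose a2 := `|F 0| + 1 + L * (C + 2) + 2 * L.
have a10 : 0 < a1 by rewrite ltr_pwDl// mulr_ge0 ?(ltW LE0)// addr_ge0.
have a20 : 0 < a2.
  have h := mulr_ge0 (ltW L0) (addr_ge0 C0 (ler0n R 2)); have := normr_ge0 (F 0).
  by rewrite /a2; lra.
have [k [k0 ka1 ka2]] : exists k, [/\ 0 < k, k * a1 <= 1 & k * a2 <= eta / 2].
  exists (Num.min a1^-1 (eta / (2 * a2))); split.
  - by rewrite lt_min invr_gt0 a10/= divr_gt0// mulr_gt0.
  - by rewrite -ler_pdivlMr// div1r ge_min lexx.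
  rewrite -ler_pdivlMr// (_ : eta / 2 / a2 = eta / (2 * a2)); last by field; rewrite gt_eqF.
  by rewrite ge_min lexx orbT.
have [t t0 ht] := Rintegral_abs_cont mD fD lnG k0.
have [d d0 hd] : exists2 d : R, 0 < d & forall x, `|x - x0| < d -> D x.
  have : nbhs x0 D by apply: open_nbhs_nbhs.
  move=> /nbhs_ballP[d /= d0 h]; exists d => // x xd; apply: h.
  by rewrite -ball_normE/= distrC.
pose r := Num.min (Num.min (d / 2) 1) (Num.min t k).
have r0 : 0 < r by rewrite !lt_min divr_gt0//= ltr01 t0 k0.
have rd : r < d.
  have : r <= d / 2 by rewrite !ge_min lexx.
  by lra.
have r1 : r <= 1 by rewrite !ge_min lexx orbT.
have rt : r <= t by rewrite !ge_min lexx !orbT.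
have rk : r <= k by rewrite !ge_min lexx !orbT.
have rnr : r ^+ n <= r.
  by case: (n) n0 => // m _; rewrite exprS ler_piMr ?(ltW r0)// exprn_ile1// ltW.
have rn0 : 0 < r ^+ n by rewrite exprn_gt0.
pose B := box x0 r.
have oB : open B by exact: open_box.
have mB : measurable B := measurable_box _ _.
have BM x : B x -> `|x| <= `|x0| + r by exact: box_norm.
have muB : fine (mu B) = r ^+ n by have -> : mu B = _ := lebesgue_box _ r0.
have fB := lebesgue_bounded_lt_oo mB BM.
have BD : B `<=` D.
  move=> x /(boxP _ _ r0) h; apply: hd; apply: le_lt_trans rd.
  apply: mx_norm_le => [|i j]; first exact: ltW.
  rewrite (ord1 i) !mxE; have /andP[h1 h2] := h j.
  by rewrite ler_norml; apply/andP; split; lra.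
have BG : \int[mu]_(x in B) `|G x| <= k.
  have := ht B mB BD; rewrite muB => /(_ (le_trans rnr rt)).
  rewrite (_ : \int[mu]_(x in B) _ = \int[mu]_(x in B) `|G x|)//.
  by apply: eq_Rintegral => x _; rewrite normr_id.
pose l := eta / (2 * (T + 1)).
have T10 : 0 < T + 1 by rewrite addr_gt0.
have l0 : 0 < l by rewrite divr_gt0// mulr_gt0.
have lT : l * (T + 1) = eta / 2 by rewrite /l; field; rewrite gt_eqF.
have [chi [tchi hE hF]] := concentrate x0 r0 T10 l0.
have lchi := jac_integrable BM mB tchi.
have lGB := mx_integrableS mB mD BD lG.
have [tF tF0 hsF] := superposition_close mB fB FL lchi k0.
have [tE tE0 hsE] := superposition_close mB fB EL' lchi k0.
pose tau := Num.min (Num.min tF tE) k.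
have tau0 : 0 < tau by rewrite !lt_min tF0 tE0 k0.
have tauF : tau <= tF by rewrite !ge_min lexx.
have tauE : tau <= tE by rewrite !ge_min lexx orbT.
have tauk : tau <= k by rewrite !ge_min lexx !orbT.
pose z x := (0 : 'M[R]_(N, n)) - G x.
have lz : mx_integrable B z := mx_integrableB mB (mx_integrable_cst 0 mB fB) lGB.
have [psi1 [A [tpsi1 [mA AB] At hA hI]]] := lusin_gradient oB BM lz tau0.
have zE : \int[mu]_(x in B) `|z x| = \int[mu]_(x in B) `|G x|.
  by apply: eq_Rintegral => x _; rewrite /z sub0r normrN.
have lpsi1 := jac_integrable BM mB tpsi1.
pose psi x := psi1 x + chi x.
have tpsi : test_function B psi := test_functionD tpsi1 tchi.
have jpsi x : jac psi x = jac psi1 x + jac chi x.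
  by rewrite /psi jacD//; [exact: (test_smooth tpsi1)|exact: (test_smooth tchi)].
have tpsiD := test_function_sub BD tpsi.
have lW : mx_integrable B (fun x => G x + jac psi x).
  exact: (mx_integrableD mB lGB (jac_integrable BM mB tpsi)).
have dE x : G x + jac psi x - jac chi x = jac psi1 x - z x.
  by rewrite jpsi /z sub0r opprK addrA addrK addrC.
have hdiff x : B x -> ~ A x -> `|G x + jac psi x - jac chi x| <= tau.
  by move=> Bx nA; rewrite dE; exact: hA.
have hIA : \int[mu]_(x in A) `|G x + jac psi x - jac chi x| <= (C + 2) * k.
  rewrite (_ : \int[mu]_(x in A) _ = \int[mu]_(x in A) `|jac psi1 x - z x|); last first.
    by apply: eq_Rintegral => x _; rewrite dE.
  have lpz := mx_integrableB mB lpsi1 lz.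
  apply: (@le_trans _ _ (\int[mu]_(x in B) `|jac psi1 x - z x|)).
    exact: (Rintegral_subset mB mA AB (Li_mx_norm mB lpz)).
  apply: (le_trans (Rintegral_normB oB lpsi1 lz)).
  have hCk : C * \int[mu]_(x in B) `|z x| <= C * k by rewrite zE; exact: ler_wpM2l.
  move: hI; rewrite -/C; move: hCk; rewrite zE.
  move: (\int[mu]_(x in B) `|jac psi1 x|) (C * \int[mu]_(x in B) `|G x|) BG => u v; lra.
have hF' := hsF _ A lW mA AB (le_trans At tauF) (fun x Bx nA => le_trans (hdiff x Bx nA) tauF).
have hE' := hsE _ A lW mA AB (le_trans At tauE) (fun x Bx nA => le_trans (hdiff x Bx nA) tauE).
have lFW := Li_growth mB fB FL lW; have lFc := Li_growth mB fB FL lchi.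
have lEW := Li_growth mB fB EL' lW; have lEc := Li_growth mB fB EL' lchi.
have hF2 : \int[mu]_(x in B) F (G x + jac psi x) <=
    \int[mu]_(x in B) F (jac chi x) + (k + L * ((C + 2) * k)).
  rewrite addrC -lerBlDr -(RintegralB mB lFW lFc).
  apply: (le_trans (Rintegral_le_norm mB (LiB mB lFW lFc))); apply: (le_trans hF').
  by rewrite lerD2l ler_pM2l.
have hE2 : \int[mu]_(x in B) Eint (jac chi x) <=
    \int[mu]_(x in B) Eint (G x + jac psi x) + (k + LE * ((C + 2) * k)).
  rewrite addrC -lerBlDr -(RintegralB mB lEc lEW).
  apply: (le_trans (Rintegral_le_norm mB (LiB mB lEc lEW))).
  rewrite (_ : \int[mu]_(x in B) _ =
      \int[mu]_(x in B) `|Eint (G x + jac psi x) - Eint (jac chi x)|); last first.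
    by apply: eq_Rintegral => x _; rewrite distrC.
  by apply: (le_trans hE'); rewrite lerD2l ler_pM2l.
have lWD : mx_integrable D (fun x => G x + jac psi x).
  exact: (mx_integrableD mD lG (jac_integrable DM mD tpsiD)).
have offB (K : 'M[R]_(N, n) -> R) : \int[mu]_(x in D `\` B) K (G x + jac psi x) =
    \int[mu]_(x in D `\` B) K (G x).
  by apply: eq_Rintegral => x; rewrite inE => -[_ nB]; rewrite (jac_supp tpsi nB) addr0.
exists psi; split => //.
- rewrite (Rintegral_split mD mB BD (Li_growth mD fD FL lWD)) offB.
  rewrite (Rintegral_split mD mB BD (Li_growth mD fD FL lG)).
  have hGB : - (2 * L * k) <= \int[mu]_(x in B) F (G x).
    rewrite lerNl; apply: (@le_trans _ _ `|\int[mu]_(x in B) F (G x)|).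
      by rewrite -normrN ler_norm.
    apply: (le_trans (Rintegral_growth mB fB FL lGB)); rewrite muB.
    rewrite (_ : 2 * L * k = L * (k + k)); last by ring.
    by rewrite ler_pM2l// lerD// (le_trans rnr).
  have hr : `|F 0| * r ^+ n <= `|F 0| * k by rewrite ler_wpM2l// (le_trans rnr).
  move: hF2 hF hGB hr ka2; rewrite lT /a2.
  rewrite (_ : k * (`|F 0| + 1 + L * (C + 2) + 2 * L) =
     `|F 0| * k + k + L * ((C + 2) * k) + 2 * L * k); last by ring.
  move: (\int[mu]_(x in B) F (G x + jac psi x)) (\int[mu]_(x in B) F (jac chi x))
    (\int[mu]_(x in B) F (G x)) (\int[mu]_(x in D `\` B) F (G x))
    (L * ((C + 2) * k)) (2 * L * k) (`|F 0| * k) (`|F 0| * r ^+ n) => b1 b2 b3 b4 b5 b6 b7 b8.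
  lra.
rewrite (Rintegral_split mD mB BD (Li_growth mD fD EL' lWD)).
have p0 : 0 <= \int[mu]_(x in D `\` B) Eint (G x + jac psi x).
  by apply: Rintegral_ge0 => x _; exact: Eint_ge0.
move: hE hE2 p0 ka1; rewrite /a1.
rewrite (_ : k * (1 + LE * (C + 2)) = k + LE * ((C + 2) * k)); last by ring.
rewrite -/B.
move: (\int[mu]_(x in B) Eint (jac chi x)) (\int[mu]_(x in B) Eint (G x + jac psi x))
  (\int[mu]_(x in D `\` B) Eint (G x + jac psi x)) (LE * ((C + 2) * k)) => b1 b2 b3 b4.
lra.
Qed.

End necessity.

(** * Unbounded minimizing sequences *)

Lemma enorm0 (R : realType) (p q : nat) : enorm (0 : 'M[R]_(p, q)) = 0.
Proof.
apply/eqP; rewrite eq_le enorm_ge0 andbT; apply: (le_trans (enorm_le_mx_norm _)).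
by rewrite normr0 mulr0.
Qed.

Section dirichlet.
Context {R : realType} {n N : nat}.
Notation mu := (@lebesgue_rV R n).
Variables (D : set 'rV[R]_n) (M : R).
Hypotheses (oD : open D) (DM : forall x, D x -> `|x| <= M).
Implicit Types (u v phi : 'rV[R]_n -> 'rV[R]_N).

Lemma W11_0_addl v phi : W11_0 D v -> test_function D phi -> W11_0 D (v \+ phi)%R.
Proof.
move=> [[G hG] hv] tphi; have hJ := jac_weak_gradient oD DM tphi.
have hS := weak_gradientD oD DM hG hJ.
split; first by exists (fun x => G x + jac phi x).
move=> e e0; have [psi tpsi hpsi] := hv e e0.
exists (fun x => psi x + phi x); first exact: test_functionD.
rewrite (_ : (v \+ phi) \- _ = v \- psi)%R//.
by apply/funext => x /=; rewrite opprD addrACA subrr addr0.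
Qed.

Lemma W11_0_zero : W11_0 D (fun=> 0 : 'rV[R]_N).
Proof.
have t0 := test_function0 (N := N) D; have hJ := jac_weak_gradient oD DM t0.
split; first by exists (jac (fun=> 0)).
move=> e e0; exists (fun=> 0) => //.
have h0 := weak_gradientB oD DM hJ hJ.
rewrite (W11normE oD DM h0) lte_fin.
have mD := measurable_rV_open oD.
have lt0 p q (f : 'rV[R]_n -> 'M[R]_(p, q)) : (forall x, f x = 0) ->
    \int[mu]_(x in D) enorm (f x) = 0.
  move=> f0; transitivity (\int[mu]_(x in D) (0 : R)).
    by apply: eq_Rintegral => x _; rewrite f0 enorm0.
  by rewrite Rintegral_cst// mul0r.
by rewrite !lt0 ?addr0// => x /=; rewrite subrr.
Qed.

End dirichlet.

Theorem proposition3p1 (R : realType) (n N : nat)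
    (hn : (2 <= n)%N) (hN : (2 <= N)%N)
    (F : 'M[R]_(N, n) -> R) (F_cont : continuous F)
    (F_growth : exists2 L : R, 0 < L & forall z, `|F z| <= L * (enorm z + 1))
    (Omega : set 'rV[R]_n) (hOmega : bounded_lipschitz_domain Omega)
    (g : 'rV[R]_n -> 'rV[R]_N) (hg : W11 Omega g) :
  (forall u : nat -> 'rV[R]_n -> 'rV[R]_N,
      minimizing_sequence F Omega g u -> W11_bounded Omega u) <->
  (exists (l : R) (z0 : 'M[R]_(N, n)),
      0 < l /\ quasiconvex_at (fun z => F z - l * Eint z) z0).
Proof.
have n0 : (0 < n)%N by exact: ltn_trans hn.
have [L0 L00 hF] := F_growth.
have FL := growth_enorm F_cont L00 hF; set L := L0 * _ in FL.
have [oD _ D0 bD _] := hOmega.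
have [M M0 DM] : exists2 M : R, 0 <= M & forall x, Omega x -> `|x| <= M.
  have [M1 [_ h]] := bD; exists (Num.max M1 0 + 1).
    by rewrite addr_ge0// le_max lexx orbT.
  by move=> x Dx; apply: h => //; rewrite ltr_pwDr// le_max lexx.
split; last first.
  move=> [l [z0 [l0 qc]]] u; exact: (minimizing_bounded oD DM FL l0 qc (Ordinal n0) M0 hg).
move=> hb; apply: contrapT => nex.
have unb (l C : R) : 0 < l -> exists2 phi : 'rV[R]_n -> 'rV[R]_N, test_function (@unit_cube R n) phi &
    \int[lebesgue_rV n]_(x in @unit_cube R n) (F (jac phi x) - l * Eint (jac phi x)) < - C.
  move=> l0; apply: contrapT => h; apply: nex.
  have [z0 qc] : exists z0, quasiconvex_at (fun z => F z - l / 2 * Eint z) z0.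
    apply: (quasiconvex_of_bounded_below (C := C) FL l0) => phi tphi.
    by rewrite leNgt; apply/negP => lt; apply: h; exists phi.
  by exists (l / 2), z0; split => //; rewrite divr_gt0.
have [G0 hG0] := hg.
have cl0 : dirichlet_class Omega g (g \+ (fun=> 0)).
  by exists (fun=> 0) => //; exact: W11_0_zero oD DM.
have ne : energy F Omega @` dirichlet_class Omega g != set0.
  by apply/set0P; exists (energy F Omega (g \+ (fun=> 0))); exists (g \+ (fun=> 0)).
have [e he cve] := ereal_inf_seq ne.
have /choice[w hw] : forall k, exists w : 'rV[R]_n -> 'rV[R]_N,
    [/\ dirichlet_class Omega g w, (energy F Omega w <= e k + (k.+1%:R^-1)%:E)%E &
     (k.+1%:R%:E <= W11norm Omega w)%E].
  move=> k; have [_ [v vW <-] <-] := he k.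
  have [[G hG] _] := vW; have hu := weak_gradientD oD DM hG0 hG.
  have [_ lu _] := hu.
  have k0 : 0 < k.+1%:R^-1 :> R by rewrite invr_gt0 ltr0n.
  have k1 : 0 < k.+1%:R :> R by rewrite ltr0n.
  have [psi [tpsi h1 h2]] := perturb n0 FL unb oD D0 DM lu k0 k1.
  have hpsi := jac_weak_gradient oD DM tpsi.
  have hw := weak_gradientD oD DM hu hpsi; have [lw lGw _] := hw.
  exists ((g \+ v) \+ psi); split.
  - exists (v \+ psi); first by apply: (W11_0_addl oD DM).
    by apply/funext => x /=; rewrite addrA.
  - by rewrite (energyE oD DM FL hw) (energyE oD DM FL hu) -EFinD lee_fin.
  rewrite (W11normE oD DM hw) lee_fin; apply: (le_trans h2).
  have mD := measurable_rV_open oD; have fD := lebesgue_bounded_lt_oo mD DM.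
  rewrite ler_wpDl//; first by apply: Rintegral_ge0 => x _; exact: enorm_ge0.
  apply: (le_Rintegral mD (Li_growth mD fD (@Eint_growth R n N) lGw) (Li_enorm mD lGw)).
  by move=> x _; exact: Eint_le.
have mw : minimizing_sequence F Omega g w.
  split=> [k|]; first by case: (hw k).
  (* The energies of w lie between the infimum and e k + 1 / (k + 1); this
     includes the case where the infimum is -oo. *)
  have h0 : ((k.+1%:R^-1 : R)%:E @[k --> \oo] --> (0 : R)%:E)%E.
    by apply: cvg_EFin; [exact: nearW|exact: cvg_harmonic].
  have h1 : (e k + (k.+1%:R^-1)%:E @[k --> \oo] -->
      ereal_inf (energy F Omega @` dirichlet_class Omega g))%E.
    rewrite -[X in _ --> X]adde0; apply: cvgeD => //.
    exact: fin_num_adde_defl.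
  apply: (squeeze_cvge _ (cvg_cst _) h1); apply: nearW => k.
  have [h2 h3 _] := hw k; rewrite h3 andbT.
  by apply: ereal_inf_lbound; exists (w k).
have [B hB] := hb w mw.
have [k _ /(_ k (leqnn k)) hk] : \forall k \near \oo, B < k%:R.
  exact: nbhs_infty_gtr.
have [_ _ h3] := hw k; have := le_trans h3 (hB k).
by rewrite lee_fin leNgt (lt_trans hk)// ltr_nat.
Qed.
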